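(* Let $K$ be algebraically closed of characteristic $p\ge0$ and let $\mathcal X$ be a $(g+1)$-curve over $K$ of genus $g>2$, with $g+1$ prime. (a) If $\mathcal X$ is tame ($p\ne g+1$), then $\mathcal X$ is birationally equivalent to a plane curve $$\mathcal X_{r,s,t,a}:\ Y^{g+1}=X^r(X-1)^s(X-a)^t,$$ where $a\in K\setminus\{0,1\}$ and $r,s,t$ are integers with $1\le r,s,t\le g$ and $r+s+t\not\equiv 0\pmod{g+1}$. (b) If $\mathcal X$ is wild ($p=g+1$), then $\mathcal X$ is birationally equivalent either to a curve $$\mathcal Y_{a,b,c}:\ Y^{g+1}-Y=\frac{aX^2+bX+c}{X(X-1)},$$ with $(a,b,c)\in K^3\setminus\{(0,0,0)\}$ and $\gcd(aX^2+bX+c,\,X(X-1))=1$, or to a curve $$\mathcal Z_{d,e,\ell}:\ Y^{g+1}-Y=X^3+dX^2+eX+\ell,$$ with $d,e,\ell\in K$.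
   Context: A $q$-curve ($q$ prime) is a curve whose automorphism group contains a subgroup of order $q$; it is tame if $p=0$ or $q\ne p$, and wild if $q=p$. *)

(* Defs.v *)
(* An (irreducible, projective, nonsingular) curve over an
   algebraically closed field K is handled, up to birational equivalence,
   through its function field F: a field F together with an embedding
   iota : K -> F, such that F is a function field of one variable over K. *)
From HB Require Import structures.
From mathcomp Require Import all_boot all_order all_algebra.
From mathcomp Require Import boolp.
Set Implicit Arguments. Unset Strict Implicit. Unset Printing Implicit Defensive.
Import Order.TTheory GRing.Theory Num.Theory.
Local Open Scope ring_scope.

Section FunctionFields.
Variables (K : closedFieldType) (F : fieldType) (iota : {rmorphism K -> F}).

Definition evalK (P : {poly K}) (z : F) : F := (map_poly iota P).[z].

Definition eval2K (P : {poly {poly K}}) (x y : F) : F :=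
  (map_poly (fun c => evalK c x) P).[y].

Definition transcendentalK (x : F) : Prop :=
  forall P : {poly K}, evalK P x = 0 -> P = 0.

Definition function_field : Prop :=
  exists x : F, transcendentalK x /\
  exists (n : nat) (b : 'I_n -> F), forall f : F,
    exists PQ : 'I_n -> {poly K} * {poly K},
      (forall i, evalK (PQ i).2 x != 0) /\
      f = \sum_(i < n) (evalK (PQ i).1 x / evalK (PQ i).2 x) * b i.

(* places of F/K, given by their normalized discrete valuations (trivial on K);
   the value at 0 is conventionally fixed to 0 (it stands for +oo) *)
Definition is_place (v : F -> int) : Prop :=
  [/\ v 0 = 0, exists t, v t = 1,
      forall x y, x != 0 -> y != 0 -> v (x * y) = v x + v y,
      forall x y, x != 0 -> y != 0 -> x + y != 0 ->
        Num.min (v x) (v y) <= v (x + y)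
    & forall k : K, k != 0 -> v (iota k) = 0].

Definition divisor := seq ((F -> int) * int).
Definition is_divisor (D : divisor) : Prop := forall p, p \in D -> is_place p.1.
Definition divcoef (D : divisor) (w : F -> int) : int :=
  \sum_(p <- D) (if `[< p.1 = w >] then p.2 else 0).
(* all places have degree 1 since K is algebraically closed *)
Definition divdeg (D : divisor) : int := \sum_(p <- D) p.2.

Definition inL (D : divisor) (f : F) : Prop :=
  f = 0 \/ forall w, is_place w -> - divcoef D w <= w f.

Definition K_independent (n : nat) (f : 'I_n -> F) : Prop :=
  forall c : 'I_n -> K, \sum_(i < n) iota (c i) * f i = 0 -> forall i, c i = 0.

Definition ell (D : divisor) (n : nat) : Prop :=
  (exists f : 'I_n -> F, (forall i, inL D (f i)) /\ K_independent f) /\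
  (forall f : 'I_n.+1 -> F, (forall i, inL D (f i)) -> ~ K_independent f).

Definition genus (g : nat) : Prop :=
  (forall D n, is_divisor D -> ell D n -> divdeg D - n%:Z + 1 <= g%:Z) /\
  (exists D n, [/\ is_divisor D, ell D n & divdeg D - n%:Z + 1 = g%:Z]).

Definition K_automorphism (s : F -> F) : Prop :=
  [/\ forall x y, s (x + y) = s x + s y,
      forall x y, s (x * y) = s x * s y,
      s 1 = 1, bijective s
    & forall k : K, s (iota k) = iota k].

(* the automorphism group contains a subgroup of prime order q, i.e. an
   automorphism of order q *)
Definition q_curve (q : nat) : Prop :=
  prime q /\ exists s : F -> F,
    [/\ K_automorphism s, forall f, iter q s f = f & exists f, s f != f].

Definition generates2 (x y : F) : Prop :=
  forall f : F, exists P Q : {poly {poly K}},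
    eval2K Q x y != 0 /\ f = eval2K P x y / eval2K Q x y.

End FunctionFields.

(* Main.v *)
(** The genus hypothesis is used as Riemann's theorem: [deg D - l(D) + 1 <= g] for
    all divisors, with equality in large degree.  This alone shows that functions have
    finitely many poles and principal divisors degree zero: a function in [L(D)] with
    [deg D < 0] would embed the large spaces [L(-kD)] in [L(0)].

    Let [s] be the automorphism of order [q = g + 1].  The fixed field [F^s] is
    studied through the spaces [L(pull D)^s], where [pull D] replaces a place by the
    sum of its [q] conjugates; [pull D] is the pullback of a divisor of the quotient
    curve, whose genus minus one is the maximum of [psi D = deg D - dim L(pull D)^s].
    Filtering [L(pull D)] by the operators [(s - lam_0) ... (s - lam_(i-1))], with
    [lam_i = z^i] (tame) or [lam_i = 1] (wild), and comparing with Riemann's theorem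
    on [F] is the Riemann-Hurwitz formula.

    Tame case: [F = F^s(y)] with [s y = z y]; the i-th graded piece is
    [y^i L(pull (D + E_i))^s], where [E_i] rounds down [i div(y)] at the fixed places.
    With [n] fixed places this gives [2 q - 4 = 2 q max(psi) + n (q - 1)], whence
    the quotient has genus zero and [n = 4].  Wild case: the graded pieces all lie in
    [L(pull D)^s], so the quotient has genus at most one; if it had genus one, the
    first graded piece would be everything, and the base-point-free pencil trick
    would make all of them full, contradicting [g <> 1].  Then [y] with [s y = y + 1]
    can be chosen with poles at the fixed places only and orders [m_P] prime to [q],
    and the same count gives [sum (m_P + 1) = 4].

    Genus zero gives [x] with [F^s = K(x)], and the equation of [y] is read off from
    its divisor. *)
Require Import Defs.
From HB Require Import structures.
From mathcomp Require Import all_boot all_order all_algebra.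
From mathcomp Require Import boolp.
From mathcomp Require Import zify ring.
Import Order.TTheory GRing.Theory Num.Theory.
Local Open Scope ring_scope.
Set Implicit Arguments. Unset Strict Implicit. Unset Printing Implicit Defensive.

(** * Linear algebra over the constants *)

Section LinearAlgebra.
Variables (K : closedFieldType) (F : fieldType) (iota : {rmorphism K -> F}).
Implicit Types (V W : F -> Prop) (u v w : F) (k : K).

(** The hypotheses speak only of [F]; neither the fixed field nor the quotient curve is constructed.
    This is why [pull D] sums all [q] translates with multiplicity: at a fixed place its coefficient
    is a multiple of [q], the ramification index, and its degree is always [q deg D]. Two facts make
    this model faithful: residue fields are [K] (a count of monomials gives an algebraic relation
    with a uniformizer, which is reduced modulo the place), and [s] is totally ramified at each
    place it fixes. The genus is only given as a maximum; that it is reached in every large degree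
    follows from one argument, used for [F] itself (identity automorphism) and for the quotient. In
    large degree, comparing [dim L(pull D)] with the sum of the [dim L(pull (E_i + D))^s] gives
    [sum deg E_i = q m + 1 - g], where [m] is the maximum of [psi]. As [q = g + 1], for [m = -1] the
    right side is [-2 g]; this is the origin of the 4 in both cases. *)

Definition subsp V := V 0 /\ forall k u v, V u -> V v -> V (iota k * u + v).

Lemma subspD V u v : subsp V -> V u -> V v -> V (u + v).
Proof. by move=> [_ h] hu hv; have := h 1 u v hu hv; rewrite rmorph1 mul1r. Qed.

Lemma subspZ V k u : subsp V -> V u -> V (iota k * u).
Proof. by move=> [h0 h] hu; have := h k u 0 hu h0; rewrite addr0. Qed.

Lemma subspB V u v : subsp V -> V u -> V v -> V (u - v).
Proof.
by move=> hV hu hv; have := hV.2 (-1) v u hv hu; rewrite rmorphN1 mulN1r addrC.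
Qed.

Lemma subsp_sum V (I : finType) (c : I -> K) (f : I -> F) :
  subsp V -> (forall i, V (f i)) -> V (\sum_i iota (c i) * f i).
Proof.
move=> hV hf; apply: big_ind; first exact: hV.1.
  by move=> x y; apply: subspD.
by move=> i _; apply: subspZ.
Qed.

Definition indep (I : finType) (f : I -> F) :=
  forall c : I -> K, \sum_i iota (c i) * f i = 0 -> forall i, c i = 0.

Definition hasdim V n := exists b : 'I_n -> F,
  [/\ forall i, V (b i), indep b
    & forall u, V u -> exists c : 'I_n -> K, u = \sum_i iota (c i) * b i].

(** A vector in the left kernel of the coefficient matrix. Arbitrary finite index types allow
    families indexed by pairs, such as monomials in two functions. *)
Lemma dep_fin (I J : finType) (z : I -> F) (b : J -> F) (A : I -> J -> K) :
  (forall i, z i = \sum_j iota (A i j) * b j) -> (#|J| < #|I|)%N ->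
  exists c : I -> K, (exists i, c i != 0) /\ \sum_i iota (c i) * z i = 0.
Proof.
move=> hz hIJ.
pose M := \matrix_(i < #|I|, j < #|J|) A (enum_val i) (enum_val j).
have : kermx M != 0.
  rewrite kermx_eq0 /row_free neq_ltn (leq_ltn_trans (rank_leq_col M)) //.
case/matrix0Pn => i0 [j0 hij]; pose r := row i0 (kermx M).
have hr : r *m M = 0 by rewrite -row_mul mulmx_ker row0.
exists (fun i => r 0 (enum_rank i)); split.
  by exists (enum_val j0); rewrite enum_valK mxE.
under eq_bigr => i _ do rewrite hz mulr_sumr.
rewrite exchange_big big1 // => j _.
have := congr1 (fun m : 'rV_ _ => m 0 (enum_rank j)) hr; rewrite mxE.
rewrite [in X in _ = X]mxE => /(congr1 iota); rewrite rmorph0 rmorph_sum /= => h.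
transitivity (b j * \sum_i iota (r 0 (enum_rank i) * A i j)).
  by rewrite mulr_sumr; apply: eq_bigr => i _; rewrite rmorphM; ring.
rewrite (reindex _ (onW_bij _ (@enum_rank_bij I))) /= in h.
rewrite (_ : \sum_i _ = 0) ?mulr0 // -[RHS]h; apply: eq_bigr => i _.
by rewrite !mxE !enum_rankK.
Qed.

Lemma hasdim_dep V n (I : finType) (z : I -> F) :
  hasdim V n -> (forall i, V (z i)) -> (n < #|I|)%N ->
  exists c : I -> K, (exists i, c i != 0) /\ \sum_i iota (c i) * z i = 0.
Proof.
move=> [b [_ _ hb]] hz hn.
pose A i := sval (cid (hb _ (hz i))).
apply: (@dep_fin I 'I_n z b A); last by rewrite card_ord.
by move=> i; rewrite /A; case: cid.
Qed.

Lemma hasdim_indep V n (I : finType) (z : I -> F) :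
  hasdim V n -> (forall i, V (z i)) -> indep z -> (#|I| <= n)%N.
Proof.
move=> hV hz hi; rewrite leqNgt; apply/negP => hn.
have [c [[i /eqP hci] hc]] := hasdim_dep hV hz hn.
by apply: hci; apply: hi.
Qed.

Lemma hasdim_uniq V m n : hasdim V m -> hasdim V n -> m = n.
Proof.
move=> hm hn; apply/eqP; rewrite eqn_leq.
have [b [hb ib _]] := hm; have [b' [hb' ib' _]] := hn.
have := hasdim_indep hn hb ib; have := hasdim_indep hm hb' ib'.
by rewrite !card_ord => -> ->.
Qed.

Definition fcons (T : Type) n (u : T) (b : 'I_n -> T) (i : 'I_n.+1) : T :=
  oapp b u (unlift ord0 i).

Lemma fcons0 n u (b : 'I_n -> F) : fcons u b ord0 = u.
Proof. by rewrite /fcons unlift_none. Qed.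

Lemma fconsS n u (b : 'I_n -> F) i : fcons u b (lift ord0 i) = b i.
Proof. by rewrite /fcons liftK. Qed.

Lemma fcons_all V n u (b : 'I_n -> F) :
  V u -> (forall i, V (b i)) -> forall i, V (fcons u b i).
Proof.
by move=> hu hb i; case: (unliftP ord0 i) => [j|] ->; rewrite ?fconsS ?fcons0.
Qed.

Lemma indep_fcons n u (b : 'I_n -> F) :
  indep b -> (forall c : 'I_n -> K, u <> \sum_i iota (c i) * b i) ->
  indep (fcons u b).
Proof.
move=> hb hu c; rewrite big_ord_recl fcons0.
under eq_bigr => i _ do rewrite fconsS.
move=> hc.
have c0 : c ord0 = 0.
  apply: contrapT => /eqP hn.
  apply: (hu (fun i => - (c ord0)^-1 * c (lift ord0 i))).
  have h0 : iota (c ord0) != 0 by rewrite fmorph_eq0.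
  apply: (mulfI h0); rewrite mulr_sumr.
  have /eqP := hc; rewrite addr_eq0 => /eqP ->; rewrite -sumrN.
  apply: eq_bigr => i _; rewrite rmorphM rmorphN fmorphV; field.
  by [].
move=> i; case: (unliftP ord0 i) => [j|] -> //.
move: hc; rewrite c0 rmorph0 mul0r add0r => hc.
exact: (hb (fun i => c (lift ord0 i))).
Qed.

Lemma hasdim_ex V n : subsp V ->
  (forall f : 'I_n.+1 -> F, (forall i, V (f i)) -> ~ indep f) ->
  exists2 m, (m <= n)%N & hasdim V m.
Proof.
move=> hV; elim: n => [|n IH] h.
  exists 0%N => //; exists (fun _ => 0); split.
  - by case.
  - by move=> c _ [].
  move=> u hu; exists (fun _ => 0); rewrite big_ord0.
  apply: contrapT => /eqP hn; apply: (h (fun _ => u)) => // c.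
  rewrite big_ord_recl big_ord0 addr0 => /eqP.
  rewrite mulf_eq0 (negPf hn) orbF fmorph_eq0 => /eqP hc i.
  by rewrite (ord1 i).
have [[f [hf hi]]|hno] := pselect (exists f : 'I_n.+1 -> F,
   (forall i, V (f i)) /\ indep f); last first.
  have [|m hm hd] := IH; last by exists m => //; exact: leqW.
  by move=> f hf hi; apply: hno; exists f.
exists n.+1 => //; exists f; split=> // u hu.
apply: contrapT => hno; apply: (h (fcons u f)).
  exact: fcons_all.
by apply: indep_fcons => // c hc; apply: hno; exists c.
Qed.

Lemma hasdim_sub V W n : subsp W -> (forall u, W u -> V u) -> hasdim V n ->
  exists2 m, (m <= n)%N & hasdim W m.
Proof.
move=> hW hWV hV; apply: hasdim_ex => // f hf hi.
have := @hasdim_indep _ _ _ f hV (fun i => hWV _ (hf i)) hi.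
by rewrite card_ord ltnn.
Qed.

Lemma hasdim_eq V W n : subsp W -> (forall u, W u -> V u) -> hasdim V n ->
  hasdim W n -> forall u, V u -> W u.
Proof.
move=> sW hWV hV [b [hb ib _]] u hu.
have [[c ->]|hno] := pselect (exists c : 'I_n -> K, u = \sum_i iota (c i) * b i).
  exact: subsp_sum.
have := hasdim_indep hV (fcons_all hu (fun i => hWV _ (hb i))).
rewrite card_ord ltnn => h; exfalso; suff: false by []; apply: h.
by apply: indep_fcons => // c hc; apply: hno; exists c.
Qed.

Lemma hasdim_codim1 V W n : subsp W -> (forall u, W u -> V u) ->
  (forall u v, V u -> V v -> ~ W v -> exists k, W (u - iota k * v)) ->
  hasdim W n -> exists2 m, (m <= n.+1)%N & hasdim V m.
Proof.
move=> sW hWV h hW; have [b [hb ib gb]] := hW.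
have [hall|] := pselect (forall u, V u -> W u).
  exists n => //; exists b; split=> // [i|u /hall/gb//]; exact: hWV.
move=> /asboolPn/existsp_asboolPn [v /asboolPn/imply_asboolPn [hv nW]].
exists n.+1 => //; exists (fcons v b); split.
- by apply: fcons_all => // i; apply: hWV.
- by apply: indep_fcons => // c hc; apply: nW; rewrite hc; apply: subsp_sum.
move=> u hu; have [k /gb [c hc]] := h _ _ hu hv nW.
exists (fcons k c).
rewrite big_ord_recl /fcons unlift_none /=.
under eq_bigr => i _ do rewrite !liftK /=.
by rewrite -hc addrC subrK.
Qed.

Definition klinear (Phi : F -> F) :=
  forall k u v, Phi (iota k * u + v) = iota k * Phi u + Phi v.

Lemma klinear0 Phi : klinear Phi -> Phi 0 = 0.
Proof.
move=> h; have := h (-1) 0 0; rewrite mulr0 addr0 rmorphN1 mulN1r.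
by rewrite addrC subrr.
Qed.

Lemma klinearZ Phi k u : klinear Phi -> Phi (iota k * u) = iota k * Phi u.
Proof. by move=> h; have := h k u 0; rewrite !addr0 klinear0 // addr0. Qed.

Lemma klinearD Phi u v : klinear Phi -> Phi (u + v) = Phi u + Phi v.
Proof. by move=> h; have := h 1 u v; rewrite rmorph1 !mul1r. Qed.

Lemma klinearN Phi u : klinear Phi -> Phi (- u) = - Phi u.
Proof. by move=> h; rewrite -mulN1r -(rmorphN1 iota) klinearZ // rmorphN1 mulN1r. Qed.

Lemma klinearB Phi u v : klinear Phi -> Phi (u - v) = Phi u - Phi v.
Proof. by move=> h; rewrite klinearD // klinearN. Qed.

Lemma klinear_sum Phi (I : finType) (c : I -> K) (f : I -> F) : klinear Phi ->
  Phi (\sum_i iota (c i) * f i) = \sum_i iota (c i) * Phi (f i).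
Proof.
move=> h; elim/big_ind2: _ => [|x x' y y' <- <-|i _]; first exact: klinear0.
  exact: klinearD.
exact: klinearZ.
Qed.

Lemma rank_nullity V Phi a b : klinear Phi ->
  hasdim (fun u => V u /\ Phi u = 0) a ->
  hasdim (fun w => exists2 u, V u & Phi u = w) b -> subsp V -> hasdim V (a + b).
Proof.
move=> lP [e [he ie ge]] [f [hf jf gf]] sV.
pose p i := s2val (cid2 (hf i)).
have hp i : V (p i) by rewrite /p; case: cid2.
have hq i : Phi (p i) = f i by rewrite /p; case: cid2.
pose z (i : 'I_(a + b)) := match split i with inl j => e j | inr j => p j end.
have zl j : z (lshift b j) = e j by rewrite /z (unsplitK (inl j : 'I_a + 'I_b)).
have zr j : z (rshift a j) = p j by rewrite /z (unsplitK (inr j : 'I_a + 'I_b)).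
have Pe j : Phi (e j) = 0 by case: (he j).
exists z; split.
- by move=> i; rewrite /z; case: split => j //; case: (he j).
- move=> c; rewrite big_split_ord /=.
  under eq_bigr => i _ do rewrite zl.
  under [X in _ + X = _]eq_bigr => i _ do rewrite zr.
  move=> hc.
  have cr j : c (rshift a j) = 0.
    apply: (jf (fun j => c (rshift a j))).
    have := congr1 Phi hc; rewrite klinear0 // klinearD // !(klinear_sum _ _ lP).
    rewrite big1 ?add0r => [|i _]; last by rewrite Pe mulr0.
    by under eq_bigr => i _ do rewrite hq.
  move: hc; rewrite [X in _ + X]big1 ?addr0 => [|i _]; last first.
    by rewrite cr rmorph0 mul0r.
  move=> /(ie (fun j => c (lshift b j))) cl i.
  by rewrite -(splitK i); case: split.
move=> u hu; have [d hd] := gf (Phi u) (ex_intro2 _ _ u hu erefl).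
have [|c hc] := ge (u - \sum_i iota (d i) * p i).
  split; first by apply: subspB => //; apply: subsp_sum.
  rewrite klinearB // (klinear_sum _ _ lP) hd.
  by under [X in _ - X]eq_bigr => i _ do rewrite hq; rewrite subrr.
exists (fun i => match split i with inl j => c j | inr j => d j end).
rewrite big_split_ord /=.
under eq_bigr => i _ do rewrite zl (unsplitK (inl i : 'I_a + 'I_b)).
under [X in _ + X]eq_bigr => i _ do rewrite zr (unsplitK (inr i : 'I_a + 'I_b)).
by rewrite -hc subrK.
Qed.

Lemma hasdim_iso V W Phi n : klinear Phi -> (forall u, Phi u = 0 -> u = 0) ->
  (forall u, V u -> W (Phi u)) -> (forall w, W w -> exists2 u, V u & Phi u = w) ->
  hasdim V n -> hasdim W n.
Proof.
move=> lP iP hVW hWV [b [hb ib gb]]; exists (fun i => Phi (b i)); split.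
- by move=> i; apply: hVW.
- by move=> c; rewrite -(klinear_sum _ _ lP) => /iP/ib.
move=> w /hWV [u /gb [c hc] <-]; exists c.
by rewrite hc klinear_sum.
Qed.

(* [0] when [V] is infinite dimensional. *)
Definition dim V : nat :=
  if pselect (exists n, hasdim V n) is left e then sval (cid e) else 0%N.
Definition fdim V := exists n, hasdim V n.

Lemma dimP V : fdim V -> hasdim V (dim V).
Proof. by rewrite /dim => h; case: pselect => // e; case: cid. Qed.

Lemma dimE V n : hasdim V n -> dim V = n.
Proof.
by move=> h; have := dimP (ex_intro _ n h); move/hasdim_uniq; apply.
Qed.

Lemma eq_dim V W : (forall u, V u <-> W u) -> dim V = dim W.
Proof. by move=> h; congr dim; apply: funext => u; apply: propext. Qed.

Lemma fdim_sub V W : subsp W -> (forall u, W u -> V u) -> fdim V -> fdim W.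
Proof. by move=> sW h [n /(hasdim_sub sW h) [m _ hm]]; exists m. Qed.

Lemma dim_sub V W : subsp W -> (forall u, W u -> V u) -> fdim V ->
  (dim W <= dim V)%N.
Proof.
by move=> sW h [n hn]; have [m ? hm] := hasdim_sub sW h hn; rewrite (dimE hn) (dimE hm).
Qed.

Lemma dim_inj V W Phi : klinear Phi -> (forall u, Phi u = 0 -> u = 0) ->
  (forall u, V u -> W (Phi u)) -> fdim V -> fdim W -> (dim V <= dim W)%N.
Proof.
move=> lP iP h fV fW; have [b [hb ib _]] := dimP fV.
have := hasdim_indep (dimP fW) (fun i => h _ (hb i)); rewrite card_ord; apply.
by move=> c; rewrite -(klinear_sum _ _ lP) => /iP/ib.
Qed.

Lemma dim_sub_eq V W : subsp W -> (forall u, W u -> V u) -> fdim V ->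
  (dim V <= dim W)%N -> forall u, V u -> W u.
Proof.
move=> sW h fV hd; have fW := fdim_sub sW h fV.
apply: (hasdim_eq sW h (dimP fV)).
rewrite (_ : dim V = dim W); first exact: dimP.
by apply/eqP; rewrite eqn_leq hd dim_sub.
Qed.

Lemma dim_gt0_ex V : fdim V -> (0 < dim V)%N -> exists2 u, V u & u != 0.
Proof.
move=> fV; have [b [hb ib _]] := dimP fV.
case: (dim V) b hb ib => // n b hb ib _; exists (b ord0) => //.
apply/eqP => h0.
have := ib (fun i => (i == ord0)%:R); rewrite big_ord_recl h0 mulr0 add0r.
rewrite big1 => [/(_ erefl ord0)/eqP|i _]; last by rewrite rmorph0 mul0r.
by rewrite eqxx oner_eq0.
Qed.
End LinearAlgebra.

(** * Places and algebraic dependence *)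

Section Places.
Variables (K : closedFieldType) (F : fieldType) (iota : {rmorphism K -> F}).
Implicit Types (u w : F) (k : K).

(* [vge v m u] is [v u >= m] with the usual convention [v 0 = +oo]. *)
Definition vge (v : F -> int) (m : int) u := u = 0 \/ m <= v u.

Variable v : F -> int.
Hypothesis pv : is_place iota v.

Lemma placeM u w : u != 0 -> w != 0 -> v (u * w) = v u + v w.
Proof. by case: pv => _ _ h _ _; apply: h. Qed.

Lemma placeK k : k != 0 -> v (iota k) = 0.
Proof. by case: pv => _ _ _ _; apply. Qed.

Lemma place1 : v 1 = 0.
Proof. by rewrite -(rmorph1 iota) placeK ?oner_eq0. Qed.

Lemma placeV u : u != 0 -> v u^-1 = - v u.
Proof.
move=> u0; have := placeM u0 (_ : u^-1 != 0); rewrite invr_eq0 => /(_ u0).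
by rewrite mulfV // place1 => h; lia.
Qed.

Lemma place_div u w : u != 0 -> w != 0 -> v (u / w) = v u - v w.
Proof. by move=> u0 w0; rewrite placeM ?invr_eq0 // placeV. Qed.

Lemma placeX u n : u != 0 -> v (u ^+ n) = n%:Z * v u.
Proof.
move=> u0; elim: n => [|n IH]; first by rewrite expr0 place1 mul0r.
by rewrite exprS placeM ?expf_neq0 // IH; lia.
Qed.

Lemma placeZ k u : k != 0 -> v (iota k * u) = v u.
Proof.
move=> k0; have [->|u0] := eqVneq u 0; first by rewrite mulr0.
by rewrite placeM ?fmorph_eq0 // placeK // add0r.
Qed.

Lemma placeN u : v (- u) = v u.
Proof. by rewrite -mulN1r -(rmorphN1 iota) placeZ // oppr_eq0 oner_eq0. Qed.

Lemma vge_refl u : vge v (v u) u. Proof. by right. Qed.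

Lemma vge_ge m u : vge v m u -> u != 0 -> m <= v u.
Proof. by case=> [->|//]; rewrite eqxx. Qed.

Lemma vge_le m n u : n <= m -> vge v m u -> vge v n u.
Proof. by move=> h [->|h']; [left|right; apply: le_trans h']. Qed.

Lemma vge_mul m n u w : vge v m u -> vge v n w -> vge v (m + n) (u * w).
Proof.
move=> [->|hu]; first by rewrite mul0r; left.
move=> [->|hw]; first by rewrite mulr0; left.
have [->|u0] := eqVneq u 0; first by rewrite mul0r; left.
have [->|w0] := eqVneq w 0; first by rewrite mulr0; left.
by right; rewrite placeM // lerD.
Qed.

Lemma vge_mulr m u w : vge v m u -> vge v 0 w -> vge v m (u * w).
Proof. by move=> hu hw; have := vge_mul hu hw; rewrite addr0. Qed.

Lemma vge_exp m u n : vge v m u -> vge v (n%:Z * m) (u ^+ n).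
Proof.
move=> h; elim: n => [|n IH]; first by right; rewrite expr0 place1 mul0r.
by rewrite exprS; have := vge_mul h IH; congr vge; lia.
Qed.

Lemma vgeD m u w : vge v m u -> vge v m w -> vge v m (u + w).
Proof.
move=> hu hw; have [->|u0] := eqVneq u 0; first by rewrite add0r.
have [->|w0] := eqVneq w 0; first by rewrite addr0.
have [->|uw0] := eqVneq (u + w) 0; first by left.
right; case: pv => _ _ _ h _; apply: le_trans (h _ _ u0 w0 uw0).
by rewrite le_min !vge_ge.
Qed.

Lemma vgeZ m k u : vge v m u -> vge v m (iota k * u).
Proof.
have [->|k0] := eqVneq k 0; first by rewrite rmorph0 mul0r; left.
by move=> [->|h]; [left; rewrite mulr0|right; rewrite placeZ].
Qed.

Lemma vgeK m k : m <= 0 -> vge v m (iota k).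
Proof.
move=> hm; rewrite -[iota k]mulr1; apply: vgeZ.
by right; rewrite place1.
Qed.

Lemma subsp_vge m : subsp iota (vge v m).
Proof. by split=> [|k u w hu hw]; [left|apply: vgeD => //; apply: vgeZ]. Qed.

Lemma vgeB m u w : vge v m u -> vge v m w -> vge v m (u - w).
Proof. exact: subspB (subsp_vge m). Qed.

Lemma vgeN m u : vge v m u -> vge v m (- u).
Proof. by move=> h; rewrite -sub0r; apply: vgeB => //; left. Qed.

Lemma vge_sum m (I : finType) (f : I -> F) :
  (forall i, vge v m (f i)) -> vge v m (\sum_i f i).
Proof. by move=> h; apply: big_ind => //; [left|apply: vgeD]. Qed.

Lemma vge_eq0 u : (forall n : nat, vge v n%:Z u) -> u = 0.
Proof.
move=> h; apply: contrapT => /eqP u0.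
by have := vge_ge (h `|v u|.+1) u0; lia.
Qed.

Lemma place_add_lt u w : u != 0 -> vge v (v u + 1) w ->
  u + w != 0 /\ v (u + w) = v u.
Proof.
move=> u0 hw; have h0 : u + w != 0.
  apply/eqP => /addr0_eq h; move: hw; rewrite -h => /vge_ge.
  by rewrite oppr_eq0 placeN => /(_ u0); lia.
split=> //; apply/eqP; rewrite eq_le; apply/andP; split; last first.
  by apply: vge_ge h0; apply: vgeD; [right|apply: vge_le hw; lia].
rewrite leNgt; apply/negP => hlt.
have : vge v (v u + 1) (u + w - w).
  by apply: vgeB => //; right; lia.
by rewrite addrK => /vge_ge /(_ u0); lia.
Qed.

End Places.

(** * Transcendence degree one and residue fields *)

Section AlgebraicDependence.
Variables (K : closedFieldType) (F : fieldType) (iota : {rmorphism K -> F}).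
Local Notation ev P x := (evalK iota P x).

Lemma evalKE (P : {poly K}) x n : (size P <= n)%N ->
  ev P x = \sum_(i < n) iota P`_i * x ^+ i.
Proof.
move=> hn; rewrite /evalK (horner_coef_wide _ (n := n)) ?size_map_poly //.
by apply: eq_bigr => i _; rewrite coef_map.
Qed.

Lemma evalK0 x : ev 0 x = 0. Proof. by rewrite /evalK rmorph0 horner0. Qed.

Lemma evalKM P Q x : ev (P * Q) x = ev P x * ev Q x.
Proof. by rewrite /evalK rmorphM hornerM. Qed.

Lemma evalKD P Q x : ev (P + Q) x = ev P x + ev Q x.
Proof. by rewrite /evalK rmorphD hornerD. Qed.

Lemma evalK_sum (I : finType) (P : I -> {poly K}) x :
  ev (\sum_i P i) x = \sum_i ev (P i) x.
Proof. by rewrite /evalK rmorph_sum horner_sum. Qed.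

Lemma evalK_prod (I : finType) (P : I -> {poly K}) x :
  ev (\prod_i P i) x = \prod_i ev (P i) x.
Proof. by rewrite /evalK rmorph_prod horner_prod. Qed.

Lemma evalKC c x : ev c%:P x = iota c.
Proof. by rewrite /evalK map_polyC hornerC. Qed.

Lemma evalK_split (P : {poly K}) : exists r : seq K, forall x,
  ev P x = iota (lead_coef P) * \prod_(z <- r) (x - iota z).
Proof.
have [r hr] := closed_field_poly_normal P; exists r => x.
rewrite [in LHS]hr /evalK linearZ /= hornerZ rmorph_prod horner_prod.
congr (_ * _); apply: eq_bigr => z _.
by rewrite rmorphB /= map_polyX map_polyC hornerXsubC.
Qed.

Lemma algebraic_const (P : {poly K}) x :
  P != 0 -> ev P x = 0 -> exists k, x = iota k.
Proof.
move=> P0; have [r ->] := evalK_split P; move/eqP.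
rewrite mulf_eq0 fmorph_eq0 lead_coef_eq0 (negPf P0) /= prodf_seq_eq0.
by case/hasP => z _ /=; rewrite subr_eq0 => /eqP ->; exists z.
Qed.

Lemma eval2K_poly n (E : nat -> {poly K}) x y :
  eval2K iota (\poly_(i < n) E i) x y = \sum_(i < n) ev (E i) x * y ^+ i.
Proof.
rewrite /eval2K /map_poly horner_poly.
rewrite (big_ord_widen _ (fun i => ev (\poly_(i < n) E i)`_i x * y ^+ i)
          (size_poly n E)) big_mkcond /=.
apply: eq_bigr => i _; rewrite coef_poly ltn_ord; case: ltnP => // h.
have := nth_default 0 h; rewrite coef_poly ltn_ord => ->.
by rewrite evalK0 mul0r.
Qed.

Section Span.
Variables (x : F) (n : nat) (b : 'I_n -> F).

(** Coefficients have degree below [N], so this space has dimension at most [n * N] over [K], linear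
    in [N]. *)
Definition polyspan (N : nat) (f : F) := exists p : 'I_n -> {poly K},
  (forall k, size (p k) <= N)%N /\ f = \sum_k ev (p k) x * b k.

Lemma polyspan_dep N (I : finType) (f : I -> F) :
  (forall i, polyspan N (f i)) -> (n * N < #|I|)%N ->
  exists c : I -> K, (exists i, c i != 0) /\ \sum_i iota (c i) * f i = 0.
Proof.
move=> hf hI; pose p i := sval (cid (hf i)).
apply: (@dep_fin _ _ iota I ('I_n * 'I_N)%type f (fun j => x ^+ j.2 * b j.1)
   (fun i j => (p i j.1)`_j.2)); last by rewrite card_prod !card_ord.
move=> i; rewrite /p; case: cid => q /= [hq ->].
rewrite -(pair_bigA _ (fun (k : 'I_n) (e : 'I_N) => iota (q k)`_e * (x ^+ e * b k))) /=.
apply: eq_bigr => k _; rewrite (evalKE _ (hq k)) mulr_suml.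
by apply: eq_bigr => e _; rewrite mulrA.
Qed.

(** Multiplication by [f] raises coefficient degrees by at most [C]. Such constants add up in
    products, so the cost of a monomial is linear in its exponents. *)
Definition bounded_mul (C : nat) (f : F) :=
  forall N u, polyspan N u -> polyspan (N + C) (f * u).

Lemma bounded_mulP C f : (forall j, polyspan C.+1 (f * b j)) -> bounded_mul C f.
Proof.
move=> h N u [p [hp ->]].
pose q j := sval (cid (h j)).
exists (fun k => \sum_j p j * q j k); split.
  move=> k; apply: (leq_trans (size_sum _ _ _)); apply/bigmax_leqP => j _.
  apply: (leq_trans (size_polyMleq _ _)).
  have : (size (q j k) <= C.+1)%N by rewrite /q; case: cid => /= ? [].
  by have := hp j; lia.
rewrite mulr_sumr.
under [RHS]eq_bigr => k _ do rewrite evalK_sum mulr_suml.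
rewrite exchange_big; apply: eq_bigr => j _ /=.
have -> : f * (ev (p j) x * b j) = ev (p j) x * (f * b j) by ring.
have -> : f * b j = \sum_k ev (q j k) x * b k by rewrite /q; case: cid => ? [].
by rewrite mulr_sumr; apply: eq_bigr => k _; rewrite evalKM mulrA.
Qed.

Lemma bounded_mul_le C C' f : (C <= C')%N -> bounded_mul C f -> bounded_mul C' f.
Proof.
move=> hC h N u /h [p [hp hf]]; exists p; split=> // k.
by apply: leq_trans (hp k) _; rewrite leq_add2l.
Qed.

Lemma bounded_mul_comp C C' f g :
  bounded_mul C f -> bounded_mul C' g -> bounded_mul (C + C') (f * g).
Proof.
by move=> hf hg N u /hg /hf; rewrite -mulrA addnAC addnA addnAC.
Qed.

Lemma bounded_mulX C f a : bounded_mul C f -> bounded_mul (a * C) (f ^+ a).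
Proof.
move=> h; elim: a => [|a IH]; first by move=> N u; rewrite addn0 mul1r.
by rewrite exprS mulSn; apply: bounded_mul_comp.
Qed.

Lemma bounded_mul_poly (s : {poly K}) : bounded_mul (size s) (ev s x).
Proof.
apply: bounded_mulP => j; exists (fun k => (k == j)%:R * s); split.
  by move=> k; case: eqP => _; rewrite ?mul1r ?mul0r ?size_poly0.
rewrite (bigD1 j) //= eqxx mul1r big1 ?addr0 // => k /negPf ->.
by rewrite mul0r evalK0 mul0r.
Qed.

Hypothesis hspan : forall f : F, exists PQ : 'I_n -> {poly K} * {poly K},
  (forall i, ev (PQ i).2 x != 0) /\
  f = \sum_(i < n) (ev (PQ i).1 x / ev (PQ i).2 x) * b i.

Lemma span_denominator f : exists (s : {poly K}) (N : nat),
  ev s x != 0 /\ polyspan N (ev s x * f).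
Proof.
have [PQ [hQ ->]] := hspan f.
pose s := \prod_i (PQ i).2; exists s.
pose p k := (PQ k).1 * \prod_(i | i != k) (PQ i).2.
exists (\max_k size (p k)); split.
  by rewrite evalK_prod; apply/prodf_neq0 => i _.
exists p; split; first by move=> k; exact: (leq_bigmax k).
rewrite mulr_sumr; apply: eq_bigr => k _; rewrite mulrA; congr (_ * _).
rewrite /s /p (bigD1 k) //= !evalKM; field.
exact: hQ.
Qed.

Lemma mul_denominator f : exists (s : {poly K}) (C : nat),
  ev s x != 0 /\ bounded_mul C (ev s x * f).
Proof.
pose s j := sval (cid (span_denominator (f * b j))).
have hs j : exists N, ev (s j) x != 0 /\ polyspan N (ev (s j) x * (f * b j)).
  by rewrite /s; case: cid.
pose N j := sval (cid (hs j)).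
have hN j : ev (s j) x != 0 /\ polyspan (N j) (ev (s j) x * (f * b j)).
  by rewrite /N; case: cid.
pose t j := \prod_(i | i != j) s i.
exists (\prod_j s j), (\max_j (N j + size (t j))); split.
  by rewrite evalK_prod; apply/prodf_neq0 => i _; have [] := hN i.
apply: bounded_mulP => j.
have [_ /(@bounded_mul_poly (t j)) [p [hp e]]] := hN j.
exists p; split.
  move=> k; apply: leq_trans (hp k) _; apply: leqW.
  exact: (leq_bigmax (F := fun j => N j + size (t j))%N j).
by rewrite -e (bigD1 j) //= evalKM -/(t j); ring.
Qed.

(** Transcendence degree one by counting: the [(A + 1)^2] monomials [z^i u^j] with [i, j <= A],
    multiplied by the common denominator [S], lie in a space of dimension at most [n (N0 + 2 A C)],
    only linear in [A]. *)
Lemma algebraic_dependence_of_span (z u : F) :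
  exists (m : nat) (p : 'I_m -> {poly K}),
    (exists i, p i != 0) /\ \sum_i ev (p i) z * u ^+ i = 0.
Proof.
have [s1 [C1 [s10 h1]]] := mul_denominator z.
have [s2 [C2 [s20 h2]]] := mul_denominator u.
have [t [N0 [t0 ht]]] := span_denominator 1.
pose C := (C1 + C2 + size s1 + size s2)%N.
(* Chosen so that [n (N0 + 2 A C) <= A (A + 1) < (A + 1)^2]. *)
pose A := (n * (2 * C + N0))%N.
pose S := ev s1 x ^+ A * ev s2 x ^+ A * ev t x.
have S0 : S != 0 by rewrite !mulf_neq0 ?expf_neq0.
pose f (ij : 'I_A.+1 * 'I_A.+1) := S * (z ^+ ij.1 * u ^+ ij.2).
have hf ij : polyspan (N0 + 2 * A * C) (f ij).
  case: ij => i j; rewrite /f /=.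
  have e : S * (z ^+ i * u ^+ j) = (ev s1 x * z) ^+ i * (ev s1 x ^+ (A - i) *
     ((ev s2 x * u) ^+ j * (ev s2 x ^+ (A - j) * (ev t x * 1)))).
    have -> : S = ev s1 x ^+ i * ev s1 x ^+ (A - i) *
       (ev s2 x ^+ j * ev s2 x ^+ (A - j)) * ev t x.
      by rewrite -!exprD !subnKC // -ltnS.
    by rewrite !exprMn; ring.
  have [l1 [l2 [l3 l4]]] : (C1 <= C /\ C2 <= C /\ size s1 <= C /\ size s2 <= C)%N.
    by rewrite /C; lia.
  have b1 := bounded_mulX i (bounded_mul_le (C' := C) l1 h1).
  have b2 := bounded_mulX j (bounded_mul_le (C' := C) l2 h2).
  have b3 := bounded_mulX (A - i) (bounded_mul_le (C' := C) l3
     (@bounded_mul_poly s1)).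
  have b4 := bounded_mulX (A - j) (bounded_mul_le (C' := C) l4
     (@bounded_mul_poly s2)).
  have := b1 _ _ (b3 _ _ (b2 _ _ (b4 _ _ ht))); rewrite -e => -[p [hp ->]].
  exists p; split=> // k; apply: leq_trans (hp k) _.
  have hi : (i <= A)%N by rewrite -ltnS.
  have hj : (j <= A)%N by rewrite -ltnS.
  by rewrite -!addnA leq_add2l -!mulnDl leq_mul2r; apply/orP; right; lia.
have [|c [[[i0 j0] hc0] hc]] := polyspan_dep hf.
  rewrite card_prod !card_ord.
  have : (n * (N0 + 2 * A * C) <= n * (2 * C + N0) * A.+1)%N.
    rewrite -[X in (_ <= X)%N]mulnA leq_mul2l; apply/orP; right.
    by rewrite mulnS mulnDl; nia.
  by rewrite -/A; nia.
exists A.+1, (fun j => \poly_(i < A.+1) c (inord i, j)); split.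
  exists j0; apply/eqP => /polyP /(_ i0); rewrite coef_poly ltn_ord coef0.
  by rewrite inord_val => /eqP; rewrite (negPf hc0).
apply: (mulfI S0); rewrite mulr0 -[RHS]hc.
rewrite (eq_bigr (fun ij => iota (c (ij.1, ij.2)) * f (ij.1, ij.2))) => [|[]//].
rewrite -(pair_bigA _ (fun i j : 'I_A.+1 => iota (c (i, j)) * f (i, j))) /= exchange_big.
rewrite mulr_sumr; apply: eq_bigr => j _ /=.
rewrite (evalKE _ (size_poly _ _)) mulr_suml mulr_sumr; apply: eq_bigr => i _.
by rewrite coef_poly ltn_ord inord_val /f /=; ring.
Qed.

End Span.

Hypothesis ff : function_field iota.

Lemma algebraic_dependence (z u : F) :
  exists (m : nat) (p : 'I_m -> {poly K}),
    (exists i, p i != 0) /\ \sum_i ev (p i) z * u ^+ i = 0.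
Proof. by have [x [_ [n [b hb]]]] := ff; apply: algebraic_dependence_of_span hb _ _. Qed.

(** Residue fields are [K]. In an algebraic relation between a uniformizer [t] and [u], divide by
    the largest power [t^b] common to all coefficients: modulo the place there remains a nonzero
    polynomial [r] over [K] whose value at [u] vanishes at [v]. As [r] splits, some factor [u - z]
    vanishes at [v]. *)
Lemma residue v u : is_place iota v -> vge v 0 u ->
  exists k, vge v 1 (u - iota k).
Proof.
move=> pv hu.
have [t ht] : exists t, v t = 1 by case: pv.
have t0 : t != 0.
  by apply/eqP => e; move: ht; rewrite e; case: pv => ->.
have [m [p [[i0 hi0] hp]]] := algebraic_dependence t u.
pose N := \max_i size (p i).
have hN i : (size (p i) <= N)%N by apply: (leq_bigmax (F := fun i => size (p i))).
have ex : exists b, [exists i, (p i)`_b != 0].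
  exists (size (p i0)).-1; apply/existsP; exists i0.
  by rewrite -lead_coefE lead_coef_eq0.
case: (ex_minnP ex) => b /existsP [i1 hi1] bmin.
have plow i a : (a < b)%N -> (p i)`_a = 0.
  move=> hab; apply: contrapT => /eqP h.
  have /bmin : [exists i, (p i)`_a != 0] by apply/existsP; exists i.
  by rewrite leqNgt hab.
pose r := \poly_(i < m) (if insub i is Some i then (p i)`_b else 0).
have hr (i : 'I_m) : r`_i = (p i)`_b.
  by rewrite coef_poly ltn_ord insubT //= => h; congr (p _)`_b; apply: val_inj.
have r0 : r != 0.
  by apply/eqP => e; move: hi1; rewrite -hr e coef0 eqxx.
have vr : vge v 1 (ev r u).
  pose d i := \poly_(a < N) (p i)`_(b + a.+1).
  have hd i : ev (p i) t = t ^+ b * (iota (p i)`_b + t * ev (d i) t).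
    have ep : p i = 'X^b * (((p i)`_b)%:P + 'X * d i).
      apply/polyP => a; rewrite coefXnM; case: ltnP => hab; first exact: plow.
      rewrite coefD coefC coefXM; case: (ltngtP a b) hab => // hab _; last first.
        by rewrite hab subnn addr0.
      have -> : (a - b == 0)%N = false by lia.
      rewrite add0r coef_poly; have -> : (b + (a - b).-1.+1)%N = a by lia.
      case: ltnP => // h; apply: nth_default; apply: leq_trans (hN i) _; lia.
    by rewrite [in LHS]ep /evalK rmorphM rmorphD rmorphM /= map_polyXn map_polyX map_polyC
      !hornerE.
  have e : ev r u = - (t * \sum_i ev (d i) t * u ^+ i).
    apply: (mulfI (expf_neq0 b t0)); apply/eqP; rewrite mulrN -addr_eq0 -[X in _ == X]hp.
    rewrite (evalKE _ (size_poly _ _)) !mulr_sumr -big_split /=; apply/eqP.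
    by apply: eq_bigr => i _; rewrite hr hd; ring.
  rewrite e; apply: (vgeN pv) => //; apply: (vge_mulr pv) => //.
    by right; rewrite ht.
  apply: (vge_sum pv) => // i; apply: (vge_mulr pv) => //; last first.
    by have := vge_exp pv i hu; rewrite mulr0.
  rewrite (evalKE _ (leqnn _)); apply: (vge_sum pv) => // a; apply: vgeZ => //.
  by right; rewrite (placeX pv) // ht; lia.
have [s hs] := evalK_split r.
move: vr; rewrite hs => vr.
apply: contrapT => hno.
have hz z : u - iota z != 0 /\ v (u - iota z) = 0.
  have h : vge v 0 (u - iota z) by apply: (vgeB pv) => //; apply: vgeK.
  have z0 : u - iota z != 0.
    by apply/eqP => e; apply: hno; exists z; left.
  split=> //; have /vge_ge := h => /(_ z0) h1.
  apply/eqP; rewrite eq_le h1 andbT leNgt; apply/negP => h2.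
  by apply: hno; exists z; right; lia.
have hprod : \prod_(z <- s) (u - iota z) != 0 /\ v (\prod_(z <- s) (u - iota z)) = 0.
  elim: {hs vr} s => [|z s [IH1 IH2]]; first by rewrite big_nil oner_eq0 (place1 pv).
  have [h1 h2] := hz z.
  by rewrite big_cons mulf_neq0 // (placeM pv) // IH2 h2.
have l0 : iota (lead_coef r) != 0 by rewrite fmorph_eq0 lead_coef_eq0.
have /vge_ge := vr; rewrite mulf_neq0 ?hprod.1 // => /(_ isT).
by rewrite (placeM pv) ?hprod.1 // (placeK pv) ?lead_coef_eq0 // hprod.2.
Qed.

End AlgebraicDependence.

(** * Divisors and invariant Riemann-Roch spaces *)

Section Divisors.
Variables (K : closedFieldType) (F : fieldType) (iota : {rmorphism K -> F}).
Implicit Types (D E : divisor F) (w P : F -> int).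

Lemma divcoef_nil w : divcoef (F := F) [::] w = 0.
Proof. by rewrite /divcoef big_nil. Qed.

Lemma divcoef_cons p D w :
  divcoef (p :: D) w = (if `[< p.1 = w >] then p.2 else 0) + divcoef D w.
Proof. by rewrite /divcoef big_cons. Qed.

Lemma divcoef_cat D E w : divcoef (D ++ E) w = divcoef D w + divcoef E w.
Proof. by rewrite /divcoef big_cat. Qed.

Lemma divdeg_nil : divdeg (F := F) [::] = 0.
Proof. by rewrite /divdeg big_nil. Qed.

Lemma divdeg_cons p D : divdeg (p :: D) = p.2 + divdeg D.
Proof. by rewrite /divdeg big_cons. Qed.

Lemma divdeg_cat D E : divdeg (D ++ E) = divdeg D + divdeg E.
Proof. by rewrite /divdeg big_cat. Qed.

Lemma is_divisor_nil : is_divisor iota [::].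
Proof. by []. Qed.

Lemma is_divisor_cons p D :
  is_place iota p.1 -> is_divisor iota D -> is_divisor iota (p :: D).
Proof. by move=> hp hD r; rewrite inE => /orP [/eqP ->|/hD]. Qed.

Lemma is_divisor_behead p D :
  is_divisor iota (p :: D) -> is_place iota p.1 /\ is_divisor iota D.
Proof.
move=> h; split; first by apply: h; rewrite mem_head.
by move=> r hr; apply: h; rewrite inE hr orbT.
Qed.

Lemma is_divisor_cat D E :
  is_divisor iota D -> is_divisor iota E -> is_divisor iota (D ++ E).
Proof. by move=> hD hE p; rewrite mem_cat => /orP [/hD|/hE]. Qed.

Definition dmap (f : int -> int) D : divisor F := [seq (p.1, f p.2) | p <- D].

Lemma is_divisor_dmap f D : is_divisor iota D -> is_divisor iota (dmap f D).
Proof. by move=> hD p /mapP [r /hD h ->]. Qed.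

Lemma divcoef_scale k D w : divcoef (dmap ( *%R k) D) w = k * divcoef D w.
Proof.
elim: D => [|p D IH]; first by rewrite divcoef_nil mulr0.
by rewrite /= !divcoef_cons IH mulrDr /=; case: asbool; rewrite ?mulr0.
Qed.

Lemma divdeg_scale k D : divdeg (dmap ( *%R k) D) = k * divdeg D.
Proof. by rewrite /divdeg big_map mulr_sumr. Qed.

(** Divisors are lists in which a place may recur, so degrees are compared through coefficients on a
    duplicate-free support. *)
Lemma divdegE (S : seq (F -> int)) D : uniq S -> (forall p, p \in D -> p.1 \in S) ->
  divdeg D = \sum_(w <- S) divcoef D w.
Proof.
move=> uS hS; rewrite /divcoef exchange_big /divdeg.
apply: eq_big_seq => p /hS hp /=.
rewrite (bigD1_seq p.1) //= asboolT // big1 ?addr0 // => w hw.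
by rewrite asboolF // => e; rewrite e eqxx in hw.
Qed.

Lemma divcoef_supp D w : divcoef D w != 0 -> exists2 p, p \in D & p.1 = w.
Proof.
elim: D => [|p D IH]; first by rewrite divcoef_nil eqxx.
rewrite divcoef_cons; case: asboolP => [e _|_].
  by exists p => //; rewrite mem_head.
by rewrite add0r => /IH [r hr e]; exists r => //; rewrite inE hr orbT.
Qed.

Lemma divdeg_le D E : is_divisor iota D -> is_divisor iota E ->
  (forall w, is_place iota w -> divcoef D w <= divcoef E w) ->
  divdeg D <= divdeg E.
Proof.
move=> hD hE h; pose S := undup [seq p.1 | p <- D ++ E].
have hS p : p \in D ++ E -> p.1 \in S by move=> hp; rewrite mem_undup map_f.
rewrite (@divdegE S D) ?undup_uniq //; last first.
  by move=> p hp; apply: hS; rewrite mem_cat hp.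
rewrite (@divdegE S E) ?undup_uniq //; last first.
  by move=> p hp; apply: hS; rewrite mem_cat hp orbT.
rewrite big_seq [leRHS]big_seq; apply: ler_sum => w.
rewrite mem_undup => /mapP [p hp ->]; apply: h.
exact: (is_divisor_cat hD hE).
Qed.

Lemma divdeg_eq D E : is_divisor iota D -> is_divisor iota E ->
  (forall w, is_place iota w -> divcoef D w = divcoef E w) -> divdeg D = divdeg E.
Proof.
move=> hD hE h; apply/eqP; rewrite eq_le !divdeg_le // => w /h -> //.
Qed.

Lemma divcoef_eq0 D w : is_divisor iota D -> divdeg D = 0 ->
  (forall w, is_place iota w -> 0 <= divcoef D w) -> divcoef D w = 0.
Proof.
move=> hD d0 h; apply/eqP/negPn/negP => hw.
have [p hp e] := divcoef_supp hw.
pose S := undup [seq p.1 | p <- D].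
have hS r : r \in D -> r.1 \in S by move=> hr; rewrite mem_undup map_f.
move: d0; rewrite (divdegE (undup_uniq _) hS).
have pl v : v \in S -> is_place iota v.
  by rewrite mem_undup => /mapP [r /hD hr ->].
rewrite (bigD1_seq w) ?undup_uniq //=; last by rewrite -e hS.
have h1 : 0 < divcoef D w.
  by rewrite lt_neqAle eq_sym hw h // -e; apply: hD.
have h2 : 0 <= \sum_(i <- S | i != w) divcoef D i.
  by rewrite big_seq_cond; apply: sumr_ge0 => i /andP [/pl hi _]; apply: h.
by move=> h3; move: h1; rewrite -h3 ltNge lerDl h2.
Qed.

Definition div_of (S : seq (F -> int)) (f : (F -> int) -> int) : divisor F :=
  [seq (w, f w) | w <- S].

Lemma is_divisor_div_of S f :
  (forall w, w \in S -> is_place iota w) -> is_divisor iota (div_of S f).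
Proof. by move=> h p /mapP [w /h hw ->]. Qed.

Lemma divcoef_div_of S f w :
  uniq S -> divcoef (div_of S f) w = if w \in S then f w else 0.
Proof.
elim: S => [|v S IH] /=; first by rewrite divcoef_nil.
move=> /andP [nv uS]; rewrite divcoef_cons IH //= inE eq_sym.
case: asboolP => [<-|/eqP h]; first by rewrite eqxx (negPf nv) addr0.
by rewrite (negPf h) add0r.
Qed.

Lemma divdeg_div_of S f : divdeg (div_of S f) = \sum_(w <- S) f w.
Proof. by rewrite /divdeg big_map. Qed.

End Divisors.

(** * Invariant functions and divisors of the quotient curve *)

Section InvariantSpaces.
Variables (K : closedFieldType) (F : fieldType) (iota : {rmorphism K -> F}).
Hypothesis ff : function_field iota.
Variables (s : F -> F) (q : nat).
Hypothesis hs : K_automorphism iota s.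
Implicit Types (D E : divisor F) (w P : F -> int) (u v : F).

Lemma autD u v : s (u + v) = s u + s v. Proof. by case: hs. Qed.
Lemma autM u v : s (u * v) = s u * s v. Proof. by case: hs. Qed.
Lemma aut1 : s 1 = 1. Proof. by case: hs. Qed.
Lemma autK k : s (iota k) = iota k. Proof. by case: hs. Qed.
Lemma aut_klinear : klinear iota s.
Proof. by move=> k u v; rewrite autD autM autK. Qed.
Lemma aut0 : s 0 = 0. Proof. exact: klinear0 aut_klinear. Qed.
Lemma autB u v : s (u - v) = s u - s v. Proof. exact: klinearB aut_klinear. Qed.
Lemma aut_inj : injective s. Proof. by case: hs => _ _ _ /bij_inj. Qed.
Lemma aut_eq0 u : (s u == 0) = (u == 0).
Proof. by rewrite -[X in _ == X]aut0 (inj_eq aut_inj). Qed.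
Lemma autX u n : s (u ^+ n) = s u ^+ n.
Proof. by elim: n => [|n IH]; rewrite ?expr0 ?aut1 // !exprS autM IH. Qed.
Lemma autV u : s u^-1 = (s u)^-1.
Proof.
have [->|u0] := eqVneq u 0; first by rewrite invr0 aut0 invr0.
have su0 : s u != 0 by rewrite aut_eq0.
by apply: (mulfI su0); rewrite -autM !mulfV // aut1.
Qed.

Lemma iter_autM i u v : iter i s (u * v) = iter i s u * iter i s v.
Proof. by elim: i => //= i ->; rewrite autM. Qed.
Lemma iter_autD i u v : iter i s (u + v) = iter i s u + iter i s v.
Proof. by elim: i => //= i ->; rewrite autD. Qed.
Lemma iter_autK i k : iter i s (iota k) = iota k.
Proof. by elim: i => //= i ->; rewrite autK. Qed.
Lemma iter_aut_eq0 i u : (iter i s u == 0) = (u == 0).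
Proof. by elim: i => //= i <-; rewrite aut_eq0. Qed.
Lemma iter_fix i u : s u = u -> iter i s u = u.
Proof. by move=> h; elim: i => //= i ->. Qed.

Definition rot i P : F -> int := fun f => P (iter i s f).

Lemma rotSr i P : rot i.+1 P = rot i P \o s.
Proof. by apply: funext => f; rewrite /rot /= -iterS iterSr. Qed.

Lemma rotD i j P : rot i (rot j P) = rot (j + i) P.
Proof. by apply: funext => f; rewrite /rot iterD. Qed.

Hypothesis q0 : (0 < q)%N.
Hypothesis hq : forall f, iter q s f = f.

Lemma rotq P : rot q P = P.
Proof. by apply: funext => f; rewrite /rot hq. Qed.

Lemma rot_place i P : is_place iota P -> is_place iota (rot i P).
Proof.
case=> h0 [t ht] hM hD hK; split.
- by rewrite /rot; have /eqP -> : iter i s 0 == 0 by rewrite iter_aut_eq0.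
- exists (iter (i * q - i) s t); rewrite /rot -iterD subnKC ?leq_pmulr //.
  by rewrite (_ : iter (i * q) s t = t) // mulnC; elim: i => [|i IH];
    rewrite ?muln0 // mulnS iterD IH hq.
- by move=> x y x0 y0; rewrite /rot iter_autM hM ?iter_aut_eq0.
- move=> x y x0 y0 xy0; rewrite /rot iter_autD; apply: hD; rewrite ?iter_aut_eq0 //.
  by rewrite -iter_autD iter_aut_eq0.
by move=> k k0; rewrite /rot iter_autK hK.
Qed.

Lemma comp_place P : is_place iota P -> is_place iota (P \o s).
Proof. by move=> /(rot_place 1); congr is_place. Qed.

Lemma comp_aut_inj P w : P \o s = w \o s -> P = w.
Proof.
move=> h; apply: funext => f.
have := congr1 (fun g => g (iter q.-1 s f)) h.
by rewrite /= -!iterS prednK // hq.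
Qed.

Definition fixed P := P \o s = P.

Lemma rot_fixed i P : fixed P -> rot i P = P.
Proof. by move=> h; elim: i => [|i IH]; [|rewrite rotSr IH]. Qed.

(* The multiplicity of [w] in the sum of the [q] conjugates of [P]; for prime [q] it
   is [q] at [w = P] when [P] is fixed (total ramification). *)
Definition orb P w : nat := (\sum_(i < q) `[< rot i P = w >])%N.

Lemma orb_comp P w : orb P (w \o s) = orb P w.
Proof.
rewrite /orb; case: q q0 hq => // r _ hr; rewrite big_ord_recl big_ord_recr /=.
rewrite addnC; congr (_ + _)%N.
  apply: eq_bigr => i _; rewrite /bump /= rotSr.
  by congr nat_of_bool; apply: asbool_equiv_eq; split=> [/comp_aut_inj|->].
congr nat_of_bool; apply: asbool_equiv_eq.
have -> : rot 0 P = rot r P \o s.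
  by rewrite -rotSr; apply: funext => f; rewrite /rot hr.
by split=> [/comp_aut_inj|->].
Qed.

Lemma orb_rot i P w : orb P (rot i w) = orb P w.
Proof. by elim: i => // i IH; rewrite rotSr orb_comp. Qed.

Lemma orb_fixed P : fixed P -> orb P P = q.
Proof.
move=> h; rewrite /orb (eq_bigr (fun _ => 1%N)) => [|i _].
  by rewrite sum1_card card_ord.
by rewrite rot_fixed // asboolT.
Qed.

Lemma orb_neq0 P w : orb P w != 0%N -> exists i, w = rot i P.
Proof.
move=> h; apply: contrapT => hno; move/eqP: h; apply.
by rewrite /orb big1 // => i _; rewrite asboolF // => e; apply: hno; exists i.
Qed.

Lemma rot_cancel i P w : w = rot i P -> exists j, P = rot j w.
Proof.
move=> ->; exists (i * q - i)%N; rewrite rotD subnKC ?leq_pmulr //.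
by elim: i => [|i IH]; rewrite ?mul0n // mulSn -rotD rotq.
Qed.

Lemma orb_to_fixed P w : fixed w -> orb P w != 0%N -> P = w.
Proof.
by move=> fw /orb_neq0 [i /rot_cancel [j ->]]; rewrite rot_fixed.
Qed.

Lemma orb_pos P : (0 < orb P P)%N.
Proof.
rewrite /orb; case: q q0 => // r _; rewrite big_ord_recl.
by rewrite asboolT.
Qed.

(* Satisfied by automorphisms of prime order, and by [s = id], [q = 1], for which
   [L0 D] is [inL D]. *)
Hypothesis horb : forall P, is_place iota P -> fixed P \/ orb P P = 1%N.
Hypothesis hram : forall P, is_place iota P -> fixed P ->
  forall u, s u = u -> u != 0 -> (q%:Z %| P u)%Z.

Definition pull D : divisor F :=
  flatten [seq [seq (rot i p.1, p.2) | i <- index_iota 0 q] | p <- D].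

(* The coefficient of [pull D] at [w]. *)
Definition pc D w : int := \sum_(p <- D) p.2 * (orb p.1 w)%:Z.

Lemma divcoef_pull D w : divcoef (pull D) w = pc D w.
Proof.
rewrite /pc; elim: D => [|p D IH]; first by rewrite big_nil divcoef_nil.
rewrite big_cons /pull /= divcoef_cat -/(pull D) IH; congr (_ + _).
rewrite /divcoef big_map /= /orb big_mkord (big_morph Posz PoszD (erefl _)) mulr_sumr.
by apply: eq_bigr => i _ /=; case: asbool; rewrite ?mulr1 ?mulr0.
Qed.

Lemma divdeg_pull D : divdeg (pull D) = q%:Z * divdeg D.
Proof.
elim: D => [|p D IH]; first by rewrite !divdeg_nil mulr0.
rewrite /pull /= divdeg_cat -/(pull D) IH divdeg_cons mulrDr; congr (_ + _).
by rewrite /divdeg big_map /= big_mkord sumr_const card_ord -mulr_natl natz.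
Qed.

Lemma is_divisor_pull D : is_divisor iota D -> is_divisor iota (pull D).
Proof.
move=> hD p /flattenP [x /mapP [r /hD hr ->]] /mapP [i _ ->] /=.
exact: rot_place.
Qed.

Lemma pc_nil w : pc [::] w = 0. Proof. by rewrite /pc big_nil. Qed.
Lemma pc_cons p D w : pc (p :: D) w = p.2 * (orb p.1 w)%:Z + pc D w.
Proof. by rewrite /pc big_cons. Qed.
Lemma pc_cat D E w : pc (D ++ E) w = pc D w + pc E w.
Proof. by rewrite /pc big_cat. Qed.
Lemma pc_rot i D w : pc D (rot i w) = pc D w.
Proof. by apply: eq_bigr => p _; rewrite orb_rot. Qed.
Lemma pc_comp D w : pc D (w \o s) = pc D w.
Proof. exact: (pc_rot 1). Qed.

Lemma orb_dvd P w : fixed w -> (q %| orb P w)%N.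
Proof.
move=> fw; have [->//|] := eqVneq (orb P w) 0%N.
by move=> /(orb_to_fixed fw) ->; rewrite orb_fixed.
Qed.

Lemma pc_dvd D w : fixed w -> (q%:Z %| pc D w)%Z.
Proof.
move=> fw; apply: rpred_sum => p _.
apply: dvdz_mull; exact: orb_dvd.
Qed.

Lemma pc_ge0 D w : (forall p, p \in D -> 0 <= p.2) -> 0 <= pc D w.
Proof.
by move=> h; rewrite /pc big_seq; apply: sumr_ge0 => p /h hp; rewrite mulr_ge0.
Qed.

Definition L0 D u := s u = u /\ (u = 0 \/ forall w, is_place iota w -> - pc D w <= w u).

Lemma L0P D u : L0 D u <->
  s u = u /\ forall w, is_place iota w -> vge w (- pc D w) u.
Proof.
split=> [[su h]|[su h]]; split=> //.
  by case: h => [->|h] w hw; [left|right; apply: h].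
have [->|u0] := eqVneq u 0; [by left|right=> w hw].
exact: vge_ge (h w hw) u0.
Qed.

Lemma L0_inL D u : L0 D u <-> s u = u /\ inL iota (pull D) u.
Proof.
split=> -[su h]; split=> //; (case: h => [->|h]; [by left|right=> w hw]).
  by rewrite divcoef_pull; apply: h.
by rewrite -divcoef_pull; apply: h.
Qed.

Lemma subsp_L0 D : subsp iota (L0 D).
Proof.
split=> [|k u v /L0P [su hu] /L0P [sv hv]].
  by apply/L0P; split; [exact: aut0|move=> w _; left].
apply/L0P; split; first by rewrite aut_klinear su sv.
by move=> w pw; apply: (subsp_vge pw _).2; [apply: hu|apply: hv].
Qed.

Lemma L0_ext D E u : (forall w, is_place iota w -> pc D w <= pc E w) ->
  L0 D u -> L0 E u.
Proof.
move=> h [su [->|hu]]; split=> //; [exact: aut0|by left|right=> w hw].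
by apply: le_trans (hu w hw); rewrite lerN2 h.
Qed.

(** Values at [P] of functions fixed by [s] move in steps of [orb P P]: [q] at a fixed place by
    ramification, 1 elsewhere. A bound missed by less than one step therefore holds. *)
Lemma pull_ind_ge P (m : int) u : is_place iota P -> s u = u -> u != 0 ->
  (fixed P -> (q%:Z %| m)%Z) -> m - (orb P P)%:Z < P u -> m <= P u.
Proof.
move=> pP su u0 hm; case: (horb pP) => [fP|->]; last by lia.
rewrite orb_fixed // => h; have [a ha] := dvdzP (hm fP).
have [b hb] := dvdzP (hram pP fP su u0).
move: h; rewrite ha hb => h; rewrite ler_wpM2r //.
have : a - 1 < b by rewrite -(ltr_pM2r (_ : 0 < q%:Z)) // mulrBl mul1r.
by lia.
Qed.

Lemma L0_drop D P u : is_place iota P -> L0 ((P, 1) :: D) u ->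
  vge P (- pc D P - (orb P P)%:Z + 1) u -> L0 D u.
Proof.
move=> pP [su [->|hu]] hP; first by split; [exact: aut0|left].
have [->|u0] := eqVneq u 0; first by split; [exact: aut0|left].
split=> //; right=> w pw; have := hu w pw; rewrite pc_cons mul1r /=.
have [->|/orb_neq0 [i ->] _] := eqVneq (orb P w) 0%N; first by rewrite add0r.
rewrite pc_rot /rot iter_fix //.
apply: pull_ind_ge => //; last by have := vge_ge hP u0; lia.
by move=> fP; rewrite rpredN pc_dvd.
Qed.

Lemma L0_exact D P u : is_place iota P -> L0 ((P, 1) :: D) u -> ~ L0 D u ->
  u != 0 /\ P u = - pc D P - (orb P P)%:Z.
Proof.
move=> pP hu nu; split.
  by apply/eqP => u0; apply: nu; rewrite u0; apply: (subsp_L0 D).1.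
have hP : ~ vge P (- pc D P - (orb P P)%:Z + 1) u by move=> /(L0_drop pP hu).
apply/eqP; rewrite eq_le; apply/andP; split.
  by rewrite leNgt; apply/negP => h; apply: hP; right; lia.
have [_ [u0|h]] := hu; first by case: nu; rewrite u0; apply: (subsp_L0 D).1.
by have := h P pP; rewrite pc_cons mul1r /=; lia.
Qed.

(** One point of the quotient raises the dimension by at most one: [v] has the exact pole order, so
    [u / v] has a residue [k], and [u - k v] drops a full step by [L0_drop]. *)
Lemma L0_step D P u v : is_place iota P -> L0 ((P, 1) :: D) u ->
  L0 ((P, 1) :: D) v -> ~ L0 D v -> exists k, L0 D (u - iota k * v).
Proof.
move=> pP hu hv nv; have [v0 vP] := L0_exact pP hv nv.
have huP : vge P (P v) u.
  have [_ [->|h]] := hu; [by left|right; have := h P pP].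
  by rewrite vP pc_cons mul1r /=; lia.
have h0 : vge P 0 (u / v).
  have := vge_mul pP huP (vge_refl P v^-1).
  by rewrite (placeV pP) // subrr.
have [k hk] := residue ff pP h0; exists k.
apply: (L0_drop pP).
  by apply: subspB; [apply: subsp_L0|by []|apply: subspZ => //; apply: subsp_L0].
have := vge_mul pP hk (vge_refl P v); rewrite mulrBl divfK // vP.
by congr vge; lia.
Qed.

Lemma L0_sub_cons D P n u : is_place iota P -> L0 D u -> L0 ((P, n%:Z) :: D) u.
Proof.
move=> pP; apply: L0_ext => w _; rewrite pc_cons /=.
by rewrite lerDr mulr_ge0.
Qed.

Local Notation fdimK := (fdim iota).
Local Notation dimK := (dim iota).

Lemma dim_L0_cons D P : is_place iota P -> fdimK (L0 D) ->
  fdimK (L0 ((P, 1) :: D)) /\ (dimK (L0 ((P, 1%R) :: D)) <= (dimK (L0 D)).+1)%N.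
Proof.
move=> pP /dimP hd.
have [m hm hm'] := hasdim_codim1 (subsp_L0 D)
  (fun u => @L0_sub_cons D P 1 u pP) (fun u v => @L0_step D P u v pP) hd.
by split; [exists m|rewrite (dimE hm')].
Qed.

Lemma dim_L0_cat D E : is_divisor iota E -> (forall p, p \in E -> 0 <= p.2) ->
  fdimK (L0 D) ->
  fdimK (L0 (E ++ D)) /\ (dimK (L0 (E ++ D)))%:Z <= (dimK (L0 D))%:Z + divdeg E.
Proof.
elim: E => [|[P k] E IH] hE eE fD; first by rewrite divdeg_nil addr0.
have [/= pP hE'] := is_divisor_behead hE.
have [|fX hX] := IH hE' _ fD.
  by move=> p hp; apply: eE; rewrite inE hp orbT.
have k0 : 0 <= k by apply: (eE (P, k)); rewrite mem_head.
rewrite divdeg_cons /=; case: k k0 {hE eE} => // n _.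
elim: n => [|n [IHf IHn]].
  have e : L0 ((P, 0) :: E ++ D) = L0 (E ++ D).
    by apply: funext => u; apply: propext; split; apply: L0_ext => w _;
       rewrite pc_cons mul0r add0r.
  by rewrite e; split=> //; lia.
have e : L0 ((P, n.+1%:Z) :: E ++ D) = L0 ((P, 1) :: (P, n%:Z) :: E ++ D).
  by apply: funext => u; apply: propext; split; apply: L0_ext => w _;
     rewrite !pc_cons /=; lia.
have [h1 h2] := dim_L0_cons pP IHf.
by rewrite e; split=> //; lia.
Qed.

(** Since [D0 + |D0| >= 0], adding [|D0| + |D|] to [D0] gives a divisor that dominates [D], and
    adding an effective divisor keeps the dimension finite. *)
Lemma fdim_L0 D0 D : is_divisor iota D0 -> is_divisor iota D ->
  fdimK (L0 D0) -> fdimK (L0 D).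
Proof.
move=> h0 hD f0; pose A := dmap (fun k => `|k|) (D0 ++ D).
have hA : is_divisor iota A by apply/is_divisor_dmap/is_divisor_cat.
have pA p : p \in A -> 0 <= p.2 by case/mapP => r _ ->; apply: normr_ge0.
have [fA _] := dim_L0_cat hA pA f0.
apply: fdim_sub (subsp_L0 D) _ fA.
move=> u; apply: L0_ext => w _; rewrite pc_cat /A /dmap map_cat pc_cat.
have h (E : divisor F) : pc E w <= pc (dmap (fun k => `|k|) E) w /\
    - pc E w <= pc (dmap (fun k => `|k|) E) w.
  elim: E => [|p E [IH1 IH2]]; first by rewrite pc_nil.
  rewrite /= !pc_cons /=; split; nia.
by have := h D; have := h D0; rewrite /dmap; lia.
Qed.

(** Descent of divisors to the quotient. The induction removes the whole orbit of the head [w0] of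
    [S], with the multiplicity [k] given by [f w0 = k * orb w0 w0]; divisibility at fixed places
    makes [k] an integer. *)
Lemma pull_repr (S : seq (F -> int)) (f : (F -> int) -> int) :
  (forall w, is_place iota w -> f (w \o s) = f w) ->
  (forall w, is_place iota w -> f w != 0 -> w \in S) ->
  (forall w, is_place iota w -> fixed w -> (q%:Z %| f w)%Z) ->
  exists E, [/\ is_divisor iota E, forall w, is_place iota w -> pc E w = f w &
    (forall w, is_place iota w -> 0 <= f w) -> forall p, p \in E -> 0 <= p.2].
Proof.
elim: S f => [|w0 S IH] f hf hS hd.
  exists [::]; split=> // w pw; rewrite pc_nil; apply/esym/eqP/negPn/negP.
  by move=> /(hS _ pw).
have [[p0 f0]|hno] := pselect (is_place iota w0 /\ f w0 != 0); last first.
  apply: IH => // w pw fw; have := hS w pw fw; rewrite inE => /orP [/eqP e|//].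
  by case: hno; rewrite -e.
have frot i w : is_place iota w -> f (rot i w) = f w.
  by move=> pw; elim: i => // i IHi; rewrite rotSr hf ?IHi //; apply: rot_place.
have [k hk] : exists k, f w0 = k * (orb w0 w0)%:Z.
  case: (horb p0) => [fx|->]; last by exists (f w0); rewrite mulr1.
  by rewrite orb_fixed //; apply/dvdzP/hd.
pose f' w := f w - k * (orb w0 w)%:Z.
have f'orb i : f' (rot i w0) = 0.
  by rewrite /f' orb_rot frot // hk subrr.
have f'out w : ~ (exists i, w = rot i w0) -> f' w = f w.
  move=> h; rewrite /f'; have [->|/orb_neq0 //] := eqVneq (orb w0 w) 0%N.
  by rewrite mulr0 subr0.
have [||| E [hE eE pE]] := IH f'.
- by move=> w pw; rewrite /f' hf // orb_comp.
- move=> w pw f'w; have nw : ~ (exists i, w = rot i w0).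
    by move=> [i e]; move: f'w; rewrite e f'orb eqxx.
  move: f'w; rewrite f'out // => /(hS w pw); rewrite inE => /orP [/eqP e|//].
  by case: nw; exists 0%N.
- move=> w pw fw; rewrite /f' rpredB ?hd //.
  by apply: dvdz_mull; apply: orb_dvd.
exists ((w0, k) :: E); split.
- exact: is_divisor_cons.
- by move=> w pw; rewrite pc_cons eE // /f' /= addrC subrK.
move=> pf p; rewrite inE => /orP [/eqP ->|] /=.
  have := pf _ p0; rewrite hk pmulr_lge0 //.
  by have := orb_pos w0; lia.
apply: pE => w pw.
have [[i ->]|h] := pselect (exists i, w = rot i w0); first by rewrite f'orb.
by rewrite f'out // pf.
Qed.

Lemma divdeg_pull_le D E : is_divisor iota D -> is_divisor iota E ->
  (forall w, is_place iota w -> pc D w <= pc E w) -> divdeg D <= divdeg E.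
Proof.
move=> hD hE h; rewrite -(ler_pM2l (_ : 0 < q%:Z)) // -!divdeg_pull.
apply: (divdeg_le (iota := iota)); try exact: is_divisor_pull.
by move=> w pw; rewrite !divcoef_pull h.
Qed.

(* The maximum of [psi] is the genus of the quotient minus one. *)
Definition psi D : int := divdeg D - (dimK (L0 D))%:Z.

(** The difference [E - D] descends to an effective divisor [X], and adding [X] raises the dimension
    by at most [deg X]. *)
Lemma psi_mono D E : is_divisor iota D -> is_divisor iota E -> fdimK (L0 D) ->
  (forall w, is_place iota w -> pc D w <= pc E w) -> psi D <= psi E.
Proof.
move=> hD hE fD h.
have [|||X [hX eX pX]] := @pull_repr [seq p.1 | p <- pull E ++ pull D]
   (fun w => pc E w - pc D w).
- by move=> w _; rewrite !pc_comp.
- move=> w _; rewrite -!divcoef_pull => hw.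
  have [p hp <-] : exists2 p, p \in pull E ++ pull D & p.1 = w.
    have [h0|/divcoef_supp [p hp e]] := eqVneq (divcoef (pull E) w) 0.
      move: hw; rewrite h0 sub0r oppr_eq0 => /divcoef_supp [p hp e].
      by exists p => //; rewrite mem_cat hp orbT.
    by exists p => //; rewrite mem_cat hp.
  exact: map_f.
- by move=> w pw fw; rewrite rpredB // pc_dvd.
have e w : is_place iota w -> pc (X ++ D) w = pc E w.
  by move=> pw; rewrite pc_cat eX // subrK.
have eL : L0 (X ++ D) = L0 E.
  by apply: funext => u; apply: propext; split; apply: L0_ext => w /e ->.
have eD : divdeg (X ++ D) = divdeg E.
  apply/eqP; rewrite eq_le !divdeg_pull_le //; try exact: is_divisor_cat.
    by move=> w /e ->.
  by move=> w /e ->.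
have [|_] := dim_L0_cat hX _ fD.
  by apply: pX => w pw; rewrite subr_ge0 h.
by rewrite eL /psi -eD divdeg_cat; lia.
Qed.

Section LargeDegree.
Variable B : int.
Hypothesis fdimL : forall D, is_divisor iota D -> fdimK (L0 D).
Hypothesis psi_le : forall D, is_divisor iota D -> psi D <= B.
Hypothesis principal : forall u, s u = u -> u != 0 -> exists E,
  [/\ is_divisor iota E, divdeg E = 0
    & forall w, is_place iota w -> divcoef E w = w u].

Lemma principal_pull u : s u = u -> u != 0 -> exists E,
  [/\ is_divisor iota E, divdeg E = 0 & forall w, is_place iota w -> pc E w = w u].
Proof.
move=> su u0; have [X [hX dX eX]] := principal su u0.
have [|||E [hE eE _]] := @pull_repr [seq p.1 | p <- X] (fun w => w u).
- by move=> w _ /=; rewrite su.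
- by move=> w pw; rewrite -eX // => /divcoef_supp [p hp <-]; apply: map_f.
- by move=> w pw fw; apply: hram.
exists E; split=> //; apply: (mulfI (_ : q%:Z != 0)); first by lia.
rewrite -divdeg_pull mulr0 -dX; apply: (divdeg_eq (iota := iota)) => //.
  exact: is_divisor_pull.
by move=> w pw; rewrite divcoef_pull eE // eX.
Qed.

(** Take [D1] where the bounded function [psi] is maximal. For [D] of large degree, a nonzero [u] in
    the space of [D - D1] gives [D + div u >= D1]; as [psi] is monotone and unchanged by adding
    [div u], it is maximal at [D] too. *)
Lemma psi_large : exists (m N : int),
  (forall D, is_divisor iota D -> psi D <= m) /\
  (forall D, is_divisor iota D -> N <= divdeg D -> psi D = m).
Proof.
have hn := is_divisor_nil iota.
pose Q (n : nat) := `[< exists D, is_divisor iota D /\ psi D = psi [::] + n%:Z >].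
have exQ : exists n, Q n by exists 0%N; apply/asboolP; exists [::]; rewrite addr0.
have ubQ n : Q n -> (n <= `|B - psi [::]|)%N.
  by move=> /asboolP [D [hD e]]; have := psi_le hD; lia.
case: (ex_maxnP exQ ubQ) => n0 /asboolP [D1 [hD1 e1]] maxn.
have hm D : is_divisor iota D -> psi D <= psi D1.
  move=> hD; rewrite leNgt e1; apply/negP => h.
  have : Q `|psi D - psi [::]|%N.
    by apply/asboolP; exists D; split=> //; lia.
  by move=> /maxn; lia.
(* From this degree on [deg (D - D1) >= psi D1 + 1], which forces dimension at least 1 because
   [psi <= psi D1]. *)
exists (psi D1), (divdeg D1 + psi D1 + 1); split=> // D hD hdeg.
apply/eqP; rewrite eq_le hm //=.
pose G := D ++ dmap ( *%R (-1)) D1.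
have hG : is_divisor iota G by apply/is_divisor_cat => //; apply: is_divisor_dmap.
have dG : divdeg G = divdeg D - divdeg D1.
  by rewrite divdeg_cat divdeg_scale mulN1r.
have pG w : pc G w = pc D w - pc D1 w.
  by rewrite pc_cat /pc big_map /= -sumrN; congr (_ + _); apply: eq_bigr => p _;
    rewrite mulN1r mulNr.
have [|u hu u0] := dim_gt0_ex (fdimL hG).
  by have := hm G hG; move: hdeg; rewrite /psi dG; lia.
have [su [/eqP|vu]] := hu; first by rewrite (negPf u0).
have [E [hE dE eE]] := principal_pull su u0.
have hDE : is_divisor iota (E ++ D) by apply: is_divisor_cat.
have -> : psi D = psi (E ++ D).
  rewrite /psi divdeg_cat dE add0r; congr (_ - _%:Z).
  have hd := dimP (fdimL hDE).
  apply: dimE; apply: (hasdim_iso (Phi := fun v => u * v) _ _ _ _ hd).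
  - by move=> k x y; ring.
  - by move=> x /eqP; rewrite mulf_eq0 (negPf u0) => /eqP.
  - move=> x [sx [->|hx]]; first by rewrite mulr0; apply: (subsp_L0 D).1.
    have [->|x0] := eqVneq x 0; first by rewrite mulr0; apply: (subsp_L0 D).1.
    split; first by rewrite autM su sx.
    right=> w pw; have := hx w pw.
    by rewrite (placeM pw) // pc_cat eE //; lia.
  move=> y [sy hy]; exists (y / u); last by rewrite mulrC divfK.
  have [->|y0] := eqVneq y 0; first by rewrite mul0r; apply: (subsp_L0 _).1.
  split; first by rewrite autM autV su sy.
  right=> w pw; rewrite (place_div pw) // pc_cat eE //.
  by case: hy => [/eqP|/(_ w pw)]; [rewrite (negPf y0)|lia].
apply: psi_mono => // [|w pw]; first exact: fdimL.
by have := vu w pw; rewrite pG pc_cat eE //; lia.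
Qed.

End LargeDegree.
End InvariantSpaces.

(** * Consequences of Riemann's theorem *)

Section Riemann.
Variables (K : closedFieldType) (F : fieldType) (iota : {rmorphism K -> F}).
Hypothesis ff : function_field iota.
Variable g : nat.
Hypothesis g0 : (0 < g)%N.
Hypothesis hg : genus iota g.
Implicit Types (D E : divisor F) (w P : F -> int) (u z : F).
Local Notation ev P x := (evalK iota P x).
Local Notation L := (inL iota).
Local Notation fdimK := (fdim iota).
Local Notation dimK := (dim iota).

Lemma aut_id : K_automorphism iota id.
Proof. by split=> //; exists id. Qed.

Lemma pull_id D : pull id 1 D = D.
Proof.
elim: D => [|[P k] D IH] //.
by rewrite /pull /= in IH *; rewrite IH.
Qed.

Lemma L0_id D : L0 iota id 1 D = L D.
Proof.
apply: funext => u; apply: propext; rewrite L0_inL // pull_id.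
by split=> [[]|].
Qed.

Lemma orb_id P : is_place iota P -> fixed id P \/ orb id 1 P P = 1%N.
Proof. by left. Qed.

Lemma ram_id P : is_place iota P -> fixed id P ->
  forall u : F, id u = u -> u != 0 -> (1 %| P u)%Z.
Proof. by move=> *; rewrite dvd1z. Qed.

Lemma inLP D u : L D u <-> forall w, is_place iota w -> vge w (- divcoef D w) u.
Proof.
split=> [[->|h] w pw|h]; [by left|by right; apply: h|].
have [->|u0] := eqVneq u 0; [by left|right=> w pw].
exact: vge_ge (h w pw) u0.
Qed.

Lemma subsp_L D : subsp iota (L D).
Proof. by rewrite -L0_id; exact: (@subsp_L0 K F iota id 1 aut_id D). Qed.

Lemma ell_hasdim D n : ell iota D n <-> hasdim iota (L D) n.
Proof.
split=> [[[f [hf jf]] hmax]|hn].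
  have [m hm hd] := hasdim_ex (subsp_L D) hmax.
  suff -> : n = m by [].
  apply/eqP; rewrite eqn_leq hm andbT.
  by have := hasdim_indep hd hf jf; rewrite card_ord.
split; first by have [b [hb jb _]] := hn; exists b.
by move=> f hf /(hasdim_indep hn hf); rewrite card_ord ltnn.
Qed.

Lemma fdim_L D : is_divisor iota D -> fdimK (L D).
Proof.
move=> hD; case: hg => _ [D0 [n [h0 /ell_hasdim hn _]]].
rewrite -L0_id; apply: (fdim_L0 ff aut_id _ _ orb_id ram_id h0 hD) => //.
by exists n; rewrite L0_id.
Qed.

Lemma riemann D : is_divisor iota D -> divdeg D - (dimK (L D))%:Z + 1 <= g%:Z.
Proof. by move=> hD; apply: hg.1 => //; apply/ell_hasdim/dimP/fdim_L. Qed.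

Lemma riemann_sharp : exists D,
  is_divisor iota D /\ divdeg D - (dimK (L D))%:Z + 1 = g%:Z.
Proof.
case: hg => _ [D [n [hD /ell_hasdim /dimE <- e]]]; by exists D.
Qed.

Lemma L_nil_K k : L [::] (iota k).
Proof. by apply/inLP => w pw; rewrite divcoef_nil; apply: vgeK. Qed.

(** All powers of [u] lie in the finite-dimensional [L(0)], so [u] is algebraic over [K], hence
    constant. *)
Lemma const_of_regular u :
  (forall w, is_place iota w -> vge w 0 u) -> exists k, u = iota k.
Proof.
move=> hu; have fL := fdim_L (is_divisor_nil iota).
have [||c [[i hi] hc]] := @hasdim_dep _ _ _ _ _ 'I_(dimK (L [::])).+1
   (fun i => u ^+ i) (dimP fL); last 1 first.
- apply: (@algebraic_const _ _ iota (\poly_(i < (dimK (L [::])).+1) c (inord i))).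
    apply/eqP => /polyP /(_ i); rewrite coef_poly ltn_ord coef0 inord_val.
    exact/eqP.
  rewrite (evalKE _ _ (size_poly _ _)) -[RHS]hc; apply: eq_bigr => j _.
  by rewrite coef_poly ltn_ord inord_val.
- move=> i; apply/inLP => w pw; rewrite divcoef_nil oppr0.
  by have := vge_exp pw i (hu w pw); rewrite mulr0.
- by rewrite card_ord.
Qed.

Lemma dim_L_nil : dimK (L [::]) = 1%N.
Proof.
apply: dimE; exists (fun _ => 1); split.
- by move=> _; rewrite -(rmorph1 iota); apply: L_nil_K.
- move=> c; rewrite big_ord_recl big_ord0 addr0 mulr1 => /eqP.
  by rewrite fmorph_eq0 => /eqP hc i; rewrite (ord1 i).
move=> u /inLP hu; have [|k ->] := @const_of_regular u.
  by move=> w pw; have := hu w pw; rewrite divcoef_nil.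
by exists (fun _ => k); rewrite big_ord_recl big_ord0 addr0 mulr1.
Qed.

Lemma L_neg_degree D u : is_divisor iota D -> divdeg D < 0 -> L D u -> u = 0.
Proof.
move=> hD dD hu; apply: contrapT => /eqP u0.
(* With this [k] the divisor [-k D] has degree at least [g + 1], whence [dim L(-k D) >= 2], while
   multiplication by [u^k] maps this space into [L(0)], of dimension 1. *)
pose k := g.+1; pose E := dmap ( *%R (- k%:Z)) D.
have hE : is_divisor iota E by apply: is_divisor_dmap.
have : (dimK (L E) <= dimK (L [::]))%N.
  apply: (dim_inj (Phi := fun z => u ^+ k * z)); try exact: fdim_L.
  - by move=> c x y; ring.
  - by move=> x /eqP; rewrite mulf_eq0 expf_eq0 (negPf u0) andbF => /eqP.
  move=> z /inLP hz; apply/inLP => w pw; rewrite divcoef_nil.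
  have := vge_mul pw (vge_exp pw k ((inLP D u).1 hu w pw)) (hz w pw).
  by congr vge; rewrite divcoef_scale; ring.
rewrite dim_L_nil; have := riemann hE; rewrite divdeg_scale /k; nia.
Qed.

Definition finpoles u := exists S : seq (F -> int),
  forall w, is_place iota w -> w u < 0 -> w \in S.

Lemma place_list (S : seq (F -> int)) : exists S' : seq (F -> int),
  uniq S' /\ forall w, (w \in S') <-> is_place iota w /\ w \in S.
Proof.
exists (undup [seq w <- S | `[< is_place iota w >]]); rewrite undup_uniq; split=> // w.
rewrite mem_undup mem_filter.
by split=> [/andP [/asboolP]|[/asboolP -> ->]].
Qed.

(** With more distinct zeros than the degree of [C], which bounds the poles, [u] would lie in [L] of
    a divisor of negative degree. *)
Lemma finite_zeros u : u != 0 -> finpoles u -> exists S : seq (F -> int),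
  forall w, is_place iota w -> 0 < w u -> w \in S.
Proof.
move=> u0 [S0 hS0]; have [S [uS hS]] := place_list S0.
apply: contrapT => hno.
have big n : exists T : seq (F -> int), [/\ uniq T, size T = n &
    forall w, w \in T -> is_place iota w /\ 0 < w u].
  elim: n => [|n [T [uT sT hT]]]; first by exists [::].
  have [w [pw wu wT]] : exists w, [/\ is_place iota w, 0 < w u & w \notin T].
    apply: contrapT => h; apply: hno; exists T => w pw wu.
    by apply: contrapT => /negP wT; apply: h; exists w.
  exists (w :: T); split; rewrite /= ?wT ?sT // => v.
  by rewrite inE => /orP [/eqP ->|/hT].
pose C := div_of S (fun w => `|w u|).
have hC : is_divisor iota C by apply: is_divisor_div_of => w /hS [].
have [T [uT sT hT]] := big (`|divdeg C|.+1).
have hTd : is_divisor iota (div_of T (fun _ => -1)).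
  by apply: is_divisor_div_of => w /hT [].
suff : u = 0 by move/eqP; rewrite (negPf u0).
apply: (@L_neg_degree (C ++ div_of T (fun _ => -1))).
- exact: is_divisor_cat.
- rewrite divdeg_cat [divdeg (div_of T _)]divdeg_div_of.
  rewrite big_const_seq count_predT sT.
  have -> n : iter n (+%R (-1)) 0 = - n%:Z.
    by elim: n => // n /= ->; lia.
  by lia.
apply/inLP => w pw; right; rewrite divcoef_cat !divcoef_div_of //.
case: (boolP (w \in T)) => [/hT [_ h]|_]; case: ifP => hw; try lia.
rewrite leNgt; apply/negP => h; move: hw.
by rewrite (hS w).2 //; split=> //; apply: hS0 => //; lia.
Qed.

Lemma exists_place : exists P, is_place iota P.
Proof.
have [[|p D] [hD e]] := riemann_sharp; last by exists p.1; apply: hD; rewrite mem_head.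
by move: e; rewrite divdeg_nil dim_L_nil; lia.
Qed.

Lemma exists_nonconstant_finpoles : exists z, finpoles z /\ forall k, z <> iota k.
Proof.
(* Degree [g + 1] makes [dim L(D) >= 2], so there is a nonconstant function whose only possible pole
   is [P]. *)
have [P pP] := exists_place; pose D : divisor F := [:: (P, g.+1%:Z)].
have hD : is_divisor iota D by apply: is_divisor_cons.
have [z hz nz] : exists2 z, L D z & ~ L [::] z.
  apply: contrapT => hno.
  have := @dim_sub _ _ iota (L [::]) (L D) (subsp_L D) _ (fdim_L (is_divisor_nil iota)).
  have := riemann hD; rewrite dim_L_nil divdeg_cons divdeg_nil /= => h1 h2.
  suff : (dimK (L D) <= 1)%N by lia.
  apply: h2 => u hu; apply: contrapT => nu; apply: hno; by exists u.
exists z; split=> [|k e]; last by apply: nz; rewrite e; apply: L_nil_K.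
exists [:: P] => w pw hw; rewrite mem_seq1; apply: contrapT => /negP /eqP h.
have /inLP/(_ w pw) := hz.
rewrite divcoef_cons divcoef_nil /= asboolF ?addr0; last by move=> e; apply: h.
case=> [z0|]; last by lia.
by apply: nz; rewrite z0; apply: (subsp_L _).1.
Qed.

Lemma vge_evalK w p z : is_place iota w -> vge w 0 z -> vge w 0 (ev p z).
Proof.
move=> pw hz; rewrite (evalKE _ _ (leqnn _)).
apply: (vge_sum pw) => i; apply: vgeZ => //.
by have := vge_exp pw i hz; rewrite mulr0.
Qed.

(** [u] is algebraic over [K(z)] for a nonconstant [z] with finitely many poles. Where [z] is
    regular and the leading coefficient of the relation does not vanish, a pole of [u] would make
    the top term dominate all others. Only finitely many places are excluded. *)
Lemma all_finpoles u : finpoles u.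
Proof.
have [z [[S hS] nz]] := exists_nonconstant_finpoles.
have [m [p [[i0 hi0] hp]]] := algebraic_dependence ff z u.
case: (@arg_maxnP _ i0 (fun i => p i != 0) (fun i : 'I_m => i : nat) hi0)
  => k /= pk kmax.
have pz0 : ev (p k) z != 0.
  by apply/eqP => /(algebraic_const pk) [c /nz].
have [|T hT] := @finite_zeros (ev (p k) z) pz0.
  exists S => w pw h; apply: contrapT => /negP wS.
  have hz : vge w 0 z.
    by right; rewrite leNgt; apply/negP => /(hS _ pw) h'; rewrite h' in wS.
  by have := vge_ge (vge_evalK (p k) pw hz) pz0; lia.
exists (S ++ T) => w pw wu; rewrite mem_cat; apply/orP.
apply: contrapT => hno; have [wS wT] : w \notin S /\ w \notin T.
  by split; apply/negP => h; apply: hno; [left|right].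
have hz : vge w 0 z.
  by right; rewrite leNgt; apply/negP => /(hS _ pw) h'; rewrite h' in wS.
have w0 : w (ev (p k) z) = 0.
  apply/eqP; rewrite eq_le (vge_ge (vge_evalK (p k) pw hz) pz0) andbT leNgt.
  by apply/negP => /(hT _ pw) h'; rewrite h' in wT.
have u0 : u != 0.
  by apply/eqP => e; move: wu; rewrite e; case: pw => ->.
have t0 : ev (p k) z * u ^+ k != 0 by rewrite mulf_neq0 ?expf_neq0.
have tv : w (ev (p k) z * u ^+ k) = k%:Z * w u.
  by rewrite (placeM pw) ?expf_neq0 // (placeX pw) // w0 add0r.
move: hp; rewrite (bigD1 k) //= => hp.
have [|] := @place_add_lt _ _ iota w pw _
  (\sum_(i < m | i != k) ev (p i) z * u ^+ i) t0; last first.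
  by rewrite hp eqxx.
rewrite tv; apply: big_ind; [by left|exact: (vgeD pw)|move=> i ik].
have [->|pi] := eqVneq (p i) 0; first by rewrite evalK0 mul0r; left.
have := kmax i pi; rewrite leq_eqVlt (inj_eq val_inj) (negPf ik) /= => hik.
rewrite [_ * u ^+ i]mulrC; apply: (vge_mulr pw); last exact: vge_evalK.
by right; rewrite (placeX pw) //; nia.
Qed.

Lemma principal_divisor u : u != 0 -> exists E,
  [/\ is_divisor iota E, divdeg E = 0
    & forall w, is_place iota w -> divcoef E w = w u].
Proof.
move=> u0; have [S1 h1] := all_finpoles u.
have [S2 h2] := finite_zeros u0 (all_finpoles u).
have [S [uS hS]] := place_list (S1 ++ S2).
pose E := div_of S (fun w => w u).
have hE : is_divisor iota E by apply: is_divisor_div_of => w /hS [].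
have eE w : is_place iota w -> divcoef E w = w u.
  move=> pw; rewrite divcoef_div_of //; case: ifP => // /negP wS.
  apply/esym/eqP; rewrite eq_le !leNgt; apply/andP; split; apply/negP => h;
    apply: wS; apply/hS; split=> //; rewrite mem_cat.
    by rewrite (h2 w) ?orbT.
  by rewrite (h1 w).
exists E; split=> //; apply/eqP; rewrite eq_le !leNgt; apply/andP; split; apply/negP => h.
  have : u = 0; last by move/eqP; rewrite (negPf u0).
  apply: (@L_neg_degree (dmap ( *%R (-1)) E)).
  - exact: is_divisor_dmap.
  - by rewrite divdeg_scale; lia.
  by apply/inLP => w pw; right; rewrite divcoef_scale eE //; lia.
have : u^-1 = 0; last by move/eqP; rewrite invr_eq0 (negPf u0).
apply: (@L_neg_degree E) => //.
by apply/inLP => w pw; right; rewrite (placeV pw) // eE.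
Qed.

Lemma riemann_large : exists N : int, forall D, is_divisor iota D ->
  N <= divdeg D -> (dimK (L D))%:Z = divdeg D + 1 - g%:Z.
Proof.
have e D : psi iota id 1 D = divdeg D - (dimK (L D))%:Z by rewrite /psi L0_id.
have [|||m [N [hm hN]]] := @psi_large _ _ iota ff id 1 aut_id isT (fun _ => erefl)
  orb_id ram_id (g%:Z - 1).
- by move=> D hD; rewrite L0_id; apply: fdim_L.
- by move=> D hD; rewrite e; have := riemann hD; lia.
- by move=> u _; apply: principal_divisor.
(* Riemann's inequality bounds the stable value above, and a divisor that attains the genus bounds
   it below. *)
have em : m = g%:Z - 1.
  have [P pP] := exists_place.
  have hP : is_divisor iota [:: (P, N)] by apply: is_divisor_cons.
  have := hN _ hP; rewrite divdeg_cons divdeg_nil addr0 => /(_ (lexx _)).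
  rewrite e => h1; have := riemann hP.
  by have [D0 [hD0 h0]] := riemann_sharp; have := hm _ hD0; rewrite e; lia.
by exists N => D hD /(hN D hD); rewrite e em; lia.
Qed.

Lemma common_poles n (z : 'I_n -> F) : exists B,
  [/\ is_divisor iota B, (forall p, p \in B -> 0 <= p.2) & forall i, L B (z i)].
Proof.
pose S0 i := sval (cid (all_finpoles (z i))).
have hS0 i w : is_place iota w -> w (z i) < 0 -> w \in S0 i.
  by rewrite /S0; case: cid => T hT; apply: hT.
have [S [uS hS]] := place_list (flatten [seq S0 i | i <- enum 'I_n]).
exists (div_of S (fun w => \sum_i `|w (z i)|)); split.
- by apply: is_divisor_div_of => w /hS [].
- by move=> p /mapP [w _ ->] /=; apply: sumr_ge0.
move=> i; apply/inLP => w pw; right; rewrite divcoef_div_of //.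
case: ifP => [_|/negP wS].
  rewrite (bigD1 i) //=; set T := \sum_(_ < n | _) _.
  have T0 : 0 <= T by apply: sumr_ge0.
  by move: (w (z i)) T T0 => a b; clear; lia.
rewrite oppr0 leNgt; apply/negP => h; apply: wS; apply/hS; split=> //.
apply/flattenP; exists (S0 i); last exact: hS0.
by apply/mapP; exists i => //; rewrite mem_enum.
Qed.

Lemma dim_L_effective D : is_divisor iota D -> (forall p, p \in D -> 0 <= p.2) ->
  (dimK (L D))%:Z <= divdeg D + 1.
Proof.
move=> hD eD.
have := @dim_L0_cat _ _ iota ff id 1 aut_id isT (fun _ => erefl) orb_id ram_id [::] D hD eD.
rewrite !L0_id cats0 dim_L_nil => h.
by have [_] := h (fdim_L (is_divisor_nil iota)); lia.
Qed.

(* The pole divisor bounds the degree [F : K(x)]. *)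
Lemma poly_dependence C (d : nat) x (z : 'I_d.+1 -> F) :
  is_divisor iota C -> (forall p, p \in C -> 0 <= p.2) -> divdeg C = d%:Z ->
  L C x -> exists p : 'I_d.+1 -> {poly K},
    (exists i, p i != 0) /\ \sum_i ev (p i) x * z i = 0.
Proof.
move=> hC eC dC hx; have [B [hB eB hz]] := common_poles z.
have cC w : 0 <= divcoef C w.
  rewrite /divcoef big_seq; apply: sumr_ge0 => p hp.
  by case: asbool => //; apply: eC.
have dB : 0 <= divdeg B by rewrite /divdeg big_seq; apply: sumr_ge0.
(* The [(l + 1)(d + 1)] products [x^i z_j] lie in [L(l C + B)], of dimension at most
   [l d + deg B + 1]; they are dependent because [l > deg B]. *)
pose l := `|divdeg B|.+1.
pose D := dmap ( *%R l%:Z) C ++ B.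
have hD : is_divisor iota D by apply/is_divisor_cat => //; apply: is_divisor_dmap.
have eD p : p \in D -> 0 <= p.2.
  rewrite mem_cat => /orP [/mapP [r /eC hr -> /=]|/eB//].
  by rewrite mulr_ge0.
have [||c [[[i0 j0] h0] hc]] := @hasdim_dep _ _ iota _ _ ('I_l.+1 * 'I_d.+1)%type
   (fun ij => x ^+ ij.1 * z ij.2) (dimP (fdim_L hD)).
- move=> [i j] /=; apply/inLP => w pw; rewrite divcoef_cat divcoef_scale.
  have /inLP/(_ w pw) h1 := hx; have /inLP/(_ w pw) h2 := hz j.
  have := vge_mul pw (vge_exp pw i h1) h2; apply: vge_le.
  have h3 : i%:Z * divcoef C w <= l%:Z * divcoef C w.
    by rewrite ler_wpM2r // lez_nat -ltnS.
  by rewrite opprD mulrN lerD2r lerN2.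
- rewrite card_prod !card_ord; have := dim_L_effective hD eD.
  rewrite divdeg_cat divdeg_scale dC /l; nia.
exists (fun j => \poly_(i < l.+1) c (inord i, j)); split.
  exists j0; apply/eqP => /polyP /(_ i0); rewrite coef_poly ltn_ord coef0.
  by rewrite inord_val => /eqP; rewrite (negPf h0).
rewrite -[RHS]hc.
rewrite [RHS](eq_bigr (fun ij => iota (c (ij.1, ij.2)) * (x ^+ ij.1 * z ij.2))) => [|[]//].
rewrite -(pair_bigA _ (fun (i : 'I_l.+1) (j : 'I_d.+1) =>
   iota (c (i, j)) * (x ^+ i * z j))) /= exchange_big.
apply: eq_bigr => j _; rewrite (evalKE _ _ (size_poly _ _)) mulr_suml.
by apply: eq_bigr => i _; rewrite coef_poly ltn_ord inord_val mulrA.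
Qed.

End Riemann.

(** * Cyclic automorphisms of prime order *)

Section Ramification.
Variables (K : closedFieldType) (F : fieldType) (iota : {rmorphism K -> F}).
Hypothesis ff : function_field iota.
Variables (s : F -> F) (q : nat).
Hypothesis hs : K_automorphism iota s.
Hypothesis q_prime : prime q.
Hypothesis hq : forall f, iter q s f = f.
Hypothesis s_nontriv : exists f, s f != f.
Implicit Types (D E : divisor F) (w P Q : F -> int) (u v y z : F) (lam : nat -> K).

Let q0 : (0 < q)%N := prime_gt0 q_prime.

(** The stabilizer of a place in a group of prime order is trivial or everything: by a Bezout
    identity, [s] is a power of any nontrivial [s^i] fixing [P]. *)
Lemma orb_dichotomy P : is_place iota P -> fixed s P \/ orb s q P P = 1%N.
Proof.
move=> pP; have [fP|nP] := pselect (fixed s P); [by left|right].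
rewrite /orb (bigD1 (Ordinal q0)) //= asboolT // big1 // => i hi.
rewrite asboolF // => e; apply: nP.
have i0 : (0 < i)%N by rewrite lt0n; apply: contra_neq hi => h; apply: val_inj.
have mult a : rot s (a * i) P = P.
  by elim: a => [|a IH] //; rewrite mulSn -rotD e.
case: (egcdnP q i0) => a b hab _.
have hc : gcdn i q = 1%N.
  by apply/eqP; rewrite -/(coprime _ _) coprime_sym prime_coprime // gtnNdvd.
have multq c : rot s (c * q) P = P.
  by elim: c => [|c IH] //; rewrite mulSn -rotD (rotq hq).
by have := mult a; rewrite hab hc addn1 rotSr multq.
Qed.

Definition cnorm u := \prod_(i < q) iter i s u.

Lemma cnorm_inv u : s (cnorm u) = cnorm u.
Proof.
rewrite /cnorm; have -> : s (\prod_(i < q) iter i s u) = \prod_(i < q) iter i.+1 s u.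
  apply: (big_morph s (autM hs) (aut1 hs)).
case: q q0 hq => // r _ hr.
by rewrite big_ord_recr big_ord_recl /= mulrC -[s (iter r s u)]/(iter r.+1 s u) hr.
Qed.

Lemma cnorm_neq0 u : u != 0 -> cnorm u != 0.
Proof. by move=> u0; apply/prodf_neq0 => i _; rewrite (iter_aut_eq0 hs). Qed.

Lemma iter_place i P u : fixed s P -> P (iter i s u) = P u.
Proof. by move=> fP; have := rot_fixed i fP => /(congr1 (fun v : F -> int => v u)). Qed.

Lemma cnorm_place P u : is_place iota P -> fixed s P -> u != 0 ->
  P (cnorm u) = q%:Z * P u.
Proof.
move=> pP fP u0; rewrite /cnorm -[q in RHS]card_ord -sum1_card.
rewrite (big_morph Posz PoszD (erefl _)) mulr_suml.
suff [] : \prod_(i < q) iter i s u != 0 /\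
   P (\prod_(i < q) iter i s u) = \sum_(i < q) 1%N%:Z * P u by [].
elim/big_rec2: _ => [|i a b _ [b0 hb]]; first by rewrite oner_eq0 (place1 pP).
by rewrite mulf_neq0 ?(iter_aut_eq0 hs) // (placeM pP) ?(iter_aut_eq0 hs) // hb
  mul1r iter_place.
Qed.

(** If some invariant value were prime to [q], a Bezout combination with the norm of a uniformizer,
    of value [q], would give an invariant uniformizer [pi]. As residues lie in [K], each function
    regular at [P] would be approximated to every order by invariant ones, and [s] would be the
    identity. *)
Lemma fixed_ramified P : is_place iota P -> fixed s P ->
  forall u, s u = u -> u != 0 -> (q%:Z %| P u)%Z.
Proof.
move=> pP fP u su u0; apply: contrapT => /negP nd.
pose V (n : int) := exists v, [/\ s v = v, v != 0 & P v = n].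
have VD m n : V m -> V n -> V (m + n).
  move=> [a [sa a0 pa]] [b [sb b0 pb]]; exists (a * b).
  by rewrite (autM hs) sa sb mulf_neq0 // (placeM pP) // pa pb.
have VN m : V m -> V (- m).
  move=> [a [sa a0 pa]]; exists a^-1.
  by rewrite (autV hs) sa invr_eq0 (placeV pP) // pa.
have V0 : V 0 by exists 1; rewrite (aut1 hs) oner_eq0 (place1 pP).
have VM (k m : int) : V m -> V (k * m).
  move=> hm; have Vn (n : nat) : V (n%:Z * m).
    elim: n => [|n IH]; first by rewrite mul0r.
    by rewrite -addn1 PoszD mulrDl mul1r; apply: VD.
  by case: k => n //; rewrite NegzE mulNr; apply: VN.
have [t ht] : exists t, P t = 1 by case: pP.
have t0 : t != 0.
  by apply/eqP => e; move: ht; rewrite e; case: pP => ->.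
have Vq : V q%:Z.
  exists (cnorm t); rewrite cnorm_inv cnorm_neq0 //.
  by rewrite (cnorm_place pP fP t0) ht mulr1.
have [pi [spi pi0 ppi]] : V 1.
  have [a [b hab]] := Bezoutz q%:Z (P u).
  have <- : a * q%:Z + b * P u = 1.
    rewrite hab; apply/eqP; rewrite -/(coprimez _ _) /coprimez.
    by move: nd; rewrite dvdzE /= -prime_coprime // /coprime /gcdz /= => /eqP ->.
  by apply: VD; apply: VM => //; exists u.
have approx z (k : nat) : vge P 0 z -> exists A, s A = A /\ vge P k%:Z (z - A).
  move=> hz; elim: k => [|k [A [sA hA]]]; first by exists 0; rewrite (aut0 hs) subr0.
  have pik : pi ^+ k != 0 by rewrite expf_neq0.
  have ppik : P (pi ^+ k) = k%:Z by rewrite (placeX pP) // ppi mulr1.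
  have h0 : vge P 0 ((z - A) / pi ^+ k).
    have := vge_mul pP hA (vge_refl P (pi ^+ k)^-1).
    by rewrite (placeV pP) // ppik subrr.
  have [c hc] := residue ff pP h0.
  exists (A + iota c * pi ^+ k); split.
    by rewrite (autD hs) (autM hs) (autK hs) (autX hs) sA spi.
  have := vge_mul pP hc (vge_refl P (pi ^+ k)).
  rewrite mulrBl divfK // ppik opprD addrA.
  by congr vge; lia.
have inv0 z : vge P 0 z -> s z = z.
  move=> hz; apply/eqP; rewrite -subr_eq0; apply/eqP.
  apply: (vge_eq0 (v := P)) => k; have [A [sA hA]] := approx z k hz.
  have -> : s z - z = s (z - A) - (z - A) by rewrite (autB hs) sA; ring.
  apply: (vgeB pP) => //; case: hA => [->|h]; first by rewrite (aut0 hs); left.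
  by right; rewrite (iter_place 1 _ fP).
have [f /eqP] := s_nontriv; apply.
have [f0|f0] := lerP 0 (P f); first by apply: inv0; right.
have fn0 : f != 0 by apply/eqP => e; move: f0; rewrite e; case: pP => ->.
have : s f^-1 = f^-1 by apply: inv0; right; rewrite (placeV pP) //; lia.
by rewrite (autV hs) => /invr_inj.
Qed.

End Ramification.

(** * The eigenfiltration of a cyclic action *)

Section CyclicAction.
Variables (K : closedFieldType) (F : fieldType) (iota : {rmorphism K -> F}).
Hypothesis ff : function_field iota.
Variable g : nat.
Hypothesis g0 : (0 < g)%N.
Hypothesis hg : genus iota g.
Variables (s : F -> F) (q : nat).
Hypothesis hs : K_automorphism iota s.
Hypothesis q_prime : prime q.
Hypothesis hq : forall f, iter q s f = f.
Hypothesis s_nontriv : exists f, s f != f.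
Implicit Types (D E : divisor F) (w P Q : F -> int) (u v y z : F) (lam : nat -> K).
Local Notation ev P x := (evalK iota P x).
Local Notation L := (inL iota).
Local Notation fdimK := (fdim iota).
Local Notation dimK := (dim iota).

Let q0 : (0 < q)%N := prime_gt0 q_prime.

Let dich := orb_dichotomy (iota := iota) q_prime hq.
Let ram := fixed_ramified ff hs q_prime hq s_nontriv.

Local Notation L0s := (L0 iota s q).
Local Notation psis := (psi iota s q).
Local Notation pcs := (pc s q).
Local Notation orbs := (orb s q).

Lemma L_pull_s D u : L (pull s q D) u -> L (pull s q D) (s u).
Proof.
move=> /inLP hu; apply/inLP => w pw.
have := hu _ (comp_place hs q0 hq pw); rewrite !divcoef_pull (pc_comp q0 hq).
by case=> [->|h]; [left; rewrite (aut0 hs)|right].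
Qed.

Lemma fdim_L_pull D : is_divisor iota D -> fdimK (L (pull s q D)).
Proof. by move=> hD; apply: (fdim_L ff hg); apply: is_divisor_pull. Qed.

Lemma fdim_L0s D : is_divisor iota D -> fdimK (L0s D).
Proof.
move=> hD; apply: (fdim_sub (subsp_L0 q hs D) _ (fdim_L_pull hD)).
by move=> u /L0_inL [].
Qed.

Lemma L0_nilP u : L0s [::] u <-> exists k, u = iota k.
Proof.
split=> [/L0P [_ hu]|[k ->]].
  by apply: (const_of_regular ff hg) => w pw; have := hu w pw; rewrite pc_nil.
apply/L0P; split; first exact: autK.
by move=> w pw; rewrite pc_nil; apply: vgeK.
Qed.

Lemma psi_nil : psis [::] = -1.
Proof.
rewrite /psi divdeg_nil (_ : dimK (L0s [::]) = 1%N) // -(dim_L_nil ff hg).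
apply: eq_dim => u; split=> [/L0_nilP [k ->]|hu]; first exact: L_nil_K.
apply/L0_nilP; apply: (const_of_regular ff hg) => w pw.
by have /inLP/(_ w pw) := hu; rewrite divcoef_nil.
Qed.

Lemma psi_stable B : (forall D, is_divisor iota D -> psis D <= B) ->
  exists (m N : int), [/\ -1 <= m,
  forall D, is_divisor iota D -> psis D <= m &
  forall D, is_divisor iota D -> N <= divdeg D -> psis D = m].
Proof.
move=> hB; have [||m [N [h1 h2]]] := psi_large ff hs q0 hq dich
  ram _ hB.
- exact: fdim_L0s.
- by move=> u _; apply: (principal_divisor ff g0 hg).
by exists m, N; split=> //; rewrite -psi_nil h1.
Qed.

Section Filtration.
Variable lam : nat -> K.

Fixpoint eigT i u :=
  if i is j.+1 then s (eigT j u) - iota (lam j) * eigT j u else u.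

Lemma eigT_klinear i : klinear iota (eigT i).
Proof.
elim: i => // i IH k u v /=; rewrite IH (aut_klinear hs); ring.
Qed.

Lemma eigT_s i u : eigT i (s u) = s (eigT i u).
Proof. by elim: i => //= i ->; rewrite (autB hs) (autM hs) (autK hs). Qed.

(** The operator [p(s)]. It turns the polynomial identity [lamq] into [eigT q = s^q - 1 = 0]. *)
Definition eigop (p : {poly K}) u := \sum_(i < size p) iota p`_i * iter i s u.

Lemma eigopE n (p : {poly K}) u : (size p <= n)%N ->
  eigop p u = \sum_(i < n) iota p`_i * iter i s u.
Proof.
move=> hn; rewrite /eigop (big_ord_widen _ (fun i => iota p`_i * iter i s u) hn).
rewrite big_mkcond; apply: eq_bigr => i _; case: ltnP => // h.
by rewrite nth_default // rmorph0 mul0r.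
Qed.

Lemma eigopXsubC c (p : {poly K}) u :
  eigop (('X - c%:P) * p) u = s (eigop p u) - iota c * eigop p u.
Proof.
pose n := size p.
have h : (size (('X - c%:P) * p)%R <= n.+1)%N.
  by apply: leq_trans (size_polyMleq _ _) _; rewrite size_XsubC.
rewrite (eigopE _ h) mulrBl.
under eq_bigr => i _ do rewrite coefB coefXM coefCM rmorphB mulrBl.
rewrite sumrB; congr (_ - _).
  rewrite big_ord_recl eqxx rmorph0 mul0r add0r (big_morph s (autD hs) (aut0 hs)).
  by apply: eq_bigr => i _; rewrite (autM hs) (autK hs).
rewrite (eigopE _ (leqnSn n)) mulr_sumr.
by apply: eq_bigr => i _; rewrite rmorphM mulrA.
Qed.

Lemma eigTE i u : eigT i u = eigop (\prod_(j < i) ('X - (lam j)%:P)) u.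
Proof.
elim: i => [|i IH] /=.
  by rewrite big_ord0 /eigop size_poly1 big_ord_recl big_ord0 addr0 coef1 rmorph1 mul1r.
by rewrite big_ord_recr /= [X in eigop X u]mulrC eigopXsubC -IH.
Qed.

Hypothesis lamq : \prod_(j < q) ('X - (lam j)%:P) = 'X^q - 1.

Lemma eigTq u : eigT q u = 0.
Proof.
have h : (size ('X^q - 1 : {poly K})%R <= q.+1)%N by rewrite -polyC1 size_XnsubC.
rewrite eigTE lamq (eigopE _ h).
under eq_bigr => i _ do rewrite coefB coefXn coef1 rmorphB mulrBl !rmorph_nat.
rewrite sumrB (bigD1 ord_max) //= eqxx mul1r hq big1 => [|i hi]; last first.
  have /negPf -> : (i : nat) != q by apply: contra_neq hi => e; apply: val_inj.
  by rewrite mul0r.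
rewrite addr0 (bigD1 ord0) //= mul1r big1 ?addr0 ?subrr // => i hi.
have /negPf -> : (i : nat) != 0%N by apply: contra_neq hi => e; apply: val_inj.
by rewrite mul0r.
Qed.

(** The last nonzero term of the chain [eigT n u] is an eigenvector. Its index is positive because
    [lam 0 = 1] and [u] is not invariant. *)
Lemma eigT_exists u : s u != u -> lam 0%N = 1 ->
  exists i, [/\ (0 < i < q)%N, eigT i u != 0 & s (eigT i u) = iota (lam i) * eigT i u].
Proof.
move=> su l0.
have ex : exists n, eigT n u == 0 by exists q; rewrite eigTq.
case: (ex_minnP ex) => -[|[|n]] /eqP hn nmin.
- by move: su; rewrite [u]hn (aut0 hs) eqxx.
- by move: hn => /= /eqP; rewrite l0 rmorph1 mul1r subr_eq0 (negPf su).
exists n.+1; split.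
- by rewrite ltnS leq0n /=; apply: nmin; rewrite eigTq.
- by apply/negP => /nmin; rewrite ltnn.
- by apply/eqP; rewrite -subr_eq0; apply/eqP.
Qed.

Variable V : F -> Prop.
Hypothesis sV : subsp iota V.
Hypothesis fV : fdimK V.
Hypothesis Vs : forall u, V u -> V (s u).

Lemma eigT_stable i u : V u -> V (eigT i u).
Proof.
by move=> hu; elim: i => //= i IH; apply: (subspB sV); [apply: Vs|apply: subspZ].
Qed.

(** The quotient [ker (eigT (i+1)) / ker (eigT i)] within [V], realized inside [F] as an image under
    [eigT i], where it consists of eigenvectors for [lam i]. *)
Definition grade i a := exists2 u, V u /\ eigT i.+1 u = 0 & eigT i u = a.

Lemma grade_sub i a : grade i a -> V a.
Proof. by move=> [u [hu _] <-]; apply: eigT_stable. Qed.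

Lemma subsp_grade i : subsp iota (grade i).
Proof.
split=> [|k a b [u [hu tu] <-] [v [hv tv] <-]].
  exists 0; last exact: klinear0 (eigT_klinear i).
  by split; [exact: sV.1|exact: klinear0 (eigT_klinear _)].
exists (iota k * u + v); last exact: eigT_klinear.
by split; [apply: sV.2|rewrite eigT_klinear tu tv mulr0 addr0].
Qed.

Lemma grade_eigen i a : grade i a -> s a = iota (lam i) * a.
Proof. by move=> [u [_ /= /eqP]]; rewrite subr_eq0 => /eqP h <-. Qed.

Lemma fdim_grade i : fdimK (grade i).
Proof. exact: fdim_sub (subsp_grade i) (@grade_sub i) fV. Qed.

(** Rank-nullity for [eigT n] on successive kernels; the last kernel is all of [V] because [eigT q]
    vanishes. *)
Lemma dim_filtration : dimK V = (\sum_(i < q) dimK (grade i))%N.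
Proof.
have h n : hasdim iota (fun u => V u /\ eigT n u = 0) (\sum_(i < n) dimK (grade i))%N.
  elim: n => [|n IH].
    rewrite big_ord0; exists (fun _ => 0); split; [by case|by move=> c _ []|].
    by move=> u [_ /= ->]; exists (fun _ => 0); rewrite big_ord0.
  have -> : (\sum_(i < n.+1) dimK (grade i) = \sum_(i < n) dimK (grade i) +
    dimK (grade n))%N by rewrite big_ord_recr.
  apply: (rank_nullity (Phi := eigT n)).
  - exact: eigT_klinear.
  - congr hasdim: IH; apply: funext => u; apply: propext.
    split=> [[hu tu]|[[hu _] tu]]; split=> //; split=> //=.
    by rewrite tu (aut0 hs) mulr0 subrr.
  - exact: dimP (fdim_grade n).
  split=> [|k u v [hu tu] [hv tv]].
    by split; [exact: sV.1|exact: (klinear0 (eigT_klinear n.+1))].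
  by split; [apply: sV.2|rewrite eigT_klinear tu tv mulr0 addr0].
apply: dimE; congr hasdim: (h q); apply: funext => u; apply: propext.
by split=> [[]|hu]//; split=> //; apply: eigTq.
Qed.

End Filtration.

(** * Functions on a quotient of genus zero *)

Section GenusZero.
Hypothesis psi_le : forall D, is_divisor iota D -> psis D <= -1.

Lemma pc1 P w : pcs [:: (P, 1)] w = (orbs P w)%:Z.
Proof. by rewrite pc_cons pc_nil mul1r addr0. Qed.

Lemma is_divisor1 P k : is_place iota P -> is_divisor iota [:: (P, k)].
Proof. by move=> pP; apply: is_divisor_cons. Qed.

(** [psi <= -1] gives dimension at least 2 in degree 1, hence a function whose only pole on the
    quotient is simple: a coordinate of the projective line. *)
Lemma simple_pole P : is_place iota P -> exists h,
  [/\ L0s [:: (P, 1)] h, h != 0 & P h = - (orbs P P)%:Z].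
Proof.
move=> pP; have hD := is_divisor1 (k := 1) pP.
have [h hh nh] : exists2 h, L0s [:: (P, 1)] h & ~ L0s [::] h.
  apply: contrapT => hno.
  have hsub u : L0s [:: (P, 1)] u -> L0s [::] u.
    by move=> hu; apply: contrapT => nu; apply: hno; exists u.
  have := dim_sub (subsp_L0 q hs _) hsub (fdim_L0s (is_divisor_nil iota)).
  have := psi_le hD; have := psi_nil; rewrite /psi divdeg_cons !divdeg_nil /=; lia.
have [h0 hP] := L0_exact hs q0 hq dich ram pP hh nh.
by exists h; rewrite hP pc_nil oppr0 add0r.
Qed.

(** [psi <= -1] gives dimension at least 1 in degree 0; then [div u + pull D] is effective of degree
    zero, hence zero. *)
Lemma degree_zero_principal D : is_divisor iota D -> divdeg D = 0 ->
  exists u, [/\ s u = u, u != 0 & forall w, is_place iota w -> w u = - pcs D w].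
Proof.
move=> hD dD; have [|u [su hu] u0] := dim_gt0_ex (fdim_L0s hD).
  by have := psi_le hD; rewrite /psi dD; lia.
exists u; split=> // w pw.
have [E [hE dE eE]] := principal_divisor ff g0 hg u0.
case: hu => [/eqP|hu]; first by rewrite (negPf u0).
have hX : is_divisor iota (E ++ pull s q D).
  by apply: is_divisor_cat => //; apply: is_divisor_pull.
have := @divcoef_eq0 _ _ _ _ w hX; rewrite divdeg_cat dE divdeg_pull dD mulr0.
move=> /(_ erefl) h; have : divcoef (E ++ pull s q D) w = 0.
  by apply: h => v pv; rewrite divcoef_cat eE // divcoef_pull; have := hu v pv; lia.
by rewrite divcoef_cat eE // divcoef_pull; lia.
Qed.

(** The pole of [x] on the quotient is at most simple, so one zero at [Q] exhausts the degree:
    [div x + pull (P - Q)] is effective of degree zero. *)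
Lemma zero_orbit P Q x : is_place iota P -> is_place iota Q ->
  L0s [:: (P, 1)] x -> 0 < Q x ->
  forall w, is_place iota w -> w x = (orbs Q w)%:Z - (orbs P w)%:Z.
Proof.
move=> pP pQ [sx hx] Qx w pw.
have x0 : x != 0 by apply/eqP => e; move: Qx; rewrite e; case: pQ => ->.
case: hx => [/eqP|hx]; first by rewrite (negPf x0).
have [E [hE dE eE]] := principal_divisor ff g0 hg x0.
pose D : divisor F := [:: (P, 1); (Q, -1)].
have hX : is_divisor iota (E ++ pull s q D).
  apply: is_divisor_cat => //; apply: is_divisor_pull => //.
  by apply: is_divisor_cons => //; apply: is_divisor1.
have pD (v : F -> int) : pcs D v = (orbs P v)%:Z - (orbs Q v)%:Z.
  by rewrite !pc_cons pc_nil /=; lia.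
have := @divcoef_eq0 _ _ _ _ w hX.
rewrite divdeg_cat dE divdeg_pull !divdeg_cons divdeg_nil /= => h.
have : divcoef (E ++ pull s q D) w = 0.
  apply: h => [|v pv]; first by lia.
  rewrite divcoef_cat eE // divcoef_pull pD.
  have [->|/orb_neq0 [i ->]] := eqVneq (orbs Q v) 0%N.
    by have := hx v pv; rewrite pc1; lia.
  rewrite !(orb_rot q0 hq) /rot iter_fix //.
  have : (orbs Q Q)%:Z <= Q x.
    apply: (pull_ind_ge q0 dich ram) => //; last by lia.
    by move=> fQ; rewrite orb_fixed ?dvdzz.
  by lia.
by rewrite divcoef_cat eE // divcoef_pull pD; lia.
Qed.

(** Subtracting a multiple of [x^(k+1)] lowers the pole order by one step, down to the constants. *)
Lemma L0_polynomial P x k f : is_place iota P -> L0s [:: (P, 1)] x ->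
  P x = - (orbs P P)%:Z -> L0s [:: (P, k%:Z)] f ->
  exists p : {poly K}, (size p <= k.+1)%N /\ f = ev p x.
Proof.
move=> pP hx Px; have x0 : x != 0.
  apply/eqP => e; move: Px; rewrite e; case: pP => -> _ _ _ _.
  by have := orb_pos s q0 P; lia.
have [sx [/eqP|hx']] := hx; first by rewrite (negPf x0).
elim: k f => [|k IH] f hf.
  have /L0_nilP [c ->] : L0s [::] f.
    by apply: (L0_ext hs) hf => w _; rewrite pc_cons mul0r add0r.
  by exists c%:P; rewrite size_polyC evalKC; split=> //; case: (c != 0).
have e1 : L0s [:: (P, k.+1%:Z)] = L0s [:: (P, 1); (P, k%:Z)].
  by apply: funext => u; apply: propext; split; apply: (L0_ext hs) => w _;
    rewrite !pc_cons /=; lia.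
have hxk : L0s [:: (P, 1); (P, k%:Z)] (x ^+ k.+1).
  rewrite -e1; split; first by rewrite (autX hs) sx.
  right=> w pw; rewrite (placeX pw) // pc_cons pc_nil addr0 /= -mulrN.
  by apply: ler_wpM2l => //; have := hx' w pw; rewrite pc1.
have nxk : ~ L0s [:: (P, k%:Z)] (x ^+ k.+1).
  move=> [_ [/eqP|/(_ P pP)]]; first by rewrite (negPf (expf_neq0 _ x0)).
  by rewrite (placeX pP) // Px pc_cons pc_nil /=; have := orb_pos s q0 P; nia.
rewrite e1 in hf.
have [c hc] := L0_step ff hs q0 hq dich ram pP hf hxk nxk.
have [p [hp e]] := IH _ hc; exists (p + c *: 'X^(k.+1)); split.
  apply: leq_trans (size_polyD _ _) _; rewrite geq_max (leq_trans hp) //=.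
  by apply: leq_trans (size_scale_leq _ _) _; rewrite size_polyXn.
rewrite evalKD -e /evalK linearZ /= hornerZ rmorphXn /= map_polyX hornerXn.
by rewrite subrK.
Qed.

End GenusZero.

(** The poles of [x] are bounded by a divisor of degree [q], so [f, 1, y, ..., y^(q-1)] are
    dependent over [K(x)]. The coefficient of [f] is nonzero: otherwise the [q] distinct conjugates
    of [y] would be roots of a nonzero polynomial of degree below [q]. *)
Lemma generation P x y : is_place iota P -> L0s [:: (P, 1)] x ->
  (forall k, x <> iota k) ->
  (forall i j, (i < q)%N -> (j < q)%N -> iter i s y = iter j s y -> i = j) ->
  generates2 iota x y.
Proof.
move=> pP hx nx hy f.
have [sx hxL] := (L0_inL iota s q [:: (P, 1)] x).1 hx.
pose z (i : 'I_q.+1) := fcons f (fun i : 'I_q => y ^+ i) i.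
have [|||p [[i0 hi0] hp]] := @poly_dependence _ _ _ ff g g0 hg (pull s q [:: (P, 1)])
  q x z _ _ _ hxL.
- by apply: is_divisor_pull => //; apply: is_divisor1.
- move=> r /flattenP [X /mapP [t]]; rewrite mem_seq1 => /eqP -> -> /mapP [i _ ->] //.
- by rewrite divdeg_pull divdeg_cons divdeg_nil /=; lia.
move: hp; rewrite big_ord_recl /z fcons0; under eq_bigr => i _ do rewrite fconsS.
move=> hp.
pose c i := if insub i is Some j then p (lift ord0 j) else 0.
have cE (j : 'I_q) : c j = p (lift ord0 j).
  by rewrite /c insubT //= => h; congr (p (lift ord0 _)); apply: val_inj.
have alg0 r : ev r x = 0 -> r = 0.
  by move=> h; apply: contrapT => /eqP r0; have [k /nx] := algebraic_const r0 h.
have sev r i : iter i s (ev r x) = ev r x.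
  rewrite iter_fix // (evalKE _ _ (leqnn _)) (big_morph s (autD hs) (aut0 hs)).
  by apply: eq_bigr => j _; rewrite (autM hs) (autK hs) (autX hs) sx.
have p0 : ev (p ord0) x != 0.
  apply/eqP => e0; move: hp; rewrite e0 mul0r add0r => hp.
  pose r := \poly_(i < q) ev (c i) x.
  have rroot i : root r (iter i s y).
    apply/rootP; rewrite horner_poly.
    have := congr1 (iter i s) hp.
    rewrite (big_morph (iter i s) (iter_autD hs i) (iter_fix i (aut0 hs))).
    rewrite (iter_fix i (aut0 hs)) => h; rewrite -[RHS]h; apply: eq_bigr => j _.
    rewrite cE (iter_autM hs) sev; congr (_ * _).
    by elim: (j : nat) => [|n IH]; rewrite ?expr0 ?(iter_fix i (aut1 hs)) //
      !exprS (iter_autM hs) IH.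
  have r0 : r = 0.
    apply: contrapT => /eqP r0.
    have := @max_poly_roots _ r [seq iter i s y | i <- index_iota 0 q] r0.
    rewrite size_map size_iota subn0.
    have -> : all (root r) [seq iter i s y | i <- index_iota 0 q].
      by apply/allP => t /mapP [i _ ->].
    rewrite map_inj_in_uniq ?iota_uniq => [/(_ isT isT)|i j].
      by rewrite ltnNge size_poly.
    by rewrite !mem_index_iota /= => hi hj; apply: hy.
  move: hi0; have -> : p i0 = 0; last by rewrite eqxx.
  case: (unliftP ord0 i0) => [j|] ->; last exact: alg0.
  apply: alg0; rewrite -cE; have := congr1 (fun t : {poly F} => t`_j) r0.
  by rewrite coef0 coef_poly ltn_ord.
exists (\poly_(i < q) (- c i)), (\poly_(i < 1) (p ord0)).
rewrite !eval2K_poly big_ord_recl big_ord0 addr0 expr0 mulr1; split=> //.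
apply: (mulIf p0); rewrite divfK // mulrC; apply/eqP; rewrite -subr_eq0 -[X in _ == X]hp.
apply/eqP; congr (_ + _); rewrite -sumrN; apply: eq_bigr => i _.
by rewrite cE -mulNr; congr (_ * _); rewrite /evalK rmorphN hornerN opprK.
Qed.
End CyclicAction.

(** * Counting *)

(** For [0 < i < q] the remainders at [i] and [q - i] are nonzero and add up to [q]. *)
Lemma sum_modz (q : nat) (a : int) (q_prime : prime q) : ~~ (q%:Z %| a)%Z ->
  2%:Z * (\sum_(i < q) ((i%:Z * a) %% q%:Z)%Z) = q%:Z * (q%:Z - 1).
Proof.
have q0 := prime_gt0 q_prime; move=> ha; pose r (i : nat) := ((i%:Z * a) %% q%:Z)%Z.
have pair i : (1 <= i < q)%N -> r i + r (1 + q - i.+1)%N = q%:Z.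
  move=> /andP [i1 iq].
  have nd (j : nat) : (1 <= j < q)%N -> r j != 0.
    move=> /andP [j1 jq]; apply/negP => /eqP h.
    have /dvdz_mod0P : (q%:Z %| j%:Z * a)%Z by apply/dvdz_mod0P.
    move=> _; have : (q%:Z %| j%:Z * a)%Z by apply/dvdz_mod0P.
    rewrite dvdzE abszM Euclid_dvdM // => /orP [|h2].
      by rewrite absz_nat gtnNdvd.
    by move: ha; rewrite dvdzE h2.
  have qz : q%:Z != 0 by lia.
  have b j : 0 <= r j < q%:Z by rewrite modz_ge0 // ltz_pmod.
  have e : (1 + q - i.+1 = q - i)%N by lia.
  rewrite e; have h1 : r i != 0 by apply: nd; rewrite i1.
  have h2 : r (q - i)%N != 0 by apply: nd; clear -i1 iq; lia.
  have : (q%:Z %| r i + r (q - i)%N)%Z.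
    apply/dvdz_mod0P; rewrite modzDm -mulrDl -subzn ?(ltnW iq) //.
    by rewrite addrCA subrr addr0 modzMr.
  move=> /dvdzP [k hk]; have := b i; have := b (q - i)%N.
  move=> /andP [c1 c2] /andP [c3 c4].
  have k1 : 0 < k by rewrite -(pmulr_lgt0 k (_ : 0 < q%:Z)) -?hk; lia.
  have k2 : k < 2 by rewrite -(ltr_pM2r (_ : 0 < q%:Z)) -?hk; lia.
  have k3 : (k : int) = 1 by move: k1 k2; clear; lia.
  by rewrite hk k3 mul1r.
have e : \sum_(i < q) r i = \sum_(1 <= i < q) r i.
  rewrite -(big_mkord xpredT r) (big_cat_nat (n := 1)) //=.
  by rewrite big_nat1 /r mul0r mod0z add0r.
have dbl (x : int) : 2%:Z * x = x + x by lia.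
rewrite -/(r) e dbl {2}big_nat_rev /= -big_split /=.
rewrite (eq_big_nat _ _ pair) sumr_const_nat -mulr_natl natz.
by rewrite -subzn // mulrC.
Qed.


(** As [x] and [p] are multiples of [q], rounding [a] down to a multiple of [q] does not affect the
    comparison. It is applied to [a = i w(y)], with [x] the value of an invariant function at a
    fixed place. *)
Lemma dvdz_floor_le (q : nat) (a x p : int) : (0 < q)%N ->
  (q%:Z %| x)%Z -> (q%:Z %| p)%Z ->
  (- (q%:Z * (a %/ q%:Z)%Z + p) <= x) = (- p <= a + x).
Proof.
move=> q0 /dvdzP [l ->] /dvdzP [k ->].
have ea := divz_eq a q%:Z.
have ra : 0 <= (a %% q%:Z)%Z < q%:Z by rewrite modz_ge0 ?ltz_pmod //; lia.
move: (a %/ q%:Z)%Z (a %% q%:Z)%Z ea ra => c r -> ra.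
have -> : (- (q%:Z * c + k * q%:Z) <= l * q%:Z) = (0 <= (c + k + l) * q%:Z).
  by apply/idP/idP; clear; lia.
have -> : (- (k * q%:Z) <= c * q%:Z + r + l * q%:Z) = (- r <= (c + k + l) * q%:Z).
  by apply/idP/idP; clear; lia.
move: (c + k + l) ra => n; clear -q0 => /andP [r1 r2].
by have [n0|n0] := lerP 0 n; apply/idP/idP; nia.
Qed.

(** * Riemann-Hurwitz from a decomposition of Riemann-Roch spaces *)

Section Counting.
Variables (K : closedFieldType) (F : fieldType) (iota : {rmorphism K -> F}).
Hypothesis ff : function_field iota.
Variable g : nat.
Hypothesis g0 : (0 < g)%N.
Hypothesis hg : genus iota g.
Variables (s : F -> F) (q : nat).
Hypothesis hs : K_automorphism iota s.
Hypothesis q_prime : prime q.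
Hypothesis hq : forall f, iter q s f = f.
Hypothesis s_nontriv : exists f, s f != f.
Implicit Types (D E : divisor F) (w P Q : F -> int) (u v y z : F).
Local Notation L := (inL iota).
Local Notation dimK := (dim iota).
Local Notation L0s := (L0 iota s q).
Local Notation psis := (psi iota s q).
Local Notation pcs := (pc s q).
Local Notation orbs := (orb s q).

Let q0 : (0 < q)%N := prime_gt0 q_prime.
Let dich := orb_dichotomy (iota := iota) q_prime hq.
Let ram := fixed_ramified ff hs q_prime hq s_nontriv.

Lemma invariant_of_value P (n : int) : is_place iota P -> fixed s P ->
  (q%:Z %| n)%Z -> exists u, [/\ s u = u, u != 0 & P u = n].
Proof.
move=> pP fP /dvdzP [k ->].
have [t ht] : exists t, P t = 1 by case: pP.
have t0 : t != 0.
  by apply/eqP => e; move: ht; rewrite e; case: pP => ->.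
have c0 := cnorm_neq0 q hs t0; have cs := cnorm_inv hs q_prime hq t.
have cP : P (cnorm s q t) = q%:Z by rewrite (cnorm_place q hs pP fP t0) ht mulr1.
case: k => k; last first.
  exists (cnorm s q t ^- k.+1); rewrite (autV hs) (autX hs) cs invr_eq0.
  by rewrite expf_neq0 // (placeV pP) ?expf_neq0 // (placeX pP) // cP NegzE mulNr.
exists (cnorm s q t ^+ k).
by rewrite (autX hs) cs expf_neq0 // (placeX pP) // cP.
Qed.

Lemma fixed_list u : u != 0 -> (forall P, is_place iota P -> fixed s P -> P u != 0) ->
  exists S : seq (F -> int),
    uniq S /\ forall w, (w \in S) <-> is_place iota w /\ fixed s w.
Proof.
move=> u0 h; have [E [_ _ eE]] := principal_divisor ff g0 hg u0.
have [S [uS hS]] := place_list iota [seq w <- [seq p.1 | p <- E] | `[< fixed s w >]].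
exists S; split=> // w; rewrite hS mem_filter.
split=> [[pw /andP [/asboolP]]|[pw fw]] //; split=> //; rewrite asboolT //=.
have := h w pw fw; rewrite -eE // => /divcoef_supp [p hp <-].
exact: map_f.
Qed.

Lemma orb_fixedE P w : is_place iota P -> is_place iota w -> fixed s P ->
  orbs P w = if P == w then q else 0%N.
Proof.
move=> pP pw fP; case: eqP => [<-|h]; first exact: orb_fixed.
apply/eqP/negPn/negP => /orb_neq0 [i e]; apply: h.
by rewrite e rot_fixed.
Qed.

Lemma pc_abs E w : 0 <= pcs (E ++ dmap (fun k => `|k|) E) w.
Proof.
rewrite pc_cat; elim: E => [|p E IH]; first by rewrite !pc_nil.
by rewrite /= !pc_cons /=; nia.
Qed.

(** The common shift [A] allows [psi_mono] to be applied to all the [E i ++ A] at once. *)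
Lemma effective_shift n (E : nat -> divisor F) : (forall i, is_divisor iota (E i)) ->
  exists A, [/\ is_divisor iota A, forall w, 0 <= pcs A w &
    forall i w, (i < n)%N -> 0 <= pcs (E i ++ A) w].
Proof.
move=> hE; elim: n => [|n [A [hA eA IH]]].
  by exists [::]; split=> // w; rewrite pc_nil.
exists (dmap (fun k => `|k|) (E n) ++ A); split.
- by apply: is_divisor_cat => //; apply: is_divisor_dmap.
- move=> w; rewrite pc_cat addr_ge0 //.
  by apply: pc_ge0 => p /mapP [r _ ->]; apply: normr_ge0.
move=> i w; rewrite ltnS leq_eqVlt => /orP [/eqP ->|hi].
  by rewrite catA pc_cat addr_ge0 // pc_abs.
have := IH i w hi; rewrite !pc_cat => h.
rewrite addrCA addr_ge0 //.
by apply: pc_ge0 => p /mapP [r _ ->]; apply: normr_ge0.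
Qed.

Section Decomposition.
Variable E : nat -> divisor F.
Hypothesis hE : forall i, is_divisor iota (E i).
Hypothesis decomp : forall D, is_divisor iota D ->
  dimK (L (pull s q D)) = (\sum_(i < q) dimK (L0s (E i ++ D)))%N.

(** Each of the [q] numbers [psi (E i ++ A ++ D)] is at least [psi D], and Riemann's inequality on
    [F] bounds their sum: the quotient has finite genus. *)
Lemma psi_bounded : exists B : int, forall D, is_divisor iota D -> psis D <= B.
Proof.
have [A [hA _ eA]] := effective_shift q hE.
pose T := \sum_(i < q) divdeg (E i).
exists (`|T| + g%:Z) => D hD.
have hAD : is_divisor iota (A ++ D) by apply: is_divisor_cat.
have h1 (i : 'I_q) : psis D <= psis (E i ++ (A ++ D)).
  apply: (psi_mono ff hs q0 hq dich ram) => //; first exact: is_divisor_cat.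
    exact: (fdim_L0s ff hg hs q_prime hq).
  by move=> w _; rewrite catA pc_cat lerDr eA.
have h2 : \sum_(i < q) psis D <= \sum_(i < q) psis (E i ++ (A ++ D)).
  by apply: ler_sum => i _.
have e2 : \sum_(i < q) psis (E i ++ (A ++ D)) =
    T + q%:Z * divdeg (A ++ D) - (dimK (L (pull s q (A ++ D))))%:Z.
  rewrite (decomp hAD) (big_morph Posz PoszD (erefl _)).
  have -> : q%:Z * divdeg (A ++ D) = \sum_(i < q) divdeg (A ++ D).
    by rewrite sumr_const card_ord -mulr_natl natz.
  rewrite /T -big_split /= -sumrB.
  by apply: eq_bigr => i _ /=; rewrite /psi divdeg_cat.
have h3 := riemann ff hg (is_divisor_pull hs q0 hq hAD).
move: h2; rewrite e2 sumr_const card_ord -mulr_natl natz.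
by rewrite divdeg_pull in h3; have : (1 <= q)%N by []; nia.
Qed.

(** In large degree both sides of [decomp] are known exactly: [q deg D + 1 - g] on the left, and
    [deg (E i) + deg D - m] for each term on the right. *)
Lemma degree_count (m N : int) :
  (forall D, is_divisor iota D -> N <= divdeg D -> psis D = m) ->
  \sum_(i < q) divdeg (E i) = q%:Z * m + 1 - g%:Z.
Proof.
move=> hN; have [P pP] := exists_place ff g0 hg.
have [N' hN'] := riemann_large ff g0 hg.
(* Large enough for [pull D] and for every [E i ++ D], whatever the sign of [deg (E i)]. *)
pose k : int := `|N| + `|N'| + \sum_(i < q) `|divdeg (E i)|.
pose D : divisor F := [:: (P, k)].
have hD : is_divisor iota D by apply: is_divisor_cons.
have dD : divdeg D = k by rewrite divdeg_cons divdeg_nil addr0.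
have big (i : 'I_q) : `|divdeg (E i)| <= \sum_(i < q) `|divdeg (E i)|.
  by rewrite [leRHS](bigD1 i) //= lerDl; apply: sumr_ge0.
have S0 : 0 <= \sum_(i < q) `|divdeg (E i)| by apply: sumr_ge0.
have h1 (i : 'I_q) : (dimK (L0s (E i ++ D)))%:Z = divdeg (E i) + (k - m).
  have := hN (E i ++ D) (is_divisor_cat (@hE i) hD); rewrite /psi divdeg_cat dD.
  have := big i; move: S0; rewrite /k; set T := \sum_(_ < _) _ => h1 h2 h3.
  have h4 : N <= divdeg (E i) + (`|N| + `|N'| + T).
    by move: (divdeg (E i)) h2 => a h2; clear -h1 h2; lia.
  by have := h3 h4; lia.
have := hN' _ (is_divisor_pull hs q0 hq hD); rewrite divdeg_pull dD decomp //.
rewrite (big_morph Posz PoszD (erefl _)) (eq_bigr _ (fun i _ => h1 i)).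
rewrite big_split /= sumr_const card_ord -mulr_natl natz.
have : N' <= q%:Z * k.
  move: S0; rewrite /k; set T := \sum_(_ < _) _ => h.
  by have : (1 <= q)%N by []; nia.
move=> h /(_ h) e.
by rewrite -[LHS](addrK (q%:Z * (k - m))) e; ring.
Qed.

End Decomposition.

End Counting.

(** * Tame automorphisms *)

Section Tame.
Variables (K : closedFieldType) (F : fieldType) (iota : {rmorphism K -> F}).
Hypothesis ff : function_field iota.
Variable g : nat.
Hypothesis g2 : (2 < g)%N.
Hypothesis hg : genus iota g.
Variable s : F -> F.
Hypothesis hs : K_automorphism iota s.
Local Notation q := g.+1.
Hypothesis q_prime : prime q.
Hypothesis hq : forall f, iter q s f = f.
Hypothesis s_nontriv : exists f, s f != f.
Implicit Types (D E : divisor F) (w P Q : F -> int) (u v y : F).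
Local Notation L := (inL iota).
Local Notation dimK := (dim iota).
Local Notation L0s := (L0 iota s q).
Local Notation psis := (psi iota s q).
Local Notation pcs := (pc s q).

Let g0 : (0 < g)%N. Proof. exact: leq_trans g2. Qed.
Let q0 : (0 < q)%N := prime_gt0 q_prime.
Let dich := orb_dichotomy (iota := iota) q_prime hq.
Let ram := fixed_ramified ff hs q_prime hq s_nontriv.

Variable z : K.
Hypothesis hz : q.-primitive_root z.

Lemma prim_lam : \prod_(j < q) ('X - (z ^+ j)%:P) = 'X^q - 1.
Proof. by rewrite -(factor_Xn_sub_1 hz) big_mkord. Qed.

Lemma prim_neq0 : z != 0.
Proof.
apply/eqP => e; have := prim_expr_order hz; rewrite e expr0n /= => /eqP.
by rewrite eq_sym oner_eq0.
Qed.

Lemma prim_neq1 : z != 1.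
Proof.
apply/eqP => e; have := eq_prim_root_expr hz 0 1.
by rewrite e !expr1n eqxx => /esym; rewrite !modn_small //; case: (g) g2.
Qed.

Lemma eigen_place y w : s y = iota z * y -> is_place iota w -> w (s y) = w y.
Proof. by move=> -> pw; rewrite (placeZ pw) ?prim_neq0. Qed.

Lemma eigenX y i : s y = iota z * y -> s (y ^+ i) = iota (z ^+ i) * y ^+ i.
Proof. by move=> e; rewrite (autX hs) e exprMn rmorphXn. Qed.

(** If [q] divided [P y], dividing by an invariant function of the same value would give a unit [t]
    with [s t = z t]. As [s] acts trivially on residues at [P], the residue [c] of [t] would satisfy
    [c = z c] with [c] nonzero. *)
Lemma tame_fixed y P : y != 0 -> s y = iota z * y -> is_place iota P ->
  fixed s P -> ~~ (q%:Z %| P y)%Z.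
Proof.
move=> y0 sy pP fP; apply/negP => hd.
have [u [su u0 Pu]] := invariant_of_value hs q_prime hq pP fP hd.
pose t := y / u; have st : s t = iota z * t by rewrite (autM hs) (autV hs) sy su mulrA.
have t0 : t != 0 by rewrite mulf_neq0 ?invr_eq0.
have Pt : P t = 0 by rewrite (place_div pP) // Pu subrr.
have h0 : vge P 0 t by right; rewrite Pt.
have [c hc] := residue ff pP h0.
have c0 : c != 0.
  apply/eqP => e; move: hc; rewrite e rmorph0 subr0 => /vge_ge /(_ t0).
  by rewrite Pt.
have h1 : vge P 1 (s (t - iota c)).
  case: hc => [->|h]; first by rewrite (aut0 hs); left.
  by right; rewrite (iter_place 1 _ fP).
have := vgeB pP (vgeZ pP z hc) h1.
have -> : iota z * (t - iota c) - s (t - iota c) = iota (c * (1 - z)) * 1.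
  by rewrite (autB hs) st (autK hs) rmorphM rmorphB rmorph1; ring.
have k0 : c * (1 - z) != 0 by rewrite mulf_neq0 // subr_eq0 eq_sym prim_neq1.
move=> /vge_ge; rewrite mulr1 fmorph_eq0 => /(_ k0).
by rewrite (placeK pP).
Qed.

(** On the eigenspace of [z^i] the operator [eigT i] is the scalar [prod_(k < i) (z^i - z^k)], so no
    eigenvector is lost when passing to the graded piece. *)
Lemma eigT_eigenvector i a : (i < q)%N -> s a = iota (z ^+ i) * a ->
  exists2 k, k != 0 & eigT iota s (fun i => z ^+ i) i a = iota k * a.
Proof.
move=> iq sa; exists (\prod_(k < i) (z ^+ i - z ^+ k)).
  apply/prodf_neq0 => k _; rewrite subr_eq0 (eq_prim_root_expr hz).
  by rewrite !modn_small ?(ltn_trans (ltn_ord k)) // gtn_eqF.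
suff h j : eigT iota s (fun i => z ^+ i) j a =
    iota (\prod_(k < j) (z ^+ i - z ^+ k)) * a by [].
elim: j => [|j IH] /=; first by rewrite big_ord0 rmorph1 mul1r.
rewrite IH (autM hs) (autK hs) sa big_ord_recr /= [iota (_ * (_ - _))]rmorphM rmorphB.
by ring.
Qed.

Variable y : F.
Hypothesis y0 : y != 0.
Hypothesis sy : s y = iota z * y.

Definition tcoef (i : nat) w : int :=
  if `[< fixed s w >] then q%:Z * ((i%:Z * w y) %/ q%:Z)%Z else i%:Z * w y.

Lemma tcoef_divisor i : exists E, is_divisor iota E /\
  forall w, is_place iota w -> pcs E w = tcoef i w.
Proof.
have [X [hX _ eX]] := principal_divisor ff g0 hg y0.
have [|||E [hE eE _]] := pull_repr hs q0 hq dich (S := [seq p.1 | p <- X])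
   (f := tcoef i).
- move=> w pw; have ew : (w \o s) y = w y by apply: (eigen_place sy).
  rewrite /tcoef ew; congr (if _ then _ else _); apply: asbool_equiv_eq.
  by split=> [/(comp_aut_inj q0 hq)|fw]; rewrite /fixed // -[in RHS]fw.
- move=> w pw h; have : divcoef X w != 0.
    rewrite eX //; apply: contraNneq h; rewrite /tcoef => ->.
    by rewrite mulr0 div0z mulr0; case: ifP.
  by move=> /divcoef_supp [p hp <-]; apply: map_f.
- by move=> w pw fw; rewrite /tcoef asboolT // dvdz_mulr.
by exists E.
Qed.

Lemma tame_decomposition i E D : (i < q)%N -> is_divisor iota D ->
  is_divisor iota E -> (forall w, is_place iota w -> pcs E w = tcoef i w) ->
  dimK (grade iota s (fun i => z ^+ i) (L (pull s q D)) i) = dimK (L0s (E ++ D)).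
Proof.
move=> iq hD hE eE; have yi0 : y ^+ i != 0 by rewrite expf_neq0.
have zi0 : z ^+ i != 0 by rewrite expf_neq0 ?prim_neq0.
have syi := eigenX i sy.
have fd := fdim_L0s ff hg hs q_prime hq (is_divisor_cat hE hD).
have key w b : is_place iota w -> s b = b -> b != 0 ->
    (- pcs (E ++ D) w <= w b) = (- pcs D w <= w (y ^+ i * b)).
  move=> pw sb b0; rewrite (placeM pw) // (placeX pw) // pc_cat eE // /tcoef.
  case: asboolP => fw; last by apply/idP/idP; lia.
  by apply: dvdz_floor_le => //; [exact: (ram pw fw sb b0)|exact: pc_dvd].
apply: dimE; apply: (hasdim_iso (Phi := fun b => y ^+ i * b) _ _ _ _ (dimP fd)).
- by move=> k u v; ring.
- by move=> u /eqP; rewrite mulf_eq0 (negPf yi0) => /eqP.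
- move=> b [sb hb].
  have sa : s (y ^+ i * b) = iota (z ^+ i) * (y ^+ i * b).
    by rewrite (autM hs) syi sb mulrA.
  have hV : L (pull s q D) (y ^+ i * b).
    have [->|b0] := eqVneq b 0; first by rewrite mulr0; left.
    right=> w pw; rewrite divcoef_pull -key //.
    by case: hb => [/eqP|->//]; rewrite (negPf b0).
  have [k k0 ek] := eigT_eigenvector iq sa.
  exists (iota k^-1 * (y ^+ i * b)); last first.
    rewrite (klinearZ _ _ (eigT_klinear hs _ _)) ek mulrA -rmorphM mulVf //.
    by rewrite rmorph1 mul1r.
  split; first exact: (subspZ _ (subsp_L iota _) hV).
  rewrite (klinearZ _ _ (eigT_klinear hs _ _)) /= ek (autM hs) (autK hs) sa.
  by ring.
move=> a ha; have sa := grade_eigen ha.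
have [hV _] : L (pull s q D) a /\ True.
  split=> //; apply: (grade_sub (subsp_L iota _) _ ha) => u.
  exact: (L_pull_s hs q_prime hq).
exists (a / y ^+ i); last by rewrite mulrC divfK.
have [->|a0] := eqVneq a 0; first by rewrite mul0r; apply: (subsp_L0 q hs _).1.
have sb : s (a / y ^+ i) = a / y ^+ i.
  by rewrite (autM hs) (autV hs) sa syi; field; rewrite !fmorph_eq0 yi0 zi0.
split=> //; right=> w pw; rewrite key // ?mulf_neq0 ?invr_eq0 //.
rewrite mulrC divfK // -(divcoef_pull s q).
by case: hV => [/eqP|->//]; rewrite (negPf a0).
Qed.

Lemma tame_count : (forall D, is_divisor iota D -> psis D <= -1) /\
  exists S : seq (F -> int), [/\ uniq S, size S = 4%N &
    forall w, (w \in S) <-> is_place iota w /\ fixed s w].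
Proof.
pose E i := sval (cid (tcoef_divisor i)).
have hE i : is_divisor iota (E i) by rewrite /E; case: cid => ? [].
have eE i w : is_place iota w -> pcs (E i) w = tcoef i w.
  by rewrite /E; case: cid => X [hX eX]; apply: eX.
have decomp D : is_divisor iota D ->
    dimK (L (pull s q D)) = (\sum_(i < q) dimK (L0s (E i ++ D)))%N.
  move=> hD; have := dim_filtration hs q_prime hq prim_lam (subsp_L iota (pull s q D))
    (fdim_L_pull ff hg hs q_prime hq hD) (fun u => @L_pull_s _ _ _ _ _ hs q_prime hq D u).
  move=> ->; apply: eq_bigr => i _.
  by apply: tame_decomposition => // w; apply: eE.
have [B hB] := psi_bounded ff g0 hg hs q_prime hq s_nontriv hE decomp.
have [m [N [m1 hm hN]]] := psi_stable ff g0 hg hs q_prime hq s_nontriv hB.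
have cnt := degree_count ff g0 hg hs q_prime hq hE decomp hN.
have [|S [uS hS]] := fixed_list ff g0 hg (s := s) y0.
  move=> P pP fP; apply: contraTneq (tame_fixed y0 sy pP fP) => ->.
  by rewrite dvdz0.
have [X [hX dX eX]] := principal_divisor ff g0 hg y0.
(* [i div y] has degree zero, and [pull (E i)] differs from it only by the remainders modulo [q] at
   the fixed places. *)
have dE i : q%:Z * divdeg (E i) = - \sum_(P <- S) ((i%:Z * P y) %% q%:Z)%Z.
  have hT : is_divisor iota (div_of S (fun P => ((i%:Z * P y) %% q%:Z)%Z)).
    by apply: is_divisor_div_of => w /hS [].
  have : divdeg (pull s q (E i) ++ div_of S (fun P => ((i%:Z * P y) %% q%:Z)%Z)) =
      divdeg (dmap ( *%R i%:Z) X).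
    apply: (divdeg_eq (iota := iota)).
    - by apply: is_divisor_cat hT; apply: is_divisor_pull.
    - exact: is_divisor_dmap.
    move=> w pw; rewrite divcoef_cat divcoef_pull eE // divcoef_scale eX //.
    rewrite divcoef_div_of // /tcoef; case: asboolP => fw.
      by rewrite (hS w).2 //= mulrC -divz_eq.
    by case: ifP => [/hS [_ /fw]|_] //; rewrite addr0.
  rewrite divdeg_cat divdeg_pull divdeg_div_of divdeg_scale dX mulr0.
  by move/eqP; rewrite addr_eq0 => /eqP.
have main : (size S)%:Z * (q%:Z - 1) = - (2%:Z * (q%:Z * m + 1 - g%:Z)).
  apply: (mulfI (_ : q%:Z != 0)); first by lia.
  rewrite -cnt mulrN !mulr_sumr.
  rewrite [RHS](_ : _ = \sum_(i < q) \sum_(P <- S) (2%:Z * ((i%:Z * P y) %% q%:Z)%Z)).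
    rewrite exchange_big /=.
    transitivity (\sum_(P <- S) (q%:Z * (q%:Z - 1))).
      rewrite big_const_seq count_predT.
      elim: (size S) => [|n IH] /=; first by rewrite mul0r mulr0.
      by rewrite -IH; lia.
    rewrite big_seq [RHS]big_seq; apply: eq_bigr => P /hS [pP fP].
    by rewrite -mulr_sumr (sum_modz q_prime (tame_fixed y0 sy pP fP)).
  rewrite -sumrN; apply: eq_bigr => i _; rewrite -mulr_sumr.
  by rewrite mulrCA dE mulrN opprK.
have m_eq : m = -1 /\ size S = 4%N.
  move: (size S) main => n; clear -m1 g2 => main.
  have [e|m0] : m = -1 \/ 0 <= m by lia.
    split=> //; have h : n%:Z * g%:Z = 4%:Z * g%:Z by move: main; rewrite e; lia.
    have g1 : g%:Z != 0 by lia.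
    by have := mulIf g1 h; lia.
  (* Here [m >= 0]. For [m >= 1] the right side is negative. For [m = 0] it reads [n g = 2 (g - 1)]:
     then [n = 0] and [n = 1] force [g = 1] and [g = 2], and [n >= 2] makes the left side too
     large. *)
  exfalso; have {}main : n%:Z * g%:Z = 2%:Z * (g%:Z - 1) - 2%:Z * m - 2%:Z * (g%:Z * m).
    by lia.
  have [e|m2] : m = 0 \/ 1 <= m by lia.
    move: main; rewrite e; have [h|[h|h]] : (n = 0 \/ n = 1 \/ 2 <= n)%N by lia.
    - by rewrite h; lia.
    - by rewrite h; lia.
    have h2 : 2%:Z * g%:Z <= n%:Z * g%:Z by rewrite ler_wpM2r.
    by lia.
  have h1 : g%:Z * 1 <= g%:Z * m by rewrite ler_wpM2l.
  have h2 : 0 <= n%:Z * g%:Z by rewrite mulr_ge0.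
  by lia.
split; last by exists S; split=> //; case: m_eq.
by move=> D hD; rewrite -m_eq.1; apply: hm.
Qed.

End Tame.

(** * Coordinates with prescribed zeros and poles *)

Section Coordinate.
Variables (K : closedFieldType) (F : fieldType) (iota : {rmorphism K -> F}).
Hypothesis ff : function_field iota.
Variable g : nat.
Hypothesis g0 : (0 < g)%N.
Hypothesis hg : genus iota g.
Variables (s : F -> F) (q : nat).
Hypothesis hs : K_automorphism iota s.
Hypothesis q_prime : prime q.
Hypothesis hq : forall f, iter q s f = f.
Hypothesis s_nontriv : exists f, s f != f.
Implicit Types (D E : divisor F) (w P Q : F -> int) (u v x y : F).
Local Notation L0s := (L0 iota s q).

Let q0 : (0 < q)%N := prime_gt0 q_prime.

Lemma closed_root n (c : K) : (0 < n)%N -> exists d, d ^+ n = c.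
Proof.
move=> n0; have [|d /rootP] := closed_rootP ('X^n - c%:P) _.
  by rewrite size_XnsubC // gtn_eqF.
rewrite !hornerE => /eqP; rewrite subr_eq0 => /eqP <-.
by exists d; rewrite ?hornerXn.
Qed.

Lemma L0_const P c : is_place iota P -> L0s [:: (P, 1)] (iota c).
Proof.
move=> pP; apply: (@L0_ext _ _ iota s q hs [::]).
  by move=> w _; rewrite pc_cons pc_nil mul1r addr0.
by apply/(L0_nilP ff hg q hs); exists c.
Qed.

(** According to the sign at [P], either [u] or [u^-1] is regular everywhere. Functions with equal
    orders off [P] are therefore proportional, without a computation at [P]. *)
Lemma const_off_place P u : is_place iota P -> u != 0 ->
  (forall w, is_place iota w -> w != P -> w u = 0) -> exists2 c, c != 0 & u = iota c.
Proof.
move=> pP u0 h.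
have [c ec] : exists c, u = iota c.
  have [hP|hP] := lerP 0 (P u).
    apply: (const_of_regular ff hg) => w pw; right.
    by have [->//|/(h w pw) ->] := eqVneq w P.
  have [|c hc] := @const_of_regular _ _ _ ff _ hg u^-1.
    move=> w pw; right; rewrite (placeV pw) //.
    have [->|/(h w pw) ->] := eqVneq w P; last by rewrite oppr0.
    by rewrite oppr_ge0 ltW.
  by exists c^-1; rewrite fmorphV -hc invrK.
exists c => //; apply/eqP => e; move: u0; rewrite ec e rmorph0 eqxx; by [].
Qed.

Lemma not_const_of_pole P u : is_place iota P -> P u < 0 -> forall k, u <> iota k.
Proof.
move=> pP hP k e; move: hP; rewrite e.
have [->|k0] := eqVneq k 0; first by rewrite rmorph0; case: pP => ->.
by rewrite (placeK pP).
Qed.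

Lemma vge_at_fixed P Q x : is_place iota P -> is_place iota Q -> fixed s P ->
  Q != P -> L0s [:: (P, 1)] x -> vge Q 0 x.
Proof.
move=> pP pQ fP QP /L0P [_ hx]; have := hx Q pQ.
rewrite pc_cons pc_nil mul1r addr0 (orb_fixedE q pP pQ fP) eq_sym (negPf QP).
by rewrite oppr0.
Qed.

Lemma shifted_coordinate P Q x c : is_place iota P -> is_place iota Q -> fixed s P ->
  fixed s Q -> L0s [:: (P, 1)] x -> P x < 0 -> vge Q 1 (x - iota c) ->
  forall w, is_place iota w ->
    w (x - iota c) = (if Q == w then q else 0%N)%:Z - (if P == w then q else 0%N)%:Z.
Proof.
move=> pP pQ fP fQ hx Px hc w pw.
rewrite -(orb_fixedE q pQ pw fQ) -(orb_fixedE q pP pw fP).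
apply: (zero_orbit ff g0 hg hs q_prime hq s_nontriv) => //.
  by apply: subspB hx (L0_const c pP); apply: subsp_L0.
apply: vge_ge hc _; rewrite subr_eq0; apply/eqP.
exact: (not_const_of_pole pP Px).
Qed.

End Coordinate.

(** * The plane model in the tame case *)

Section TameModel.
Variables (K : closedFieldType) (F : fieldType) (iota : {rmorphism K -> F}).
Hypothesis ff : function_field iota.
Variable g : nat.
Hypothesis g2 : (2 < g)%N.
Hypothesis hg : genus iota g.
Variable s : F -> F.
Hypothesis hs : K_automorphism iota s.
Local Notation q := g.+1.
Hypothesis q_prime : prime q.
Hypothesis hq : forall f, iter q s f = f.
Hypothesis s_nontriv : exists f, s f != f.
Variable z : K.
Hypothesis hz : q.-primitive_root z.
Variable y : F.
Hypothesis y0 : y != 0.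
Hypothesis sy : s y = iota z * y.
Local Notation L0s := (L0 iota s q).

Let g0 : (0 < g)%N. Proof. exact: leq_trans g2. Qed.
Let q0 : (0 < q)%N := prime_gt0 q_prime.

Lemma tame_model : exists (a : K) (r t v : nat),
  [/\ a != 0 /\ a != 1, (0 < r <= g)%N /\ (0 < t <= g)%N /\ (0 < v <= g)%N,
      ((r + t + v) %% q != 0)%N &
      exists x y : F, generates2 iota x y /\
        y ^+ q = x ^+ r * (x - 1) ^+ t * (x - iota a) ^+ v].
Proof.
have [psi_le [S [uS sS hS]]] := tame_count ff g2 hg hs q_prime hq s_nontriv hz y0 sy.
case: S uS sS hS => [|P1 [|P2 [|P3 [|P4 []]]]] // uS _ hS.
have [p1 f1] : is_place iota P1 /\ fixed s P1 by apply/hS; rewrite !inE eqxx.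
have [p2 f2] : is_place iota P2 /\ fixed s P2 by apply/hS; rewrite !inE eqxx ?orbT.
have [p3 f3] : is_place iota P3 /\ fixed s P3 by apply/hS; rewrite !inE eqxx ?orbT.
have [p4 f4] : is_place iota P4 /\ fixed s P4 by apply/hS; rewrite !inE eqxx ?orbT.
have {}hS w : is_place iota w -> fixed s w -> [|| w == P1, w == P2, w == P3 | w == P4].
  by move=> pw fw; have := (hS w).2 (conj pw fw); rewrite !inE.
have n12 : P1 != P2 by apply: contraTneq uS => ->; rewrite /= !inE eqxx ?orbT ?andbF.
have n13 : P1 != P3 by apply: contraTneq uS => ->; rewrite /= !inE eqxx ?orbT ?andbF.
have n14 : P1 != P4 by apply: contraTneq uS => ->; rewrite /= !inE eqxx ?orbT ?andbF.
have n23 : P2 != P3 by apply: contraTneq uS => ->; rewrite /= !inE eqxx ?orbT ?andbF.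
have n24 : P2 != P4 by apply: contraTneq uS => ->; rewrite /= !inE eqxx ?orbT ?andbF.
have n34 : P3 != P4 by apply: contraTneq uS => ->; rewrite /= !inE eqxx ?orbT ?andbF.
(* The place [P4] goes to infinity; [P1] and [P2] are then normalized to 0 and 1, and [a] is the
   value of [x] at [P3]. *)
have [x0 [hx0 x00 Px0]] := simple_pole ff g0 hg hs q_prime hq s_nontriv psi_le p4.
have {}Px0 : P4 x0 < 0.
  by rewrite Px0 (orb_fixedE q p4 p4 f4) eqxx oppr_lt0.
have [c1 hc1] := residue ff p1 (vge_at_fixed p4 p1 f4 n14 hx0).
have val1 := shifted_coordinate ff g0 hg hs q_prime hq s_nontriv p4 p1 f4 f1 hx0 Px0 hc1.
set x1 := x0 - iota c1 in hc1 val1.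
have hx1 : L0s [:: (P4, 1)] x1.
  by apply: subspB hx0 (L0_const ff hg q hs c1 p4); apply: subsp_L0.
have Px1 : P4 x1 < 0 by rewrite val1 // eqxx (negPf n14) sub0r oppr_lt0.
have [c2 hc2] := residue ff p2 (vge_at_fixed p4 p2 f4 n24 hx1).
have c20 : c2 != 0.
  apply/eqP => e; move: hc2; rewrite e rmorph0 subr0 => /vge_ge.
  have x10 : x1 != 0.
    by apply/eqP => e1; move: Px1; rewrite e1; case: p4 => ->.
  by move=> /(_ x10); rewrite val1 // (negPf n12) eq_sym (negPf n24).
pose x := iota c2^-1 * x1.
have hx : L0s [:: (P4, 1)] x by apply: subspZ hx1; apply: subsp_L0.
have Px : P4 x < 0 by rewrite (placeZ p4) // invr_eq0.
have h1 : vge P1 1 (x - iota 0).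
  by rewrite rmorph0 subr0; apply: vgeZ.
have h2 : vge P2 1 (x - iota 1).
  have -> : x - iota 1 = iota c2^-1 * (x1 - iota c2).
    by rewrite mulrBr -rmorphM mulVf.
  exact: vgeZ.
have [a h3] := residue ff p3 (vge_at_fixed p4 p3 f4 n34 hx).
have v1 := shifted_coordinate ff g0 hg hs q_prime hq s_nontriv p4 p1 f4 f1 hx Px h1.
have v2 := shifted_coordinate ff g0 hg hs q_prime hq s_nontriv p4 p2 f4 f2 hx Px h2.
have v3 := shifted_coordinate ff g0 hg hs q_prime hq s_nontriv p4 p3 f4 f3 hx Px h3.
have nx := not_const_of_pole p4 Px.
have xc c : x - iota c != 0 by rewrite subr_eq0; apply/eqP/nx.
have a0 : a != 0.
  apply/eqP => e; have := vge_ge h3 (xc a); rewrite e v1 //.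
  by rewrite (negPf n13) eq_sym (negPf n34).
have a1 : a != 1.
  apply/eqP => e; have := vge_ge h3 (xc a); rewrite e v2 //.
  by rewrite (negPf n23) eq_sym (negPf n34).
rewrite !(rmorph0, subr0, rmorph1) in v1 v2.
(* An invariant factor removes multiples of [q] from the orders of [y]; the term at [P4] makes the
   degree zero. Off [P4], the order of [y1] is the remainder of that of [y] at fixed places, and 0
   elsewhere. *)
have [E [hE eE]] := tcoef_divisor ff g2 hg hs q_prime hq hz y0 sy 1.
have [|| u [su u0 vu]] := degree_zero_principal ff g0 hg hs q_prime hq psi_le
   (D := (P4, - divdeg E) :: E).
- exact: is_divisor_cons.
- by rewrite divdeg_cons /= addNr.
pose y1 := y * u.
have y10 : y1 != 0 by rewrite mulf_neq0.
have sy1 : s y1 = iota z * y1 by rewrite (autM hs) sy su mulrA.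
have vy1 w : is_place iota w -> w != P4 ->
    w y1 = if `[< fixed s w >] then (w y %% q%:Z)%Z else 0.
  move=> pw wP; rewrite (placeM pw) // vu // pc_cons eE // (orb_fixedE q p4 pw f4).
  rewrite eq_sym (negPf wP) mulr0 add0r /tcoef mul1r.
  by case: asboolP => _; rewrite ?subrr // /modz mulrC.
have rng w : is_place iota w -> fixed s w ->
    (0 < `|(w y %% q%:Z)%Z|%N <= g)%N /\ `|(w y %% q%:Z)%Z|%N%:Z = (w y %% q%:Z)%Z.
  move=> pw fw; have := tame_fixed ff g2 hs q_prime hq hz y0 sy pw fw.
  have : 0 <= (w y %% q%:Z)%Z < q%:Z by rewrite modz_ge0 // ltz_pmod.
  have -> : (q%:Z %| w y)%Z = ((w y %% q%:Z)%Z == 0).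
    by apply/dvdz_mod0P/eqP.
  by move: (w y %% q%:Z)%Z => n; clear; lia.
pose r := `|(P1 y %% q%:Z)%Z|%N; pose t := `|(P2 y %% q%:Z)%Z|%N.
pose v := `|(P3 y %% q%:Z)%Z|%N.
have [rr er] : (0 < r <= g)%N /\ r%:Z = (P1 y %% q%:Z)%Z := rng _ p1 f1.
have [rt et] : (0 < t <= g)%N /\ t%:Z = (P2 y %% q%:Z)%Z := rng _ p2 f2.
have [rv ev] : (0 < v <= g)%N /\ v%:Z = (P3 y %% q%:Z)%Z := rng _ p3 f3.
clearbody r t v.
have x00' : x != 0 by have := xc 0; rewrite rmorph0 subr0.
have x1' : x - 1 != 0 by have := xc 1; rewrite rmorph1.
pose M := x ^+ r * (x - 1) ^+ t * (x - iota a) ^+ v.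
have M0 : M != 0 by rewrite !mulf_neq0 ?expf_neq0.
have vM w : is_place iota w ->
    w M = r%:Z * w x + t%:Z * w (x - 1) + v%:Z * w (x - iota a).
  move=> pw; have xr := expf_neq0 r x00'; have xt := expf_neq0 t x1'.
  have xv := expf_neq0 v (xc a).
  by rewrite /M (placeM pw) ?mulf_neq0 // (placeM pw) // !(placeX pw).
(* [y1^q] and [M] have the same orders off [P4]; the constant between them is absorbed into [y2] by
   a [q]-th root. *)
have [||c c0 ec] := @const_off_place _ _ _ ff _ hg P4 (y1 ^+ q / M) p4.
- by rewrite mulf_neq0 ?invr_eq0 ?expf_neq0.
- move=> w pw wP; rewrite (place_div pw) ?expf_neq0 // (placeX pw) // vM //.
  rewrite v1 // v2 // v3 // vy1 // [P4 == w]eq_sym (negPf wP).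
  case: asboolP => fw.
    have /or4P [/eqP ->|/eqP ->|/eqP ->|/eqP e] := hS w pw fw.
    + by rewrite eqxx ![_ == P1]eq_sym (negPf n12) (negPf n13) -er; clear; lia.
    + by rewrite eqxx (negPf n12) [_ == P2]eq_sym (negPf n23) -et; clear; lia.
    + by rewrite eqxx (negPf n13) (negPf n23) -ev; clear; lia.
    by rewrite e eqxx in wP.
  have nf P : fixed s P -> (P == w) = false.
    by move=> fP; apply/eqP => e; apply: fw; rewrite -e.
  by rewrite !nf //; clear; lia.
have [d hd] := closed_root c q0.
have d0 : d != 0 by apply/eqP => e; move: c0; rewrite -hd e expr0n eqxx.
pose y2 := iota d^-1 * y1.
have y2E : y2 ^+ q = M.
  have e1 : y1 ^+ q = iota c * M by rewrite -ec divfK.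
  rewrite /y2 exprMn e1 -hd -rmorphXn mulrA -rmorphM -exprMn mulVf //.
  by rewrite expr1n rmorph1 mul1r.
have iy2 i : iter i s y2 = iota (z ^+ i) * y2.
  elim: i => [|i IH]; first by rewrite rmorph1 mul1r.
  rewrite iterS IH (autM hs) (autK hs) /y2 (autM hs) (autK hs) sy1 exprS rmorphM.
  by ring.
have y20 : y2 != 0 by rewrite mulf_neq0 // fmorph_eq0 invr_eq0.
exists a, r, t, v; split=> //.
(* The order of [y1] at the place over infinity is [-(r + t + v)], and it is prime to [q] as at the
   other fixed places. *)
- have h := tame_fixed ff g2 hs q_prime hq hz y10 sy1 p4 f4.
  apply: contraNneq h => h.
  have e4 : q%:Z * P4 y1 = P4 M.
    have : P4 (y1 ^+ q / M) = 0 by rewrite ec (placeK p4).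
    rewrite (place_div p4) ?expf_neq0 // (placeX p4) //.
    by move/eqP; rewrite subr_eq0 => /eqP.
  have : P4 y1 = - (r + t + v)%N%:Z.
    move: e4; rewrite vM // v1 // v2 // v3 // eqxx (negPf n14) (negPf n24) (negPf n34).
    move=> e4; apply: (mulfI (_ : q%:Z != 0)); first by [].
    by rewrite e4; clear; lia.
  by move=> ->; rewrite dvdzE abszN absz_nat /dvdn h.
exists x, y2; split; last by rewrite y2E /M.
apply: (generation ff g0 hg hs q_prime hq p4 hx nx) => i j hi hj.
rewrite !iy2 => /(mulIf y20) /fmorph_inj /eqP.
by rewrite (eq_prim_root_expr hz) !modn_small // => /eqP.
Qed.

End TameModel.

(** * Wild automorphisms *)

Section Wild.
Variables (K : closedFieldType) (F : fieldType) (iota : {rmorphism K -> F}).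
Hypothesis ff : function_field iota.
Variable g : nat.
Hypothesis g2 : (2 < g)%N.
Hypothesis hg : genus iota g.
Variable s : F -> F.
Hypothesis hs : K_automorphism iota s.
Local Notation q := g.+1.
Hypothesis q_prime : prime q.
Hypothesis q_char : q \in [pchar K].
Hypothesis hq : forall f, iter q s f = f.
Hypothesis s_nontriv : exists f, s f != f.
Implicit Types (D E : divisor F) (w P Q : F -> int) (a b u v y : F).
Local Notation L := (inL iota).
Local Notation dimK := (dim iota).
Local Notation L0s := (L0 iota s q).
Local Notation psis := (psi iota s q).
Local Notation pcs := (pc s q).
Local Notation orbs := (orb s q).
Local Notation N := (eigT iota s (fun _ => 1)).
Local Notation G i D := (grade iota s (fun _ => 1) (L (pull s q D)) i).

Let g0 : (0 < g)%N. Proof. exact: leq_trans g2. Qed.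
Let q0 : (0 < q)%N := prime_gt0 q_prime.
Let dich := orb_dichotomy (iota := iota) q_prime hq.
Let ram := fixed_ramified ff hs q_prime hq s_nontriv.

Lemma one_lam : \prod_(j < q) ('X - (1 : K)%:P) = 'X^q - 1.
Proof.
have qn : [pchar {poly K}].-nat q by rewrite pnatE // pchar_poly.
have := exprDn_pchar ('X - 1 : {poly K}) 1 qn.
by rewrite subrK expr1n prodr_const card_ord polyC1 => ->; rewrite addrK.
Qed.

Lemma natK_neq0 i : (0 < i < q)%N -> i%:R != 0 :> K.
Proof.
by move=> /andP [i0 iq]; rewrite -(dvdn_pcharf q_char) gtnNdvd.
Qed.

Lemma natF_neq0 i : (0 < i < q)%N -> i%:R != 0 :> F.
Proof. by move=> /natK_neq0; rewrite -(fmorph_eq0 iota) rmorph_nat. Qed.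

Lemma NS i u : N i.+1 u = s (N i u) - N i u.
Proof. by rewrite /= rmorph1 mul1r. Qed.

Lemma N_comp i u : N i (N 1 u) = N i.+1 u.
Proof.
rewrite [RHS]NS -(eigT_s hs) (NS 0 u).
exact: (klinearB _ _ (eigT_klinear hs _ _)).
Qed.

Lemma sN i u : s (N i u) = N i.+1 u + N i u.
Proof. by rewrite NS subrK. Qed.

Lemma N_eq0_mono i j u : (i <= j)%N -> N i u = 0 -> N j u = 0.
Proof.
move=> /subnKC <-; elim: (j - i)%N => [|n IH]; first by rewrite addn0.
by move=> /IH h; rewrite addnS NS h (aut0 hs) subrr.
Qed.

Lemma N_mul_inv i b u : s b = b -> N i (b * u) = b * N i u.
Proof.
move=> sb; elim: i => [|i IH] //.
by rewrite !NS IH (autM hs) sb; ring.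
Qed.

(* Leibniz rule for the difference operator [N = s - 1] when [N v] is invariant. *)
Lemma N_mul k u v c : s v = v + c -> s c = c ->
  N k.+1 (u * v) = v * N k.+1 u + (k.+1%:R : F) * (c * (N k.+1 u + N k u)).
Proof.
move=> sv sc; elim: k => [|k IH].
  have e (w : F) : w * (v + c) - u * v = v * (w - u) + 1 * (c * (w - u + u)) by ring.
  by rewrite !NS /= (autM hs) sv; exact: e.
have e (n A' A B : F) : (v + c) * (A' + A) + n * (c * (A' + A + (A + B))) -
   (v * A + n * (c * (A + B))) = v * A' + (n + 1) * (c * (A' + A)) by ring.
rewrite NS IH; have := sN k u; have := sN k.+1 u.
move: (N k.+2 u) (N k.+1 u) (N k u) => A' A B hA hB.
rewrite !(autD hs) !(autM hs) sv sc !(autD hs) hA hB.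
have -> : s k.+1%:R = k.+1%:R by rewrite -(rmorph_nat iota) (autK hs).
rewrite [k.+2%:R]mulrSr; exact: e.
Qed.

Lemma grade_invariant i D a : G i D a -> s a = a.
Proof. by move=> /grade_eigen; rewrite rmorph1 mul1r. Qed.

Lemma grade_L0 i D a : G i D a -> L0s D a.
Proof.
move=> ha; apply/L0_inL; split; first exact: grade_invariant ha.
apply: (grade_sub (subsp_L iota _) _ ha) => u.
exact: (L_pull_s hs q_prime hq).
Qed.

Lemma grade_ext i D E a : (forall w, is_place iota w -> pcs D w <= pcs E w) ->
  G i D a -> G i E a.
Proof.
move=> h [u [/inLP hu tu] <-]; exists u => //; split=> //.
apply/inLP => w pw; apply: vge_le (hu w pw).
by rewrite lerN2 !divcoef_pull h.
Qed.

Lemma grade0 D a : L0s D a -> G 0 D a.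
Proof. by move=> /L0_inL [sa ha]; exists a => //; rewrite NS /= sa subrr. Qed.

(** If [a = N^(i+1) u] then [a = N^i (N u)]. In contrast to the tame case, the graded pieces form a
    decreasing chain. *)
Lemma grade_decr i D a : G i.+1 D a -> G i D a.
Proof.
move=> [u [hu tu] <-]; exists (N 1 u); last exact: N_comp.
split; last by rewrite N_comp.
rewrite NS; apply: (subspB (subsp_L iota _) _ hu).
exact: (L_pull_s hs q_prime hq).
Qed.

(** By the Leibniz rule [N^(i+1) (u v) = (i + 1) a c], since [N^(i+1) u = 0]; the factor [i + 1 < q]
    is invertible in [K]. *)
Lemma grade_mul i D E a c : (i.+1 < q)%N -> G i D a -> G 1 E c -> G i.+1 (D ++ E) (a * c).
Proof.
move=> iq [u [hu tu] <-] hc; have sc := grade_invariant hc.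
move: hc => [v [hv tv] ec].
have sv : s v = v + c by rewrite -ec NS addrC subrK.
have k0 := natK_neq0 (i := i.+1) iq.
exists (iota i.+1%:R^-1 * (u * v)); last first.
  rewrite (klinearZ _ _ (eigT_klinear hs _ _)) (N_mul _ _ sv sc) tu add0r.
  rewrite mulr0 add0r fmorphV rmorph_nat mulKf ?(natF_neq0 (i := i.+1)) //.
  by rewrite mulrC.
split; last first.
  rewrite (klinearZ _ _ (eigT_klinear hs _ _)) (N_mul _ _ sv sc).
  by rewrite (N_eq0_mono (leqnSn _) tu) tu !mulr0 addr0 !mulr0 addr0 mulr0.
apply: subspZ; first exact: subsp_L.
apply/inLP => w pw; move/inLP: hu => hu; move/inLP: hv => hv.
have := vge_mul pw (hu w pw) (hv w pw); congr vge.
by rewrite !divcoef_pull pc_cat; ring.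
Qed.

Lemma wild_dim D : is_divisor iota D ->
  dimK (L (pull s q D)) = (\sum_(i < q) dimK (G i D))%N.
Proof.
move=> hD; exact: (dim_filtration hs q_prime hq one_lam (subsp_L iota (pull s q D))
    (fdim_L_pull ff hg hs q_prime hq hD) (fun u => @L_pull_s _ _ _ _ _ hs q_prime hq D u)).
Qed.

Let fL0 D : is_divisor iota D -> fdim iota (L0s D).
Proof. exact: (fdim_L0s ff hg hs q_prime hq). Qed.

Lemma fdim_G i D : is_divisor iota D -> fdim iota (G i D).
Proof.
move=> hD; apply: fdim_sub (subsp_grade hs _ (subsp_L iota _) _) _ (fL0 hD).
exact: grade_L0.
Qed.

Lemma dim_G_le i D : is_divisor iota D -> (dimK (G i D) <= dimK (L0s D))%N.
Proof.
move=> hD; apply: (dim_sub _ _ (fL0 hD)); last exact: grade_L0.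
exact: (subsp_grade hs _ (subsp_L iota _) i).
Qed.

Lemma wild_psi_le0 D : is_divisor iota D -> psis D <= 0.
Proof.
move=> hD; have h1 := riemann ff hg (is_divisor_pull hs q0 hq hD).
have h2 : (dimK (L (pull s q D)) <= q * dimK (L0s D))%N.
  rewrite wild_dim // -[q in (q * _)%N]card_ord -sum_nat_const.
  by apply: leq_sum => i _; apply: dim_G_le.
(* The dimensions give [q psi(D) <= g - 1 < q]. *)
rewrite /psi leNgt; apply/negP => h3; move: h1; rewrite divdeg_pull => h1.
have : q%:Z * 1 <= q%:Z * (divdeg D - (dimK (L0s D))%:Z) by rewrite ler_wpM2l.
by move: h1 h2; clear; lia.
Qed.


(** * Exclusion of a quotient of genus one *)

Section GenusOneExcluded.
Variable T : nat.
Variable P : F -> int.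
Hypothesis pP : is_place iota P.
Local Notation Dn n := ([:: (P, (n : nat)%:Z)] : divisor F).
Hypothesis psi0 : forall n, (T <= n)%N -> psis (Dn n) = 0.
Hypothesis dimL : forall n, (T <= n)%N ->
  (dimK (L (pull s q (Dn n))))%:Z = q%:Z * n%:Z + 1 - g%:Z.

Let hD n : is_divisor iota (Dn n). Proof. exact: is_divisor_cons. Qed.

Lemma dim_Dn n : (T <= n)%N -> dimK (L0s (Dn n)) = n.
Proof. by move=> /psi0; rewrite /psi divdeg_cons divdeg_nil /=; lia. Qed.

Lemma pc_Dn n w : pcs (Dn n) w = n%:Z * (orbs P w)%:Z.
Proof. by rewrite pc_cons pc_nil addr0. Qed.

Lemma L0_Dn_le m n a : (m <= n)%N -> L0s (Dn m) a -> L0s (Dn n) a.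
Proof.
by move=> h; apply: (L0_ext hs) => w _; rewrite !pc_Dn ler_wpM2r.
Qed.

Lemma dim_grade_sum n : (T <= n)%N ->
  (dimK (G 0 (Dn n)) + \sum_(i < g) dimK (G i.+1 (Dn n)))%N = (q * n + 1 - g)%N.
Proof.
move=> hn; have := dimL hn; rewrite (wild_dim (@hD n)) big_ord_recl /=.
move: (_ + \sum_(_ < _) _)%N => X; clear; nia.
Qed.

(** The pieces decrease, so if [G 1] had dimension at most [n - 1], the total would be at most
    [n + g (n - 1) = q n - g], one less than the dimension of [L(pull (Dn n))]. *)
Lemma grade1_full n : (T <= n)%N -> forall a, L0s (Dn n) a -> G 1 (Dn n) a.
Proof.
move=> hn; apply: dim_sub_eq.
- exact: (subsp_grade hs _ (subsp_L iota _) 1).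
- exact: grade_L0.
- exact: fL0.
rewrite dim_Dn // leqNgt; apply/negP => hlt.
have h0 := dim_G_le 0 (@hD n); rewrite dim_Dn // in h0.
have hi i : (dimK (G i.+1 (Dn n)) <= n.-1)%N.
  apply: (@leq_trans (dimK (G 1 (Dn n)))); last by case: (n) hlt.
  apply: dim_sub; [|elim: i => // i IH a /grade_decr/IH //|exact: fdim_G].
  exact: (subsp_grade hs _ (subsp_L iota _) _).
have hs' : (\sum_(i < g) dimK (G i.+1 (Dn n)) <= g * n.-1)%N.
  rewrite -[g in (g * _)%N]card_ord -sum_nat_const; exact: leq_sum.
have := dim_grade_sum hn; move: hs' h0 hlt g0; clear.
move: (dimK (G 0 _)) (\sum_(_ < _) _)%N => x z; case: n => [|n]; nia.
Qed.

Lemma exact_pole n : (T <= n)%N -> exists2 f, L0s (Dn n.+1) f & ~ L0s (Dn n) f.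
Proof.
move=> hn; apply: contrapT => hno.
have hsub u : L0s (Dn n.+1) u -> L0s (Dn n) u.
  by move=> hu; apply: contrapT => nu; apply: hno; exists u.
have := dim_sub (subsp_L0 q hs _) hsub (fL0 (@hD n)).
by rewrite !dim_Dn ?ltnn // leqW.
Qed.

Lemma Dn_cons n a : L0s (Dn n.+1) a <-> L0s ((P, 1) :: Dn n) a.
Proof.
split; apply: (L0_ext hs) => w _; rewrite pc_Dn pc_cons pc_Dn /=; lia.
Qed.

Lemma exact_value n f : L0s (Dn n.+1) f -> ~ L0s (Dn n) f ->
  f != 0 /\ P f = - (n.+1%:Z * (orbs P P)%:Z).
Proof.
move=> /Dn_cons h1 h2; have [-> ->] := L0_exact hs q0 hq dich ram pP h1 h2.
by split=> //; rewrite pc_Dn; lia.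
Qed.

(* Base-point-free pencil trick: with [1, h] in the first graded piece, fullness
   propagates from one graded piece to the next. *)
Lemma grade_full i : (i < q)%N -> exists n0, forall n, (n0 <= n)%N ->
  forall a, L0s (Dn n) a -> G i (Dn n) a.
Proof.
elim: i => [|i IH] iq; first by exists 0%N => n _ a; apply: grade0.
have [n0 hn0] := IH (ltnW iq).
(* On the quotient [h] has pole order exactly [M] at [P]; the pencil is spanned by 1 and [h]. *)
pose M := T.+1; have [h hh nh] := exact_pole (leqnn T).
have [h0 Ph] := exact_value hh nh.
have g1h : G 1 (Dn M) h by apply: grade1_full => //; apply: leqnSn.
have g11 : G 1 (Dn M) 1.
  apply: grade1_full; first exact: leqnSn.
  apply: (@L0_Dn_le 0) => //; rewrite -(rmorph1 iota).
  apply: (@L0_ext _ _ iota s q hs [::]); first by move=> w _; rewrite pc_Dn mul0r pc_nil.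
  by apply/(L0_nilP ff hg q hs); exists 1.
have mult n a c : (M <= n)%N -> G i (Dn (n - M)) a -> G 1 (Dn M) c ->
    G i.+1 (Dn n) (a * c).
  move=> hM ha hc; apply: grade_ext (grade_mul iq ha hc) => w _.
  by rewrite pc_cat !pc_Dn -mulrDl -PoszD subnK.
(* One [M] is spent on the multiplication by 1 or [h]; the other two ensure [k - M >= T] once the
   induction on the pole order passes [n - M]. *)
exists (n0 + 3 * M)%N => n hn.
have big : (M <= n /\ n0 <= n - M)%N by clear -hn; lia.
suff claim k a : (k <= n)%N -> L0s (Dn k) a -> G i.+1 (Dn n) a by move=> a; apply: claim.
elim: k a => [|k IHk] a hk ha.
  rewrite -[a]mulr1; apply: mult g11; first exact: big.1.
  by apply: hn0; [exact: big.2|apply: L0_Dn_le ha].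
have [hle|hgt] := leqP k.+1 (n - M).
  rewrite -[a]mulr1; apply: mult g11; first exact: big.1.
  by apply: hn0; [exact: big.2|apply: L0_Dn_le ha].
have kM : (T <= k - M)%N by move: hgt hn; rewrite /M; clear; lia.
have ek : ((k - M).+1 + M = k.+1)%N by move: hgt hn; rewrite /M; clear; lia.
(* The product [f h] lies in the next graded piece and has pole order exactly [k + 1], so a multiple
   of it removes the leading term of [a]. *)
have [f hf nf] := exact_pole kM; have [f0 Pf] := exact_value hf nf.
have hfh : L0s (Dn k.+1) (f * h).
  apply/L0P; split.
    by rewrite (autM hs); case: hf => -> _; case: hh => -> _.
  move=> w pw; have /L0P [_ /(_ w pw) h1] := hf; have /L0P [_ /(_ w pw) h2] := hh.
  have := vge_mul pw h1 h2; congr vge; rewrite !pc_Dn -ek /M; lia.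
have nfh : ~ L0s (Dn k) (f * h).
  move=> [_ [/eqP|/(_ P pP)]]; first by rewrite mulf_eq0 (negPf f0) (negPf h0).
  rewrite (placeM pP) // Pf Ph pc_Dn; have := orb_pos s q0 P.
  have -> : k = (k - M + M)%N by move: hgt hn; rewrite /M; clear; lia.
  rewrite addnK /M; clear; nia.
have /Dn_cons ha' := ha; have /Dn_cons hfh' := hfh.
have [c hc] := L0_step ff hs q0 hq dich ram pP ha' hfh' nfh.
rewrite -[a](subrK (iota c * (f * h))).
have sG := subsp_grade hs (fun _ => 1) (subsp_L iota (pull s q (Dn n))) i.+1.
apply: (subspD sG); first by apply: IHk hc; apply: ltnW.
apply: (subspZ _ sG); apply: mult g1h; first exact: big.1.
apply: hn0; first exact: big.2.
by apply: L0_Dn_le hf; move: hk ek; clear; lia.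
Qed.

(** All [q] graded pieces have dimension [n] for large [n], whence [q n = q n + 1 - g]. *)
Lemma genus_one_excluded : False.
Proof.
have full j : (j <= q)%N -> exists n0, forall i n, (i < j)%N -> (n0 <= n)%N ->
    forall a, L0s (Dn n) a -> G i (Dn n) a.
  elim: j => [|j IH] jq; first by exists 0%N.
  have [n1 h1] := IH (ltnW jq); have [n2 h2] := grade_full jq.
  exists (n1 + n2)%N => i n; rewrite ltnS leq_eqVlt => /orP [/eqP ->|hi] hn.
    by apply: h2; apply: leq_trans hn; apply: leq_addl.
  by apply: h1 => //; apply: leq_trans hn; apply: leq_addr.
have [n0 h] := full q (leqnn q).
pose n := (n0 + T)%N; have hT : (T <= n)%N by apply: leq_addl.
have := dimL hT; rewrite (wild_dim (@hD n)).
rewrite (eq_bigr (fun _ => n)) => [|i _].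
  by rewrite sum_nat_const card_ord; move: g2; clear; lia.
rewrite -[RHS]dim_Dn //; apply: eq_dim => a; split; first exact: grade_L0.
by apply: h => //; apply: leq_addr.
Qed.

End GenusOneExcluded.

Lemma wild_genus_zero D : is_divisor iota D -> psis D <= -1.
Proof.
have [m [N0 [m1 hm hN]]] := psi_stable ff g0 hg hs q_prime hq s_nontriv wild_psi_le0.
have [P pP] := exists_place ff g0 hg.
have [N' hN'] := riemann_large ff g0 hg.
have m0 : m <= 0.
  pose D0 : divisor F := [:: (P, N0)].
  have hD0 : is_divisor iota D0 by apply: is_divisor_cons.
  by rewrite -(hN D0) ?wild_psi_le0 // divdeg_cons divdeg_nil addr0.
have [em|em] : m = 0 \/ m = -1 by move: m1 m0; clear; lia.
  exfalso; apply: (@genus_one_excluded (`|N0| + `|N'|)%N P pP) => n hn.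
    rewrite -em; apply: hN; first exact: is_divisor_cons.
    by rewrite divdeg_cons divdeg_nil /=; move: hn; clear; lia.
  have hD : is_divisor iota [:: (P, n%:Z)] by apply: is_divisor_cons.
  rewrite hN'; [|exact: is_divisor_pull|];
    rewrite divdeg_pull divdeg_cons divdeg_nil addr0 //=.
  by move: hn; clear; nia.
by rewrite -em; apply: hm.
Qed.

End Wild.

(** * Artin-Schreier generators and reduction of their poles *)

Section WildModel.
Variables (K : closedFieldType) (F : fieldType) (iota : {rmorphism K -> F}).
Hypothesis ff : function_field iota.
Variable g : nat.
Hypothesis g2 : (2 < g)%N.
Hypothesis hg : genus iota g.
Variable s : F -> F.
Hypothesis hs : K_automorphism iota s.
Local Notation q := g.+1.
Hypothesis q_prime : prime q.
Hypothesis q_char : q \in [pchar K].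
Hypothesis hq : forall f, iter q s f = f.
Hypothesis s_nontriv : exists f, s f != f.
Implicit Types (D E : divisor F) (w P Q : F -> int) (a b u v x : F).
Local Notation orbs := (orb s q).
Local Notation N := (eigT iota s (fun _ => 1)).

Let g0 : (0 < g)%N. Proof. exact: leq_trans g2. Qed.
Let q0 : (0 < q)%N := prime_gt0 q_prime.
Let dich := orb_dichotomy (iota := iota) q_prime hq.
Let psi_le := wild_genus_zero ff g2 hg hs q_prime q_char hq s_nontriv.

Lemma shift_neq0 y : s y = y + 1 -> y != 0.
Proof.
move=> sy; apply/eqP => e; move: sy; rewrite e (aut0 hs) add0r => /esym/eqP.
by rewrite oner_eq0.
Qed.

Lemma iter_shift i y : s y = y + 1 -> iter i s y = y + i%:R.
Proof.
move=> sy; elim: i => [|i IH]; first by rewrite addr0.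
by rewrite iterS IH (autD hs) sy -(rmorph_nat iota) (autK hs) rmorph_nat mulrSr
  -addrA [1 + _]addrC addrA.
Qed.

(** [s] acts trivially on residues at a fixed place, so if [y] were regular there, [s y - y = 1]
    would vanish at it. *)
Lemma shift_fixed y P : s y = y + 1 -> is_place iota P -> fixed s P -> P y < 0.
Proof.
move=> sy pP fP; rewrite ltNge; apply/negP => h.
have [c hc] := residue ff pP (or_intror h : vge P 0 y).
have h1 : vge P 1 (s (y - iota c)).
  case: hc => [->|h']; first by rewrite (aut0 hs); left.
  by right; rewrite (iter_place 1 _ fP).
have := vgeB pP h1 hc; rewrite (autB hs) (autK hs) sy.
have -> : y + 1 - iota c - (y - iota c) = 1 by ring.
by move=> /vge_ge; rewrite oner_eq0 (place1 pP) => /(_ isT).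
Qed.

Lemma vge_nat w i : is_place iota w -> vge w 0 (i%:R : F).
Proof. by move=> pw; rewrite -(rmorph_nat iota); apply: vgeK. Qed.

Lemma rot_shift y P i : s y = y + 1 -> is_place iota P -> P y < 0 ->
  rot s i P y = P y.
Proof.
move=> sy pP hy; rewrite /rot (iter_shift i sy).
have [|_ ->] // := @place_add_lt _ _ iota P pP y i%:R (shift_neq0 sy).
by apply: vge_le (vge_nat i pP); lia.
Qed.

(** If [N (i+1) f] is the last nonzero term of the chain, it is invariant and
    [s (N i f) = N i f + N (i+1) f]; dividing by it gives a shift by 1. *)
Lemma artin_schreier_exists : exists y, s y = y + 1.
Proof.
have [f hf] := s_nontriv.
have [i [/andP [i0 iq] Ni sNi]] :=
  eigT_exists (lam := fun _ => 1) hs q_prime hq (one_lam q_prime q_char) hf (erefl (1 : K)).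
case: i i0 iq Ni sNi => // i _ _ Ni sNi.
have {}sNi : s (N i.+1 f) = N i.+1 f by rewrite sNi rmorph1 mul1r.
exists (N i f / N i.+1 f).
rewrite (autM hs) (autV hs) sNi (sN iota s i f) mulrDl divff // addrC.
by [].
Qed.

Definition good_shift y := s y = y + 1 /\
  forall P, is_place iota P -> P y < 0 -> fixed s P /\ ~~ (q%:Z %| P y)%Z.

(** The pole order is a multiple of [orb P P], so the leading polar term is cancelled by [c h^k],
    with [h] a simple pole on the quotient. Other poles do not worsen: [h] is regular off the orbit
    of [P], and along the orbit pole orders are constant because integer shifts do not change
    them. *)
Lemma reduce_pole y P : s y = y + 1 -> is_place iota P -> P y < 0 ->
  ~ (fixed s P /\ ~~ (q%:Z %| P y)%Z) -> exists y', [/\ s y' = y' + 1, P y < P y' &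
    forall w, is_place iota w -> w y' < 0 -> w y <= w y'].
Proof.
move=> sy pP Py bad; have y0 := shift_neq0 sy.
have [h [hh h0 Ph]] := simple_pole ff g0 hg hs q_prime hq s_nontriv psi_le pP.
have [k ek] : exists k : nat, P y = - (k%:Z * (orbs P P)%:Z).
  have hd : ((orbs P P)%:Z %| P y)%Z.
    case: (dich pP) => [fP|->]; last exact: dvd1z.
    rewrite orb_fixed //; apply: contrapT => /negP nd; apply: bad; by split.
  have [k hk] := dvdzP hd; exists `|k|%N; rewrite hk -mulNr; congr (_ * _).
  move: Py; rewrite hk; have := orb_pos s q0 P; clear; nia.
pose w0 := h ^+ k; have w00 : w0 != 0 by rewrite expf_neq0.
have Pw0 : P w0 = P y by rewrite (placeX pP) // Ph ek mulrN.
have [sh _] := hh; have sw0 : s w0 = w0 by rewrite (autX hs) sh.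
have hyw : vge P 0 (y / w0) by right; rewrite (place_div pP) // Pw0 subrr.
have [c hc] := residue ff pP hyw.
pose y' := y - iota c * w0.
have sy' : s y' = y' + 1.
  by rewrite /y' (autB hs) (autM hs) (autK hs) sy sw0; ring.
have Py' : P y < P y'.
  have : vge P (P y + 1) y'.
    have := vge_mul pP hc (vge_refl P w0); rewrite mulrBl divfK // Pw0.
    by congr vge; rewrite addrC.
  by move=> /vge_ge /(_ (shift_neq0 sy')); lia.
exists y'; split=> // w pw wy'.
have [e|] := eqVneq (orbs P w) 0%N.
  have hw : vge w 0 (iota c * w0).
    apply: vgeZ => //; have /L0P [_ /(_ w pw)] := hh.
    rewrite pc_cons pc_nil mul1r addr0 e oppr0 => h1.
    by have := vge_exp pw k h1; rewrite mulr0.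
  have [h1|h1] := lerP 0 (w y).
    have : vge w 0 y' by apply: (vgeB pw) => //; right.
    by move=> /vge_ge /(_ (shift_neq0 sy')); lia.
  have : vge w (w y) y'.
    by apply: (vgeB pw); [right|apply: vge_le hw; apply: ltW].
  by move=> /vge_ge /(_ (shift_neq0 sy')).
move=> /orb_neq0 [i ew]; rewrite ew in wy' *; rewrite rot_shift //.
have [h1|h1] := ltrP (P y') 0; first by rewrite rot_shift // ltW.
move: wy'; rewrite /rot (iter_shift i sy') => wy'.
have : vge P 0 (y' + i%:R) by apply: (vgeD pP); [right|apply: vge_nat].
move=> /vge_ge; rewrite -(iter_shift i sy') (iter_aut_eq0 hs).
by move=> /(_ (shift_neq0 sy')); rewrite (iter_shift i sy'); lia.
Qed.

Lemma good_shift_exists : exists y, good_shift y.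
Proof.
have [y0 sy0] := artin_schreier_exists.
have [S0 hS0] := all_finpoles ff g0 hg y0; have [S [uS hS]] := place_list iota S0.
have hS' w : w \in S -> is_place iota w /\ w \in S0 by move=> /hS.
have {}hS w : is_place iota w -> w y0 < 0 -> w \in S.
  by move=> pw h; apply/hS; split=> //; apply: hS0.
(* Total pole order over the fixed finite set [S]; each application of [reduce_pole] decreases
   it. *)
pose mu y := (\sum_(w <- S) (if ((w : F -> int) y < 0)%R then `|w y|%N else 0))%N.
suff H n y : s y = y + 1 -> (forall w, is_place iota w -> w y < 0 -> w \in S) ->
    (mu y <= n)%N -> exists y, good_shift y by exact: (H _ _ sy0 hS (leqnn _)).
elim: n y => [|n IH] y sy hy hmu; have [hgood|hbad] := pselect (good_shift y);
  try by exists y.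
- exfalso; apply: hbad; split=> // P pP Py.
  have : (0 < mu y)%N.
    by rewrite /mu (bigD1_seq P) ?hy //= Py; move: Py; clear; lia.
  by move: hmu; clear; lia.
have [P [pP Py bad]] : exists P, [/\ is_place iota P, P y < 0 &
    ~ (fixed s P /\ ~~ (q%:Z %| P y)%Z)].
  apply: contrapT => hno; apply: hbad; split=> // P pP Py.
  by apply: contrapT => bad; apply: hno; exists P.
have [y' [sy' Py' hy']] := reduce_pole sy pP Py bad.
apply: (IH y') => // [w pw wy'|]; first apply: hy => //.
  exact: le_lt_trans (hy' w pw wy') wy'.
rewrite -ltnS; apply: leq_trans hmu.
have pS w : w \in S -> is_place iota w by move=> /hS' [].
have PS : P \in S by apply: hy.
rewrite /mu (bigD1_seq P) //= [X in (_ < X)%N](bigD1_seq P) //= Py.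
rewrite -addSn; apply: leq_add.
  by move: (P y) (P y') Py Py' => c c'; clear; case: ifP; lia.
rewrite big_seq_cond [X in (_ <= X)%N]big_seq_cond; apply: leq_sum => w /andP [wS _].
case: ifP => // h; have := hy' w (pS w wS) h; move: h.
by move: (w y) (w y') => c c'; clear; case: ifP; lia.
Qed.

End WildModel.

(** * The Riemann-Hurwitz count in the wild case *)

Section WildCount.
Variables (K : closedFieldType) (F : fieldType) (iota : {rmorphism K -> F}).
Hypothesis ff : function_field iota.
Variable g : nat.
Hypothesis g2 : (2 < g)%N.
Hypothesis hg : genus iota g.
Variable s : F -> F.
Hypothesis hs : K_automorphism iota s.
Local Notation q := g.+1.
Hypothesis q_prime : prime q.
Hypothesis q_char : q \in [pchar K].
Hypothesis hq : forall f, iter q s f = f.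
Hypothesis s_nontriv : exists f, s f != f.
Implicit Types (D E : divisor F) (w P Q : F -> int) (a b u v x : F).
Local Notation L := (inL iota).
Local Notation dimK := (dim iota).
Local Notation L0s := (L0 iota s q).
Local Notation pcs := (pc s q).
Local Notation N := (eigT iota s (fun _ => 1)).
Local Notation G i D := (grade iota s (fun _ => 1) (L (pull s q D)) i).

Let g0 : (0 < g)%N. Proof. exact: leq_trans g2. Qed.
Let q0 : (0 < q)%N := prime_gt0 q_prime.
Let dich := orb_dichotomy (iota := iota) q_prime hq.
Let ram := fixed_ramified ff hs q_prime hq s_nontriv.
Let psi_le := wild_genus_zero ff g2 hg hs q_prime q_char hq s_nontriv.

Variable y : F.
Hypothesis sy : s y = y + 1.
Hypothesis gy : forall P, is_place iota P -> P y < 0 -> fixed s P /\ ~~ (q%:Z %| P y)%Z.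

Let y0 : y != 0 := shift_neq0 hs sy.

Lemma fact_neq0 i : (i < q)%N -> (i`!)%:R != 0 :> F.
Proof.
elim: i => [|i IH] iq; first by rewrite fact0 oner_eq0.
by rewrite factS natrM mulf_neq0 ?IH ?(ltnW iq) // (natF_neq0 iota q_prime q_char).
Qed.

Lemma N_power i : N i (y ^+ i) = (i`!)%:R /\ N i.+1 (y ^+ i) = 0.
Proof.
have s1 := aut1 hs.
elim: i => [|i [IH1 IH2]]; first by rewrite (NS iota s 0) /= expr0 s1 subrr.
rewrite exprSr !(N_mul hs _ _ sy s1) (N_eq0_mono hs (leqnSn _) IH2) IH2 IH1.
by rewrite !(mulr0, add0r, addr0, mul1r) factS natrM.
Qed.

(* At a totally ramified place the terms of [sum a_j y^j] have valuations which
   are distinct modulo [q], so no cancellation occurs. *)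
Lemma leading_term_bound P i u : is_place iota P -> fixed s P -> (i < q)%N ->
  N i.+1 u = 0 -> N i u != 0 ->
  P u <= P (N i u) + i%:Z * P y /\
  exists2 j, (j <= i)%N & (q%:Z %| P u - j%:Z * P y)%Z.
Proof.
move=> pP fP; have [_ nd] := gy pP (shift_fixed ff hs sy pP fP).
elim/ltn_ind: i u => i IH u iq h1 h0.
have sa : s (N i u) = N i u by rewrite (sN iota s) h1 add0r.
have fi := fact_neq0 iq.
have sfi : s (i`!)%:R = (i`!)%:R by rewrite -(rmorph_nat iota) (autK hs).
pose b := N i u / (i`!)%:R; have b0 : b != 0 by rewrite mulf_neq0 ?invr_eq0.
have sb : s b = b by rewrite (autM hs) (autV hs) sa sfi.
pose t := b * y ^+ i; have t0 : t != 0 by rewrite mulf_neq0 ?expf_neq0.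
have Pfi : P (i`!)%:R = 0.
  by rewrite -(rmorph_nat iota) (placeK pP) // -(fmorph_eq0 iota) rmorph_nat.
have Pt : P t = P (N i u) + i%:Z * P y.
  by rewrite (placeM pP) ?expf_neq0 // (placeX pP) // (place_div pP) // Pfi subr0.
have dt : (q%:Z %| P t - i%:Z * P y)%Z.
  by rewrite Pt addrK; apply: ram.
have Nt : N i t = N i u by rewrite (N_mul_inv hs _ _ sb) (N_power i).1 divfK.
have [e|ne] := eqVneq u t.
  by rewrite -Pt -e; split=> //; exists i; rewrite ?leqnn // e.
pose u' := u - t; have u0 : u' != 0 by rewrite subr_eq0.
have Nu' : N i u' = 0 by rewrite (klinearB _ _ (eigT_klinear hs _ _)) Nt subrr.
have ex : exists n, N n u' == 0 by exists i; rewrite Nu'.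
case: (ex_minnP ex) => -[/eqP h|k /eqP hk kmin]; first by rewrite [u']h eqxx in u0.
have ki : (k < i)%N by apply: kmin; rewrite Nu'.
have nk : N k u' != 0 by apply/negP => /kmin; rewrite ltnn.
have [_ [j jk dj]] := IH k ki u' (ltn_trans ki iq) hk nk.
have ji : (j < i)%N by apply: leq_ltn_trans ki.
have neq : P u' != P t.
  apply/eqP => e; move: dj; rewrite e => dj.
  have : (q%:Z %| (i - j)%N%:Z * P y)%Z.
    have -> : (i - j)%N%:Z * P y = (P t - j%:Z * P y) - (P t - i%:Z * P y).
      by rewrite -subzn ?(ltnW ji) //; ring.
    exact: rpredB.
  rewrite dvdzE abszM Euclid_dvdM // => /orP [|h]; last by move: nd; rewrite dvdzE h.
  by rewrite absz_nat gtnNdvd ?subn_gt0 //; apply: leq_ltn_trans iq; apply: leq_subr.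
have eu : u = t + u' by rewrite addrC subrK.
have [hlt|hlt|] := ltgtP (P t) (P u'); last by move=> e; rewrite e eqxx in neq.
  have h : vge P (P t + 1) u' by right; move: hlt; clear; lia.
  have [_ e] := place_add_lt pP t0 h.
  have Pu : P u = P t by rewrite {1}eu.
  by rewrite Pu; split; [rewrite Pt|exists i].
have h : vge P (P u' + 1) t by right; move: hlt; clear; lia.
have [_ e] := place_add_lt pP u0 h.
have Pu : P u = P u' by rewrite {1}eu addrC.
rewrite Pu -Pt; split; first exact: ltW.
by exists j => //; apply: ltnW.
Qed.

(** In contrast to [tcoef], it vanishes off the fixed places: [y] is regular there, and the graded
    pieces consist of the leading coefficients [a] themselves, without the factor [y^i]. *)
Definition wcoef (i : nat) w : int :=
  if `[< fixed s w >] then q%:Z * ((i%:Z * w y) %/ q%:Z)%Z else 0.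

Lemma wcoef_divisor i : exists E, is_divisor iota E /\
  forall w, is_place iota w -> pcs E w = wcoef i w.
Proof.
have [X [hX _ eX]] := principal_divisor ff g0 hg y0.
have [|||E [hE eE _]] := pull_repr hs q0 hq dich (S := [seq p.1 | p <- X])
   (f := wcoef i).
- move=> w pw; rewrite /wcoef; case: (asboolP (fixed s w)) => fw.
    by rewrite fw asboolT.
  by rewrite asboolF // => /(comp_aut_inj q0 hq).
- move=> w pw h; have : divcoef X w != 0.
    rewrite eX //; apply: contraNneq h; rewrite /wcoef => ->.
    by rewrite mulr0 div0z mulr0; case: ifP.
  by move=> /divcoef_supp [p hp <-]; apply: map_f.
- by move=> w pw fw; rewrite /wcoef asboolT // dvdz_mulr.
by exists E.
Qed.

(** [a y^i / i!] is a preimage of [a] under [N i], and by [leading_term_bound] no preimage has a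
    smaller pole order at a fixed place. So the condition on [a] there is the bound on [a y^i]. *)
Lemma wild_decomposition i E D : (i < q)%N -> is_divisor iota D ->
  is_divisor iota E -> (forall w, is_place iota w -> pcs E w = wcoef i w) ->
  dimK (G i D) = dimK (L0s (E ++ D)).
Proof.
move=> iq hD hE eE.
have fi := fact_neq0 iq.
have key w b : is_place iota w -> fixed s w -> s b = b -> b != 0 ->
    (- pcs (E ++ D) w <= w b) = (- pcs D w <= i%:Z * w y + w b).
  move=> pw fw sb b0; rewrite pc_cat eE // /wcoef asboolT //.
  by apply: dvdz_floor_le => //; [exact: (ram pw fw sb b0)|exact: pc_dvd].
have key' w : is_place iota w -> ~ fixed s w -> pcs (E ++ D) w = pcs D w.
  by move=> pw fw; rewrite pc_cat eE // /wcoef asboolF // add0r.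
apply: eq_dim => a; split=> [ha|[sa ha]].
  have sa := grade_invariant ha.
  have [->|a0] := eqVneq a 0; first exact: (subsp_L0 q hs _).1.
  split=> //; right=> w pw.
  have [_ [/eqP|haD]] := grade_L0 hs q_prime hq ha; first by rewrite (negPf a0).
  have [fw|nfw] := pselect (fixed s w); last by rewrite key' ?haD.
  rewrite key //; have [u [hu h1] eu] := ha.
  have [|hb _] := leading_term_bound pw fw iq h1; first by rewrite eu.
  move: hb; rewrite eu addrC; apply: le_trans.
  rewrite -(divcoef_pull s q); case: hu => [u0|]; last by apply.
  by move: a0; rewrite -eu u0 (klinear0 (eigT_klinear hs _ _)) eqxx.
have [a0|a0] := eqVneq a 0.
  by rewrite a0; apply: (subsp_grade hs _ (subsp_L iota _) _).1.
case: ha => [/eqP|ha]; first by rewrite (negPf a0).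
pose b := a / (i`!)%:R.
have sfi : s (i`!)%:R = (i`!)%:R by rewrite -(rmorph_nat iota) (autK hs).
have sb : s b = b by rewrite (autM hs) (autV hs) sa sfi.
have [n1 n2] := N_power i.
exists (b * y ^+ i); last by rewrite (N_mul_inv hs _ _ sb) n1 divfK.
split; last by rewrite (N_mul_inv hs _ _ sb) n2 mulr0.
right=> w pw; rewrite divcoef_pull.
have wfi : w (i`!)%:R = 0.
  by rewrite -(rmorph_nat iota) (placeK pw) // -(fmorph_eq0 iota) rmorph_nat.
rewrite (placeM pw) ?mulf_neq0 ?invr_eq0 ?expf_neq0 // (placeX pw) // (place_div pw) //.
rewrite wfi subr0 addrC.
have [fw|nfw] := pselect (fixed s w); first by rewrite -key ?ha.
have := ha w pw; rewrite key' // => h; apply: le_trans h _.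
rewrite lerDr mulr_ge0 // leNgt; apply/negP => h.
by have [] := gy pw h.
Qed.

Lemma wild_count : exists S : seq (F -> int), [/\ uniq S,
  forall w, (w \in S) <-> is_place iota w /\ fixed s w &
  \sum_(P <- S) (1 - P y) = 4%:Z].
Proof.
pose E i := sval (cid (wcoef_divisor i)).
have hE i : is_divisor iota (E i) by rewrite /E; case: cid => ? [].
have eE i w : is_place iota w -> pcs (E i) w = wcoef i w.
  by rewrite /E; case: cid => X [hX eX]; apply: eX.
have decomp D : is_divisor iota D ->
    dimK (L (pull s q D)) = (\sum_(i < q) dimK (L0s (E i ++ D)))%N.
  move=> hD; rewrite (wild_dim ff hg hs q_prime q_char hq hD).
  by apply: eq_bigr => i _; apply: wild_decomposition => // w; apply: eE.
have [m [N0 [m1 hm hN]]] := psi_stable ff g0 hg hs q_prime hq s_nontriv psi_le.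
have em : m = -1.
  have [P pP] := exists_place ff g0 hg.
  have hP : is_divisor iota [:: (P, N0)] by apply: is_divisor_cons.
  apply/eqP; rewrite eq_le m1 andbT -(hN _ hP) ?psi_le //.
  by rewrite divdeg_cons divdeg_nil addr0.
have := degree_count ff g0 hg hs q_prime hq hE decomp hN; rewrite em => cnt.
have [|S [uS hS]] := fixed_list ff g0 hg (s := s) y0.
  by move=> P pP fP; rewrite lt_eqF // (shift_fixed ff hs sy pP fP).
exists S; split=> //.
have dE i : q%:Z * divdeg (E i) =
    \sum_(P <- S) (i%:Z * P y - ((i%:Z * P y) %% q%:Z)%Z).
  have hT : is_divisor iota (div_of S (fun P => i%:Z * P y - ((i%:Z * P y) %% q%:Z)%Z)).
    by apply: is_divisor_div_of => w /hS [].
  rewrite -divdeg_div_of -(divdeg_pull s q); apply: (divdeg_eq (iota := iota)) => //.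
    exact: is_divisor_pull.
  move=> w pw; rewrite divcoef_pull eE // divcoef_div_of // /wcoef.
  case: asboolP => fw; last by case: ifP => [/hS [_ /fw]|].
  by rewrite (hS w).2 // {2}(divz_eq (i%:Z * w y) q%:Z) addrK mulrC.
have idx : 2%:Z * (\sum_(i < q) i%:Z) = q%:Z * (q%:Z - 1).
  rewrite -(sum_modz (a := 1) q_prime); last by rewrite dvdz1; move: g0; clear; lia.
  congr (_ * _); apply: eq_bigr => i _; rewrite mulr1 modz_small //.
  by rewrite ltz_nat ltn_ord.
(* Twice the sum of [dE] over [i] is [- q g sum (1 - P y)], while the degrees of the [E i] add up to
   [-2 g]. *)
have main : q%:Z * g%:Z * (\sum_(P <- S) (1 - P y)) = q%:Z * g%:Z * 4%:Z.
  transitivity (- (2%:Z * \sum_(i < q) (q%:Z * divdeg (E i)))); last first.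
    by rewrite -mulr_sumr cnt; lia.
  under [in RHS]eq_bigr => i _ do rewrite dE.
  rewrite exchange_big /= !mulr_sumr -sumrN big_seq [RHS]big_seq.
  apply: eq_bigr => P /hS [pP fP].
  have [_ nd] := gy pP (shift_fixed ff hs sy pP fP).
  rewrite sumrB -mulr_suml [in RHS]mulrBr (sum_modz q_prime nd) mulrA idx.
  have -> : q%:Z - 1 = g%:Z by clear; lia.
  by ring.
apply: (mulfI (_ : q%:Z * g%:Z != 0)) => //.
by rewrite mulf_neq0 //; move: g0; clear; lia.
Qed.

End WildCount.

(** * Equations in the wild case *)

Section WildEquations.
Variables (K : closedFieldType) (F : fieldType) (iota : {rmorphism K -> F}).
Hypothesis ff : function_field iota.
Variable g : nat.
Hypothesis g2 : (2 < g)%N.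
Hypothesis hg : genus iota g.
Variable s : F -> F.
Hypothesis hs : K_automorphism iota s.
Local Notation q := g.+1.
Hypothesis q_prime : prime q.
Hypothesis q_char : q \in [pchar K].
Hypothesis hq : forall f, iter q s f = f.
Hypothesis s_nontriv : exists f, s f != f.
Implicit Types (D E : divisor F) (w P Q : F -> int) (a b u v x : F).
Local Notation L0s := (L0 iota s q).
Local Notation orbs := (orb s q).
Local Notation N := (eigT iota s (fun _ => 1)).

Let g0 : (0 < g)%N. Proof. exact: leq_trans g2. Qed.
Let q0 : (0 < q)%N := prime_gt0 q_prime.
Let psi_le := wild_genus_zero ff g2 hg hs q_prime q_char hq s_nontriv.

Lemma natF_inj i j : (i < q)%N -> (j < q)%N -> i%:R = j%:R :> F -> i = j.
Proof.
have key k l : (k < l)%N -> (l < q)%N -> k%:R = l%:R :> F -> False.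
  move=> kl lq e; have : (l - k)%N%:R != 0 :> F.
    apply: (natF_neq0 iota q_prime q_char); rewrite subn_gt0 kl /=.
    by apply: leq_ltn_trans lq; apply: leq_subr.
  by rewrite natrB ?(ltnW kl) // e subrr eqxx.
move=> iq jq e; have [h|h|//] := ltngtP i j; exfalso; first exact: key e.
exact: key (esym e).
Qed.

Variable y : F.
Hypothesis sy : s y = y + 1.
Hypothesis gy : forall P, is_place iota P -> P y < 0 -> fixed s P /\ ~~ (q%:Z %| P y)%Z.

Let y0 : y != 0 := shift_neq0 hs sy.
Local Notation f := (y ^+ q - y).

Lemma AS_invariant : s f = f.
Proof.
have qn : [pchar F].-nat q by rewrite pnatE // (fmorph_pchar iota).
by rewrite (autB hs) (autX hs) sy (exprDn_pchar _ _ qn) expr1n; ring.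
Qed.

Lemma AS_fixed P : is_place iota P -> fixed s P -> f != 0 /\ P f = q%:Z * P y.
Proof.
move=> pP fP; have Py := shift_fixed ff hs sy pP fP.
have yq : y ^+ q != 0 by rewrite expf_neq0.
have h : vge P (P (y ^+ q) + 1) (- y).
  by right; rewrite (placeN pP) (placeX pP) //; move: Py g0; clear; nia.
have [h1 h2] := place_add_lt pP yq h.
by split=> //; rewrite h2 (placeX pP).
Qed.

Lemma AS_free w : is_place iota w -> ~ fixed s w -> vge w 0 f.
Proof.
move=> pw nf; have h : vge w 0 y.
  by right; rewrite leNgt; apply/negP => /(gy pw) [].
by apply: (vgeB pw) => //; have := vge_exp pw q h; rewrite mulr0.
Qed.

Lemma AS_generation P x : is_place iota P -> L0s [:: (P, 1)] x ->
  (forall k, x <> iota k) -> generates2 iota x y.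
Proof.
move=> pP hx nx; apply: (generation ff g0 hg hs q_prime hq pP hx nx) => i j hi hj.
rewrite !(iter_shift hs _ sy) => /addrI; exact: natF_inj.
Qed.

(** [y^q - y] is invariant with a single pole of order [3 q], that is 3 on the quotient, so it is a
    cubic polynomial in a coordinate with its pole at [P]. *)
Lemma one_pole_model P : is_place iota P -> fixed s P ->
  (forall w, is_place iota w -> fixed s w -> w = P) -> P y = -3%:Z ->
  exists d e l : K, exists x y : F, generates2 iota x y /\
    y ^+ q - y = x ^+ 3 + iota d * x ^+ 2 + iota e * x + iota l.
Proof.
move=> pP fP only Py.
have [x1 [hx1 x10 Px1]] := simple_pole ff g0 hg hs q_prime hq s_nontriv psi_le pP.
have [f0 Pf] := AS_fixed pP fP.
have hf : L0s [:: (P, 3%:Z)] f.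
  apply/L0P; split; first exact: AS_invariant.
  move=> w pw; rewrite pc_cons pc_nil addr0 (orb_fixedE q pP pw fP) /=.
  case: eqP => [<-|h]; last first.
    by rewrite mulr0 oppr0; apply: AS_free => // /(only w pw) e; apply: h.
  by right; rewrite Pf Py; clear; lia.
have [p [hp ef]] := L0_polynomial ff g0 hg hs q_prime hq s_nontriv pP hx1 Px1 hf.
have {}Px1 : P x1 = - q%:Z by rewrite Px1 orb_fixed.
move: ef; rewrite (evalKE _ _ hp) !big_ord_recl big_ord0 /= /bump /= !add1n addr0
  expr0 expr1 mulr1.
set c0 := p`_0; set c1 := p`_1; set c2 := p`_2; set c3 := p`_3 => ef.
have vx : vge P (- q%:Z) x1 by right; rewrite Px1.
(* Otherwise the pole order would be at most [2 q]. *)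
have c30 : c3 != 0.
  apply/eqP => e3; have := vge_ge (m := - (2%:Z * q%:Z)) (v := P) (u := f) _ f0.
  rewrite Pf Py => /(_ _) h; suff : - (2%:Z * q%:Z) <= q%:Z * -3%:Z by clear; lia.
  apply: h; rewrite ef e3 rmorph0 mul0r addr0.
  apply: (vgeD pP); first by apply: vgeK => //; clear; lia.
  apply: (vgeD pP); apply: vgeZ => //; first by apply: vge_le vx; clear; lia.
  by apply: vge_le (vge_exp pP 2 vx); clear; lia.
(* Scaling the coordinate by a cube root of the leading coefficient makes the cubic monic. *)
have [t ht] := closed_root c3 (isT : (0 < 3)%N).
have t0 : t != 0 by apply/eqP => e; move: c30; rewrite -ht e expr0n eqxx.
have it0 : iota t != 0 by rewrite fmorph_eq0.
exists (c2 / t ^+ 2), (c1 / t), c0, (iota t * x1), y; split.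
  apply: (AS_generation pP).
    by apply: subspZ hx1; apply: subsp_L0.
  apply: (not_const_of_pole pP); rewrite (placeZ pP) // Px1; clear; lia.
rewrite ef -ht !rmorphM !fmorphV !rmorphXn /=; field.
by [].
Qed.

(** [P1] and [P2] are placed at 0 and 1, and infinity at a place [Q] not fixed by [s]. Then
    [M = x (x - 1) (y^q - y)] has at most a double pole at infinity and no other, so it is a
    quadratic polynomial. At [P1] and [P2] zeros and poles cancel exactly, so [M] does not vanish
    there, which is the coprimality. *)
Lemma two_pole_model P1 P2 : is_place iota P1 -> fixed s P1 -> is_place iota P2 ->
  fixed s P2 -> P1 != P2 -> (forall w, is_place iota w -> fixed s w -> w = P1 \/ w = P2) ->
  P1 y = -1 -> P2 y = -1 ->
  exists a b c : K,
    [/\ (a, b, c) != (0, 0, 0),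
        coprimep (a *: 'X^2 + b *: 'X + c%:P) ('X * ('X - 1)) &
        exists x y : F, generates2 iota x y /\
          y ^+ q - y = (iota a * x ^+ 2 + iota b * x + iota c) / (x * (x - 1))].
Proof.
move=> p1 f1 p2 f2 n12 only y1 y2.
have [z [hz z0 Pz]] := simple_pole ff g0 hg hs q_prime hq s_nontriv psi_le p1.
have {}Pz : P1 z < 0 by rewrite Pz (orb_fixedE q p1 p1 f1) eqxx oppr_lt0.
have [k hk] := residue ff p2 (vge_at_fixed p1 p2 f1 (contra_neq (@esym _ _ _) n12) hz).
(* [z] has a pole at [P1] and value [k] at [P2], so neither is a zero of [z - (k + 1)], and every
   zero of it is a place not fixed by [s]. *)
pose u := z - iota (k + 1).
have Pu : P1 u < 0.
  have z1 := @not_const_of_pole _ _ iota P1 z p1 Pz.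
  have h : vge P1 (P1 z + 1) (- iota (k + 1)).
    by apply: (vgeN p1); apply: (vgeK p1); move: Pz; clear; lia.
  by have [_ ->] := place_add_lt p1 z0 h.
have nu := not_const_of_pole p1 Pu.
have [Q pQ Qu] : exists2 Q, is_place iota Q & 0 < Q u.
  apply: contrapT => hno.
  have [w pw|c hc] := @const_of_regular _ _ _ ff _ hg u^-1.
    right; rewrite (placeV pw); last by apply/eqP => e; apply: (nu 0); rewrite rmorph0.
    by rewrite oppr_ge0 leNgt; apply/negP => h; apply: hno; exists w.
  by apply: (nu c^-1); rewrite fmorphV -hc invrK.
have nQ1 : P1 != Q by apply/eqP => e; move: Qu Pu; rewrite e; clear; lia.
have nQ2 : P2 != Q.
  apply/eqP => e; have h1 : vge P2 1 u by right; move: Qu; rewrite e; clear; lia.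
  have := vgeB p2 hk h1.
  have -> : z - iota k - u = 1 by rewrite /u rmorphD rmorph1; ring.
  by move=> /vge_ge; rewrite oner_eq0 (place1 p2) => /(_ isT).
have nfQ : ~ fixed s Q.
  by move=> /(only Q pQ) [e|e]; [move: nQ1|move: nQ2]; rewrite e eqxx.
have oQ P : fixed s P -> orbs Q P = 0%N.
  move=> fP; apply/eqP/negPn/negP => /(orb_to_fixed q0 hq fP) e.
  by apply: nfQ; rewrite e.
have [x0 [hx0 _ Qx0]] := simple_pole ff g0 hg hs q_prime hq s_nontriv psi_le pQ.
have {}Qx0 : Q x0 < 0 by rewrite Qx0; have := orb_pos s q0 Q; clear; lia.
have reg P x : is_place iota P -> fixed s P -> L0s [:: (Q, 1)] x -> vge P 0 x.
  move=> pP fP /L0P [_ /(_ P pP)]; rewrite pc_cons pc_nil mul1r addr0 oQ //.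
have zo P x : is_place iota P -> L0s [:: (Q, 1)] x -> vge P 1 x -> x != 0 ->
    forall w, is_place iota w -> w x = (orbs P w)%:Z - (orbs Q w)%:Z.
  move=> pP hx vx xn0; apply: (zero_orbit ff g0 hg hs q_prime hq s_nontriv pQ pP hx).
  exact: vge_ge vx xn0.
have lin x c : L0s [:: (Q, 1)] x -> L0s [:: (Q, 1)] (x - iota c).
  by move=> hx; apply: subspB hx (L0_const ff hg q hs c pQ); apply: subsp_L0.
have nx0 := not_const_of_pole pQ Qx0.
have [c1 hc1] := residue ff p1 (reg _ _ p1 f1 hx0).
pose x1 := x0 - iota c1; have hx1 : L0s [:: (Q, 1)] x1 := lin _ c1 hx0.
have x10 : x1 != 0 by rewrite subr_eq0; apply/eqP/nx0.
have [c2 hc2] := residue ff p2 (reg _ _ p2 f2 hx1).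
have c20 : c2 != 0.
  apply/eqP => e; move: hc2; rewrite e rmorph0 subr0 => /vge_ge /(_ x10).
  by rewrite (zo P1) // oQ // (orb_fixedE q p1 p2 f1) (negPf n12).
pose x := iota c2^-1 * x1.
have hx : L0s [:: (Q, 1)] x by apply: subspZ hx1; apply: subsp_L0.
have x0' : x != 0 by rewrite mulf_neq0 // fmorph_eq0 invr_eq0.
have h1 : vge P1 1 x by apply: vgeZ.
have e2 : x - 1 = iota c2^-1 * (x1 - iota c2).
  by rewrite mulrBr -rmorphM mulVf // rmorph1.
have h2 : vge P2 1 (x - 1) by rewrite e2; apply: vgeZ.
have hx' : L0s [:: (Q, 1)] (x - 1) by rewrite -(rmorph1 iota); apply: lin.
have x1' : x - 1 != 0.
  rewrite e2 mulf_neq0 ?fmorph_eq0 ?invr_eq0 // /x1 -addrA -opprD -rmorphD subr_eq0.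
  exact/eqP/nx0.
have v1 := zo P1 x p1 hx h1 x0'; have v2 := zo P2 (x - 1) p2 hx' h2 x1'.
have Qx : Q x = - (orbs Q Q)%:Z.
  by rewrite v1 // (orb_fixedE q p1 pQ f1) (negPf nQ1) sub0r.
have nx : forall c, x <> iota c.
  by apply: (not_const_of_pole pQ); rewrite Qx; have := orb_pos s q0 Q; clear; lia.
have [fn0 _] := AS_fixed p1 f1.
pose M := x * (x - 1) * f; have M0 : M != 0 by rewrite mulf_neq0 // mulf_neq0.
have vM w : is_place iota w -> w M = w x + w (x - 1) + w f.
  by move=> pw; rewrite -(placeM pw x0' x1') -(placeM pw (mulf_neq0 x0' x1') fn0).
have M1 : P1 M = 0.
  rewrite vM // v1 // v2 // !oQ // (AS_fixed p1 f1).2 y1 (orb_fixed _ f1).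
  by rewrite (orb_fixedE q p2 p1 f2) eq_sym (negPf n12); clear; lia.
have M2 : P2 M = 0.
  rewrite vM // v1 // v2 // !oQ // (AS_fixed p2 f2).2 y2 (orb_fixed _ f2).
  by rewrite (orb_fixedE q p1 p2 f1) (negPf n12); clear; lia.
have hM : L0s [:: (Q, 2%:Z)] M.
  split.
    have [sx _] := hx; have [sx' _] := hx'.
    by rewrite /M (autM hs) [s (x * _)](autM hs) sx sx' AS_invariant.
  right=> w pw; rewrite pc_cons pc_nil addr0 /=.
  have [fw|nfw] := pselect (fixed s w).
    by have [->|->] := only w pw fw; rewrite ?M1 ?M2 oQ.
  have hf := vge_ge (AS_free pw nfw) fn0.
  rewrite vM // v1 // v2 // (orb_fixedE q p1 pw f1) (orb_fixedE q p2 pw f2).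
  by case: (P1 == w); case: (P2 == w); move: hf; clear; lia.
have [p [hp eM]] := L0_polynomial ff g0 hg hs q_prime hq s_nontriv pQ hx Qx hM.
move: eM; rewrite (evalKE _ _ hp) !big_ord_recl big_ord0 /= /bump /= !add1n addr0
  expr0 expr1 mulr1.
set c := p`_0; set b := p`_1; set a := p`_2 => eM.
have vK m e : is_place iota m -> vge m 0 (iota e) by move=> pm; apply: vgeK.
have c0 : c != 0.
  apply/eqP => e; have : vge P1 1 M.
    rewrite eM e rmorph0 add0r.
    have -> : iota b * x + iota a * x ^+ 2 = x * (iota b + iota a * x) by ring.
    apply: (vge_mulr p1) => //; apply: (vgeD p1); first exact: vK.
    by apply: vgeZ => //; apply: vge_le h1.
  by move=> /vge_ge /(_ M0); rewrite M1.
have abc0 : a + b + c != 0.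
  apply/eqP => e; have : vge P2 1 M.
    have -> : M = (x - 1) * (iota a * (x - 1) + iota (a + a + b)) + iota (a + b + c).
      by rewrite eM !rmorphD; ring.
    rewrite e rmorph0 addr0.
    apply: (vge_mulr p2) => //; apply: (vgeD p2); last exact: vK.
    by apply: vgeZ => //; apply: vge_le h2.
  by move=> /vge_ge /(_ M0); rewrite M2.
exists a, b, c; split.
- by apply/eqP => -[_ _ e]; rewrite e eqxx in c0.
- have ep t : (a *: 'X^2 + b *: 'X + c%:P).[t] = a * t ^+ 2 + b * t + c.
    by rewrite !hornerD !hornerZ hornerXn hornerX hornerC.
  rewrite coprimepMr coprimepX -polyC1 coprimep_XsubC /root !ep.
  by rewrite expr1n !mulr1 expr0n !mulr0 !add0r c0 abc0.
exists x, y; split; first exact: AS_generation pQ hx nx.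
have -> : iota a * x ^+ 2 + iota b * x + iota c = M by rewrite eM; ring.
by rewrite /M mulrAC mulfV ?mul1r // mulf_neq0.
Qed.

End WildEquations.

(** * Roots of unity and the final case analysis *)

Section Conclusion.
Variables (K : closedFieldType) (F : fieldType) (iota : {rmorphism K -> F}).

(** A root [z] of [1 + X + ... + X^(q-1)] has order dividing the prime [q], and [z = 1] would give
    [q = 0] in [K]. *)
Lemma primitive_root_exists q : prime q -> q \notin [pchar K] ->
  exists z : K, q.-primitive_root z.
Proof.
move=> q_prime nq; have q0 := prime_gt0 q_prime; have q1 := prime_gt1 q_prime.
pose p : {poly K} := \poly_(i < q) 1.
have [|z /rootP pz] := closed_rootP p _.
  by rewrite size_poly_eq ?oner_eq0 // gtn_eqF.
have {}pz : \sum_(i < q) z ^+ i = 0.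
  by move: pz; rewrite horner_poly; under eq_bigr => i _ do rewrite mul1r.
have zq : z ^+ q = 1.
  by apply/eqP; rewrite -subr_eq0 subrX1 pz mulr0.
have [m hm mq] := prim_order_exists q0 zq; exists z.
move: mq => /(primeP q_prime).2 /orP [/eqP em|/eqP <- //].
have z1 : z = 1 by have := prim_expr_order hm; rewrite em expr1.
move: pz; rewrite z1; under eq_bigr => i _ do rewrite expr1n.
rewrite sumr_const card_ord => e; move: nq.
by rewrite inE q_prime /= e eqxx.
Qed.

End Conclusion.

Theorem theorem4p2 (K : closedFieldType) (F : fieldType)
    (iota : {rmorphism K -> F}) (g : nat) :
  function_field iota -> (2 < g)%N -> prime g.+1 ->
  genus iota g -> q_curve iota g.+1 ->
  ((g.+1 \notin [pchar K]) ->
     exists (a : K) (r s t : nat),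
       [/\ a != 0 /\ a != 1,
           (0 < r <= g)%N /\ (0 < s <= g)%N /\ (0 < t <= g)%N,
           ((r + s + t) %% g.+1 != 0)%N &
           exists x y : F, generates2 iota x y /\
             y ^+ g.+1 = x ^+ r * (x - 1) ^+ s * (x - iota a) ^+ t])
  /\
  ((g.+1 \in [pchar K]) ->
     (exists a b c : K,
        [/\ (a, b, c) != (0, 0, 0),
            coprimep (a *: 'X^2 + b *: 'X + c%:P) ('X * ('X - 1)) &
            exists x y : F, generates2 iota x y /\
              y ^+ g.+1 - y = (iota a * x ^+ 2 + iota b * x + iota c) / (x * (x - 1))])
     \/
     (exists d e l : K, exists x y : F, generates2 iota x y /\
        y ^+ g.+1 - y = x ^+ 3 + iota d * x ^+ 2 + iota e * x + iota l)).
Proof.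
move=> ff g2 q_prime hg [_ [s [hs hq [f0 hf]]]].
have s_nontriv : exists f, s f != f by exists f0.
have g0 : (0 < g)%N by apply: leq_trans g2.
split=> [tame|wild].
  have [z0 hz0] := primitive_root_exists q_prime tame.
  have [i [/andP [i0 iq] y0 sy]] := eigT_exists (lam := fun i => z0 ^+ i) hs q_prime hq
    (prim_lam hz0) hf (expr0 z0).
  apply: (tame_model ff g2 hg hs q_prime hq s_nontriv _ y0 sy).
  (* The eigenvalue [z0^i] with [0 < i < q] is again primitive since [q] is prime. *)
  by rewrite prim_root_exp_coprime // coprime_sym prime_coprime // gtnNdvd.
have [y [sy gy]] := good_shift_exists ff g2 hg hs q_prime wild hq s_nontriv.
have [S [uS hS sumS]] := wild_count ff g2 hg hs q_prime wild hq s_nontriv sy gy.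
have neg P : P \in S -> [/\ is_place iota P, fixed s P & P y < 0].
  by move=> /hS [pP fP]; split=> //; apply: (shift_fixed ff hs sy).
(* Each fixed place contributes at least 2 to the total of 4: either one place with [P y = -3], or
   two with [P y = -1]. *)
case: S uS hS sumS neg => [|P1 [|P2 S]] uS hS sumS neg.
- by move: sumS; rewrite big_nil.
- have [p1 f1 n1] := neg P1 (mem_head _ _); right.
  apply: (one_pole_model ff g2 hg hs q_prime wild hq s_nontriv sy gy p1 f1).
    by move=> w pw fw; have := (hS w).2 (conj pw fw); rewrite mem_seq1 => /eqP.
  by move: sumS; rewrite big_seq1; clear; lia.
have [p1 f1 n1] := neg P1 (mem_head _ _).
have [|p2 f2 n2] := neg P2; first by rewrite !in_cons eqxx orbT.
have rest : 2%:Z * (size S)%:Z <= \sum_(P <- S) (1 - P y).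
  have {}neg P : P \in S -> P y < 0.
    by move=> hP; have [] := neg P => //; rewrite !in_cons hP !orbT.
  elim: S neg {uS hS sumS} => [|P S IH] neg; first by rewrite big_nil.
  have {}IH := IH (fun Q hQ => neg Q (mem_behead (s := P :: S) hQ)).
  have := neg P (mem_head _ _); move: IH; rewrite big_cons /=.
  by move: (P y) (\sum_(_ <- _) _) => c d; clear; lia.
move: sumS; rewrite !big_cons => sumS.
have [y1 [y2 S0]] : P1 y = -1 /\ P2 y = -1 /\ size S = 0%N.
  by move: sumS rest n1 n2; move: (P1 y) (P2 y) (\sum_(_ <- _) _) => a b c; clear; lia.
case: S S0 uS hS {neg rest sumS} => // _ uS hS; left.
apply: (two_pole_model ff g2 hg hs q_prime wild hq s_nontriv sy gy p1 f1 p2 f2 _ _ y1 y2).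
  by apply: contraTneq uS => ->; rewrite /= mem_seq1 eqxx.
move=> w pw fw; have := (hS w).2 (conj pw fw); rewrite !in_cons in_nil orbF.
by move=> /orP [] /eqP; [left|right].
Qed.
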